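(* Let $T$ be a homogeneous operator with an associated projective representation $\pi$ of Möb of one of the following two forms (up to equivalence): (i) $\pi=\pi_1\oplus\pi_2\oplus\pi_3$, a direct sum of three irreducible projective representations, one of which is a Continuous series representation, another a holomorphic Discrete series representation, and the remaining one an anti-holomorphic Discrete series representation; (ii) $\pi=\pi_1\oplus\pi_2\oplus\pi_3\oplus\pi_4$, where two of the summands are holomorphic Discrete series representations and the other two are anti-holomorphic Discrete series representations. Then $T$ is reducible.
   Context: All Hilbert spaces are complex and separable and all operators are bounded and linear. Möb is the locally compact group of maps $\phi_{\theta,a}(z)=e^{i\theta}\frac{z-a}{1-\bar a z}$, $\theta\in\mathbb R$, $a\in\mathbb D$. An operator $T$ is homogeneous if its spectrum lies in $\overline{\mathbb D}$ and $\phi(T)$ is unitarily equivalent to $T$ for all $\phi\in$ Möb. A projective representation of Möb on $H$ is a Borel map $\pi$ into the unitary group of $H$ with $\pi(1)=I$ and $\pi(gh)=m(g,h)\pi(g)\pi(h)$ for a Borel function $m$ (the multiplier) with values in $\mathbb T$. Two projective representations $\pi_1,\pi_2$ are equivalent if $\pi_1(g)=f(g)U^*\pi_2(g)U$ for a unitary $U$ and a Borel function $f:\text{Möb}\to\mathbb T$. $\pi$ is associated with $T$ if $\phi(T)=\pi(\phi)^*T\pi(\phi)$ for all $\phi\in$ Möb. Reducible means having a non-trivial reducing subspace. Fix for each $\phi=\phi_{\theta,a}$, $\theta\in(-\pi,\pi]$, the branch $\log\phi'(z)=i\theta+\log(1-|a|^2)-2\log(1-\bar az)$ (principal logarithm)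 and put $\phi'(z)^{\lambda/2}=\exp(\tfrac\lambda2\log\phi'(z))$. For parameters $\lambda,\mu$, $R_{\lambda,\mu}$ is given by $(R_{\lambda,\mu}(\phi^{-1})f)(z)=\phi'(z)^{\lambda/2}|\phi'(z)|^{\mu}f(\phi(z))$. Continuous series (functions on $\mathbb T$): the Principal series $P_{\lambda,s}=R_{\lambda,\mu}$, $-1<\lambda\le1$, $s$ purely imaginary, $\mu=\frac{1-\lambda}2+s$, on $L^2(\mathbb T)$ (with $\{z^n\}$ orthonormal); and the Complementary series $C_{\lambda,\sigma}=R_{\lambda,\mu}$, $-1<\lambda<1$, $0<\sigma<\frac12(1-|\lambda|)$, $\mu=\frac{1-\lambda}2+\sigma$, on the Hilbert space with orthogonal basis $\{z^n\}_{n\in\mathbb Z}$ and $\|z^n\|^2=\prod_{k=0}^{|n|-1}\frac{k\pm\frac\lambda2+\frac12-\sigma}{k\pm\frac\lambda2+\frac12+\sigma}$ (sign $+$ for $n\ge0$, $-$ for $n<0$). All of these are irreducible except $P_{1,0}$. Discrete series: for $\lambda>0$ the holomorphic Discrete series $D_\lambda^+=R_{\lambda,0}$ acts on the Hilbert space $H^{(\lambda)}$ of holomorphic functions on $\mathbb D$ with orthogonal basis $\{z^n\}_{n\ge0}$, $\|z^n\|^2=\frac{\Gamma(n+1)\Gamma(\lambda)}{\Gamma(n+\lambda)}$; the anti-holomorphic Discrete series $D_\lambda^-$ acts on the same space $H^{(\lambda)}$ by $D_\lambda^-(\phi)=D_\lambda^+(\phi^* )$, $\phi^*(z)=\overline{\phi(\bar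 z)}$, the branch being the conjugate one, i.e. $(D^-_\lambda(\phi^{-1})f)(z)=\overline{\phi'(\bar z)^{\lambda/2}}\,f(\phi^*(z))$. *)

(* Defs.v *)
(* The complex numbers are R[i] for R : realType; R[i]^o is the same type with
   the topology and norm of a normed space over R[i]. *)
From HB Require Import structures.
From mathcomp Require Import all_boot all_order all_algebra.
From mathcomp Require Import sesquilinear complex.
From mathcomp Require Import all_classical all_reals all_analysis.
From mathcomp Require Import ring.
Set Implicit Arguments.
Unset Strict Implicit.
Unset Printing Implicit Defensive.
Import Order.TTheory GRing.Theory Num.Theory Num.Def.
Import numFieldNormedType.Exports.
Local Open Scope classical_set_scope.
Local Open Scope ring_scope.

HB.mixin Record CompleteNormedModule_isHilbert (R : realType) H
    & CompleteNormedModule (R[i] : numFieldType) H := {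
  inner : {dot H for (@conjC R[i])} ;
  inner_norm : forall x : H, inner x x = `|x| ^+ 2 ;
  hilbert_separable : exists D : set H, countable D /\ dense D
}.

#[short(type="hilbertType")]
HB.structure Definition Hilbert (R : realType) :=
  { H of CompleteNormedModule_isHilbert R H &
         CompleteNormedModule (R[i] : numFieldType) H }.

Section Operators.
Context {R : realType}.
Implicit Types H K : hilbertType R.

Definition bounded_op H (T : H -> H) : Prop :=
  linear T /\ exists M : R[i], forall x, `|T x| <= M * `|x|.

Definition unitary H K (U : H -> K) : Prop :=
  [/\ linear U, forall x y, inner (U x) (U y) = inner x y
    & forall y, exists x, U x = y].

(* The adjoint T^*, unique when it exists; every bounded operator and every
   unitary map has one. *)
Definition adjoint H K (T : H -> K) : K -> H :=
  xget (cst 0) [set S | forall x y, inner (T x) y = inner x (S y)].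

Definition inverse_op H (T S : H -> H) : Prop :=
  [/\ bounded_op S, cancel T S & cancel S T].

(* The bounded inverse T^-1 of T, and the zero operator if there is none. *)
Definition op_inv H (T : H -> H) : H -> H :=
  xget (cst 0) [set S | inverse_op T S].

Definition spectrum H (T : H -> H) : set R[i] :=
  [set z | ~ exists S, inverse_op (fun x => T x - z *: x) S].

Definition closed_subspace H (M : set H) : Prop :=
  [/\ closed M, M 0 & forall (a : R[i]) x y, M x -> M y -> M (a *: x + y)].

Definition orthocomp H (M : set H) : set H :=
  [set y | forall x, M x -> inner x y = 0].

Definition invariant H (T : H -> H) (M : set H) : Prop :=
  forall x, M x -> M (T x).

Definition nontrivial H (M : set H) : Prop := M != [set 0] /\ M != setT.

Definition reducible H (T : H -> H) : Prop :=
  exists M : set H, [/\ closed_subspace M, nontrivial M, invariant T M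
                      & invariant T (orthocomp M)].

Definition orthogonal_basis H (I : Type) (e : I -> H) : Prop :=
  [/\ forall i, e i != 0, forall i j, i <> j -> inner (e i) (e j) = 0
    & forall x, (forall i, inner x (e i) = 0) -> x = 0].

End Operators.

Section ComplexFunctions.
Context {R : realType}.
Local Notation C := (R[i]).
Implicit Types (z : C) (t : R).

Definition cnorm z : R := complex.Re `|z|.

Definition cis t : C := Complex (cos t) (sin t).

Definition cexp z : C := real_complex R (expR (complex.Re z)) * cis (complex.Im z).

(* This takes its values in ]-pi, pi] for z != 0. *)
Definition carg z : R :=
  let t := acos (complex.Re z / cnorm z) in
  if 0 <= complex.Im z then t else - t.

Definition clog z : C := Complex (ln (cnorm z)) (carg z).

Definition Gamma (x : R) : R :=
  \int[lebesgue_measure]_(t in `]0, +oo[) (t `^ (x - 1) * expR (- t)).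

(* Functions on the unit circle are functions F : C -> C of which only the
   values F (cis t) matter. *)
Definition square_integrable (F : C -> C) : Prop :=
  [/\ measurable_fun `[- pi, pi] (fun t : R => complex.Re (F (cis t))),
      measurable_fun `[- pi, pi] (fun t : R => complex.Im (F (cis t)))
    & (@lebesgue_measure R).-integrable `[- pi, pi]
        (fun t => (cnorm (F (cis t)) ^+ 2)%:E)].

Definition fourier (F : C -> C) (n : int) : C :=
  let G t := F (cis t) * cis (- (n%:~R * t)) in
  real_complex R (2 * pi)^-1 *
  Complex (\int[lebesgue_measure]_(t in `[- pi, pi]) complex.Re (G t))
          (\int[lebesgue_measure]_(t in `[- pi, pi]) complex.Im (G t)).

End ComplexFunctions.

Lemma mob_mul_aux (F : fieldType) (r s a b a' b' z : F) :
  1 + b' * s * b != 0 -> 1 + a / s * a' != 0 -> s != 0 -> 1 - a' * z != 0 ->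
  1 - b' * (s * (z - b) / (1 - a' * z)) != 0 ->
  r * s * ((1 + a / s * a') / (1 + b' * s * b)) *
  (z - (b + s^-1 * a) / (1 + a / s * a')) /
  (1 - (a' + s * b') / (1 + b' * s * b) * z) =
  r * (s * (z - b) / (1 - a' * z) - a) /
  (1 - b' * (s * (z - b) / (1 - a' * z))).
Proof.
move=> u0 v0 s0 z0 w0.
have {}v0 : s + a * a' != 0.
  suff -> : s + a * a' = (1 + a / s * a') * s by exact: mulf_neq0.
  by field.
have {}w0 : 1 - a' * z - b' * s * (z - b) != 0.
  suff -> : 1 - a' * z - b' * s * (z - b) =
            (1 - b' * (s * (z - b) / (1 - a' * z))) * (1 - a' * z).
    exact: mulf_neq0.
  by field.
by field; rewrite z0 s0 u0 v0 [b' * (s * _)]mulrA w0.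
Qed.

Section Mob.
Context {R : realType}.
Local Notation C := (R[i]).

(* Mob (e^(i theta), a) is the map phi_(theta, a); both coordinates are
   determined by the map. *)
Record mob := Mob {
  mob_pair : (C^o * C^o)%type ;
  mob_pairP : (`|mob_pair.1| == 1) && (`|mob_pair.2| < 1) }.
HB.instance Definition _ := [isSub for mob_pair].
HB.instance Definition _ := [Choice of mob by <:].
HB.instance Definition _ := Topological.copy mob (initial_topology mob_pair).

Definition mob_rot (g : mob) : C := (mob_pair g).1.
Definition mob_pt (g : mob) : C := (mob_pair g).2.

Definition mob_fun (g : mob) (z : C) : C :=
  mob_rot g * (z - mob_pt g) / (1 - (mob_pt g)^* * z).

Lemma norm_mob_rot g : `|mob_rot g| = 1.
Proof. by have /andP[/eqP] := mob_pairP g. Qed.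

Lemma norm_mob_pt g : `|mob_pt g| < 1.
Proof. by have /andP[] := mob_pairP g. Qed.

Lemma mob_rot_neq0 g : mob_rot g != 0.
Proof. by rewrite -normr_eq0 norm_mob_rot oner_eq0. Qed.

Lemma one_add_neq0 (z : C) : `|z| < 1 -> 1 + z != 0.
Proof.
move=> z1; apply/eqP => /eqP; rewrite addr_eq0 => /eqP zN.
by move: z1; rewrite -normrN -zN normr1 ltxx.
Qed.

Lemma norm_disc_add (b c : C) : `|b| < 1 -> `|c| < 1 ->
  `|b + c| < `|1 + c^* * b|.
Proof.
move=> b1 c1; rewrite -(ltr_pXn2r (n := 2)) ?nnegrE// !normCK.
rewrite !(rmorphD, rmorphM, rmorph1) /= conjCK -subr_gt0.
have -> : (1 + c^* * b) * (1 + c * b^*) - (b + c) * (b^* + c^*)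
        = (1 - b * b^*) * (1 - c * c^*) by ring.
by rewrite -!normCK mulr_gt0// subr_gt0 expr_lt1.
Qed.

Fact mob1_proof : (`|((1, 0) : C^o * C^o).1| == 1) && (`|(0 : C^o)| < 1).
Proof. by rewrite /= normr1 normr0 eqxx ltr01. Qed.
Definition mob1 : mob := Mob mob1_proof.

Definition mob_inv_pair (g : mob) : (C^o * C^o)%type :=
  ((mob_rot g)^*, - (mob_rot g * mob_pt g)).
Fact mob_inv_proof g :
  (`|(mob_inv_pair g).1| == 1) && (`|(mob_inv_pair g).2| < 1).
Proof.
by rewrite /= norm_conjC normrN normrM norm_mob_rot mul1r eqxx norm_mob_pt.
Qed.
Definition mob_inv (g : mob) : mob := Mob (mob_inv_proof g).

(* the coordinates of the composite g o h *)
Definition mob_mul_pair (g h : mob) : (C^o * C^o)%type :=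
  let u := 1 + (mob_pt g)^* * mob_rot h * mob_pt h in
  (mob_rot g * mob_rot h * (u^* / u),
   (mob_pt h + (mob_rot h)^* * mob_pt g) / u^*).
Fact mob_mul_proof g h :
  (`|(mob_mul_pair g h).1| == 1) && (`|(mob_mul_pair g h).2| < 1).
Proof.
rewrite /mob_mul_pair; set u := 1 + _.
have u0 : u != 0.
  apply: one_add_neq0; rewrite !normrM norm_conjC norm_mob_rot mulr1.
  by rewrite mulr_ilt1// norm_mob_pt.
rewrite /= !normrM !norm_mob_rot !mul1r !normfV norm_conjC.
rewrite divff ?normr_eq0// eqxx/= ltr_pdivrMr ?normr_gt0// mul1r.
have -> : u = 1 + ((mob_rot h)^* * mob_pt g)^* * mob_pt h.
  by rewrite rmorphM /= conjCK [mob_rot h * _]mulrC.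
apply: norm_disc_add; first exact: norm_mob_pt.
by rewrite normrM norm_conjC norm_mob_rot mul1r norm_mob_pt.
Qed.
Definition mob_mul (g h : mob) : mob := Mob (mob_mul_proof g h).

Definition mob_star_pair (g : mob) : (C^o * C^o)%type :=
  ((mob_rot g)^*, (mob_pt g)^*).
Fact mob_star_proof g :
  (`|(mob_star_pair g).1| == 1) && (`|(mob_star_pair g).2| < 1).
Proof. by rewrite /= !norm_conjC norm_mob_rot eqxx norm_mob_pt. Qed.
Definition mob_star (g : mob) : mob := Mob (mob_star_proof g).

Lemma mob_den_neq0 (g : mob) (z : C) : `|z| <= 1 -> 1 - (mob_pt g)^* * z != 0.
Proof.
move=> z1; apply: one_add_neq0; rewrite normrN normrM norm_conjC.
by rewrite (le_lt_trans _ (norm_mob_pt g))// ler_piMr.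
Qed.

Lemma norm_mob_fun_le1 (g : mob) (z : C) : `|z| <= 1 -> `|mob_fun g z| <= 1.
Proof.
move=> z1; have d0 := mob_den_neq0 g z1.
rewrite /mob_fun !normrM normfV norm_mob_rot mul1r ler_pdivrMr ?normr_gt0// mul1r.
rewrite -(ler_pXn2r (n := 2)) ?nnegrE// !normCK.
rewrite !(rmorphB, rmorphM, rmorph1) /= conjCK -subr_ge0.
set a := mob_pt g; have -> : (1 - a^* * z) * (1 - a * z^*) -
   (z - a) * (z^* - a^*) = (1 - z * z^*) * (1 - a * a^*) by ring.
rewrite -!normCK mulr_ge0// subr_ge0 ?expr_le1// ltW//.
exact: norm_mob_pt.
Qed.

Lemma mob_fun1 z : mob_fun mob1 z = z.
Proof. by rewrite /mob_fun /mob_rot /mob_pt /= rmorph0 mul1r subr0 mul0r subr0 divr1. Qed.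

Lemma mob_funM (g h : mob) (z : C) : `|z| <= 1 ->
  mob_fun (mob_mul g h) z = mob_fun g (mob_fun h z).
Proof.
move=> z1; have := mob_den_neq0 g (norm_mob_fun_le1 h z1).
have := mob_den_neq0 h z1; have := mob_rot_neq0 h.
have : 1 + (mob_pt g)^* * mob_rot h * mob_pt h != 0.
  apply: one_add_neq0; rewrite !normrM norm_conjC norm_mob_rot mulr1.
  by rewrite mulr_ilt1// norm_mob_pt.
move=> u0; have := u0; rewrite -conjC_eq0.
have sV : (mob_rot h)^* = (mob_rot h)^-1.
  by rewrite [RHS]invC_norm norm_mob_rot expr1n invr1 mul1r.
rewrite /mob_fun.
have -> : mob_rot (mob_mul g h) = mob_rot g * mob_rot h *
  ((1 + (mob_pt g)^* * mob_rot h * mob_pt h)^* /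
   (1 + (mob_pt g)^* * mob_rot h * mob_pt h)) by [].
have -> : mob_pt (mob_mul g h) = (mob_pt h + (mob_rot h)^* * mob_pt g) /
   (1 + (mob_pt g)^* * mob_rot h * mob_pt h)^* by [].
move: u0; rewrite !(rmorphM, rmorphD, fmorphV, rmorph1) /= !conjCK sV.
exact: mob_mul_aux.
Qed.

Lemma mob_mulVg (g : mob) : mob_mul (mob_inv g) g = mob1.
Proof.
have sV : (mob_rot g)^* = (mob_rot g)^-1.
  by rewrite [RHS]invC_norm norm_mob_rot expr1n invr1 mul1r.
have s0 := mob_rot_neq0 g.
have a0 := @norm_mob_pt g.
have u0 : 1 - mob_pt g * (mob_pt g)^* != 0.
  by rewrite -normCK gt_eqF// subr_gt0 expr_lt1.
have E1 : mob_rot (mob_inv g) = (mob_rot g)^-1 by rewrite -sV.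
have E2 : mob_pt (mob_inv g) = - (mob_rot g * mob_pt g) by [].
apply: val_inj.
have -> : val (mob_mul (mob_inv g) g) =
  let u := 1 + (mob_pt (mob_inv g))^* * mob_rot g * mob_pt g in
  (mob_rot (mob_inv g) * mob_rot g * (u^* / u),
   (mob_pt g + (mob_rot g)^* * mob_pt (mob_inv g)) / u^*) by [].
have uE : 1 + (mob_pt (mob_inv g))^* * mob_rot g * mob_pt g =
          1 - mob_pt g * (mob_pt g)^*.
  by rewrite E2 rmorphN rmorphM /= sV; field.
have cE : (1 - mob_pt g * (mob_pt g)^*)^* = 1 - mob_pt g * (mob_pt g)^*.
  by rewrite rmorphB rmorphM rmorph1 /= conjCK [_^* * _]mulrC.
rewrite /= uE cE E1 E2 sV divff// mulVf// mulr1.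
by rewrite mulrN mulKf// subrr mul0r.
Qed.

Lemma mob_funV (g : mob) (z : C) : `|z| <= 1 ->
  mob_fun (mob_inv g) (mob_fun g z) = z.
Proof. by move=> z1; rewrite -mob_funM// mob_mulVg mob_fun1. Qed.

Definition mob_deriv (g : mob) (z : C) : C :=
  mob_rot g * (1 - `|mob_pt g| ^+ 2) / (1 - (mob_pt g)^* * z) ^+ 2.

Lemma is_derive_mob_fun (g : mob) (z : C) : `|z| <= 1 ->
  is_derive (z : C^o) (1 : C^o) (mob_fun g : C^o -> C^o) (mob_deriv g z).
Proof.
move=> z1; have d0 := mob_den_neq0 g z1.
have dD : is_derive (z : C^o) (1 : C^o)
    (fun w : C^o => (1 - (mob_pt g)^* * w) : C^o) (- (mob_pt g)^*).
  by apply: is_derive_eq; rewrite sub0r /GRing.scale /= mulr1.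
have dV : is_derive (z : C^o) (1 : C^o)
    (fun w : C^o => (1 - (mob_pt g)^* * w)^-1 : C^o)
    ((mob_pt g)^* / (1 - (mob_pt g)^* * z) ^+ 2).
  apply: DeriveDef; first exact: derivableV.
  by rewrite deriveV// derive_val /GRing.scale /= mulrNN mulrC.
have dN : is_derive (z : C^o) (1 : C^o)
    (fun w : C^o => (mob_rot g * (w - mob_pt g)) : C^o) (mob_rot g).
  by apply: is_derive_eq; rewrite subr0 /GRing.scale /= mulr1.
have -> : (mob_fun g : C^o -> C^o) =
    (fun w : C^o => (mob_rot g * (w - mob_pt g)) : C^o) *
    (fun w : C^o => (1 - (mob_pt g)^* * w)^-1 : C^o) by [].
apply: is_derive_eq; rewrite /GRing.scale /= /mob_deriv normCK.
by field.
Qed.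

(* mob_star g is phi^*(z) = conjugate of phi (conjugate of z). *)
Lemma mob_funC (g : mob) (z : C) : mob_fun (mob_star g) z = (mob_fun g z^*)^*.
Proof.
by rewrite /mob_fun !(rmorphM, rmorphB, fmorphV, rmorph1) /= !conjCK.
Qed.

(* i theta + log (1 - |a|^2) - 2 log (1 - conj(a) z) with theta in ]-pi, pi] *)
Definition log_mob_deriv (g : mob) (z : C) : C :=
  Complex (ln (1 - cnorm (mob_pt g) ^+ 2)) (carg (mob_rot g))
  - 2 * clog (1 - (mob_pt g)^* * z).

(* phi'(z)^(lam / 2) *)
Definition mob_deriv_pow (g : mob) (lam : R) (z : C) : C :=
  cexp (real_complex R (lam / 2) * log_mob_deriv g z).

(* |phi'(z)|^mu, for complex mu *)
Definition mob_deriv_norm_pow (g : mob) (mu z : C) : C :=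
  cexp (mu * real_complex R (ln (cnorm (mob_deriv g z)))).

(* R_{lambda, mu} (phi^-1), where phi is the argument g *)
Definition Rlm (lam : R) (mu : C) (g : mob) (F : C -> C) (z : C) : C :=
  mob_deriv_pow g lam z * mob_deriv_norm_pow g mu z * F (mob_fun g z).

End Mob.
Arguments mob R : clear implicits.
Arguments mob1 {R}.

Section Representations.
Context {R : realType}.
Local Notation C := (R[i]).
Implicit Types H K : hilbertType R.

(* phi(T) = e^(i theta) (T - a) (1 - conj(a) T)^-1 *)
Definition mob_op H (g : mob R) (T : H -> H) : H -> H :=
  let B := op_inv (fun x => x - (mob_pt g)^* *: T x) in
  fun x => mob_rot g *: (T (B x) - mob_pt g *: B x).

Definition homogeneous H (T : H -> H) : Prop :=
  spectrum T `<=` [set z | `|z| <= 1] /\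
  forall g : mob R, exists2 U : H -> H, unitary U
    & mob_op g T = adjoint U \o T \o U.

Definition borel_map (X Y : topologicalType) (f : X -> Y) : Prop :=
  forall A : set Y, <<s open >> A -> <<s open >> (f @^-1` A).

(* {ptws H -> H} is the space of maps with the topology of pointwise
   convergence: on the unitary group it induces the strong operator topology. *)
Definition projective_rep H (pi : mob R -> H -> H) : Prop :=
  [/\ forall g, unitary (pi g),
      pi mob1 = id,
      borel_map (pi : mob R -> {ptws H -> H})
    & exists m : (mob R * mob R)%type -> C^o,
      [/\ borel_map m, forall gh, `|m gh| = 1
        & forall g h x, pi (mob_mul g h) x = m (g, h) *: pi g (pi h x)]].

Definition equivalent_rep H K (pi : mob R -> H -> H) (rho : mob R -> K -> K) :
    Prop :=
  exists (f : mob R -> C^o) (U : H -> K),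
    [/\ borel_map f, forall g, `|f g| = 1, unitary U
      & forall g x, pi g x = f g *: adjoint U (rho g (U x))].

Definition associated H (pi : mob R -> H -> H) (T : H -> H) : Prop :=
  forall g : mob R, mob_op g T = adjoint (pi g) \o T \o pi g.

Definition irreducible_rep H (pi : mob R -> H -> H) : Prop :=
  forall M : set H, closed_subspace M -> (forall g, invariant (pi g) M) ->
    ~ nontrivial M.

(* rho is the orthogonal direct sum of the tau i, embedded by the V i. *)
Definition direct_sum_rep (I : finType) (E : I -> hilbertType R)
    (tau : forall i, mob R -> E i -> E i) K (rho : mob R -> K -> K) : Prop :=
  exists V : forall i, E i -> K,
    [/\ forall i, linear (V i),
        forall i x y, inner (V i x) (V i y) = inner x y,
        forall i j x y, i != j -> inner (V i x) (V j y) = 0,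
        forall x, exists v : forall i, E i, x = \sum_i V i (v i)
      & forall i g x, rho g (V i x) = V i (tau i g x)].

(* For a Hilbert space K with orthogonal basis e n = z^n, the vector v is the
   function F on the circle if its coordinates are the Fourier coefficients of
   F.  The square integrable functions fill up L^2(T) in the Principal series;
   in the Complementary series they form a dense subspace, as K also contains
   distributions. *)
Definition represents K (e : int -> K) (F : C -> C) (v : K) : Prop :=
  forall n, inner v (e n) = fourier F n * `|e n| ^+ 2.

Definition circle_rep (lam : R) (mu : C) (w : int -> R) K
    (pi : mob R -> K -> K) : Prop :=
  exists e : int -> K,
    [/\ orthogonal_basis e,
        forall n, `|e n| ^+ 2 = real_complex R (w n)
      & forall g F v, square_integrable F -> represents e F v ->
          represents e (Rlm lam mu g F) (pi (mob_inv g) v)].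

Definition principal_series K (pi : mob R -> K -> K) : Prop :=
  exists (lam : R) (s : C),
    [/\ -1 < lam <= 1, complex.Re s = 0
      & circle_rep lam (real_complex R ((1 - lam) / 2) + s) (fun=> 1) pi].

Definition compl_weight (lam sigma : R) (n : int) : R :=
  let eps : R := if 0 <= n then 1 else -1 in
  \prod_(k < `|n|%N) ((k%:R + eps * (lam / 2) + 1 / 2 - sigma) /
                      (k%:R + eps * (lam / 2) + 1 / 2 + sigma)).

Definition complementary_series K (pi : mob R -> K -> K) : Prop :=
  exists lam sigma : R,
    [/\ -1 < lam < 1, 0 < sigma < (1 - `|lam|) / 2
      & circle_rep lam (real_complex R ((1 - lam) / 2 + sigma))
          (compl_weight lam sigma) pi].

Definition continuous_series K (pi : mob R -> K -> K) : Prop :=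
  principal_series pi \/ complementary_series pi.

Definition disc : set C := [set z | `|z| < 1].

(* K is the Hilbert space H^(lambda) of holomorphic functions on the disc, the
   vector f being the function ev f. *)
Definition Hlam_space (lam : R) K (ev : K -> C -> C) : Prop :=
  [/\ forall z, disc z ->
        scalar (ev^~ z) /\ continuous (ev^~ z : K -> C^o),
      forall f g, {in disc, ev f =1 ev g} -> f = g,
      forall f z, disc z -> derivable (ev f : C^o -> C^o) z 1
    & exists e : nat -> K,
      [/\ orthogonal_basis e,
          forall n, `|e n| ^+ 2 =
            real_complex R (Gamma n.+1%:R * Gamma lam / Gamma (n%:R + lam))
        & forall n z, disc z -> ev (e n) z = z ^+ n]].

Definition holomorphic_discrete_series K (pi : mob R -> K -> K) : Prop :=
  exists (lam : R) (ev : K -> C -> C),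
    [/\ 0 < lam, Hlam_space lam ev
      & forall g f z, disc z ->
          ev (pi (mob_inv g) f) z = Rlm lam 0 g (ev f) z].

Definition antiholomorphic_discrete_series K (pi : mob R -> K -> K) : Prop :=
  exists (lam : R) (ev : K -> C -> C),
    [/\ 0 < lam, Hlam_space lam ev
      & forall g f z, disc z -> ev (pi (mob_inv g) f) z =
          (mob_deriv_pow g lam z^*)^* * ev f (mob_fun (mob_star g) z)].

End Representations.

(* Main.v *)
Require Import Defs.
From HB Require Import structures.
From mathcomp Require Import all_boot all_order all_algebra.
From mathcomp Require Import sesquilinear complex.
From mathcomp Require Import all_classical all_reals all_analysis.
From mathcomp Require Import ring lra.
Set Implicit Arguments.
Unset Strict Implicit.
Unset Printing Implicit Defensive.
Import Order.TTheory GRing.Theory Num.Theory Num.Def.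
Import numFieldNormedType.Exports.
Local Open Scope classical_set_scope.
Local Open Scope ring_scope.

Local Notation "x %:C" := (real_complex _ x).

(* The rotations act diagonally on the vectors z^n; give the n-th one the weight
   x = kappa + n (holomorphic, kappa = lambda / 2), x = - kappa - n
   (anti-holomorphic) or x = lambda / 2 + n (continuous series, with
   kappa = lambda / 2 + mu).  Up to O(r^2) the boost (1, r)^-1 then acts in every
   summand by
     b_x |-> b_x + r ((x + kappa) b_(x+1) - (x - kappa) b_(x-1)).
   Covariance under the rotations makes T raise weights by 1,
   T b_(j,x) = sum_i t_ij(x) b_(i,x+1), and covariance under the boosts gives,
   to first order,
     (x + 1 - k_i) t_ij(x) - t_ij(x-1) (x - k_j) = delta_ij,
     (x + 1 + k_i) t_ij(x) - t_ij(x+1) (x + k_j) = sum_l t_il(x+1) t_lj(x).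
   These recurrences, started at the ends of the supports of the discrete series,
   decouple the continuous summand when x - kappa and x + kappa never vanish, that
   is, away from P_{1,0} = D_1^+ + D_1^-.  With two discrete series of each kind
   the only possible coupling goes from anti-holomorphic to holomorphic, at the
   weight -1/2 and between summands with lambda = 1.  A summand with another
   lambda of a coupled pair's kind splits off; otherwise all lambda are 1, T is
   two copies of the shift coupled by a single 2 x 2 matrix, and the singular
   vectors of that matrix split T. *)

(** * Hilbert space geometry *)

(** The definitions of the series say nothing directly about derivatives, so the boosts are
    differentiated weakly: only coordinates along weight vectors are expanded, with an error
    [M * r ^+ 2] whose constant may depend on the vectors involved. This suffices because both [T]
    and its adjoint send a weight vector to a finite sum of weight vectors, so [T] can be applied to
    such an expansion. The identity that is differentiated is the covariance of [T] with its
    denominator cleared, T rho(g^-1) (x + r T x) = rho(g^-1) (T x + r x); its components of weights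
    x and x + 2 are the two recurrences. Rotations by angles in [0, 1] and boosts with r < 1/8
    suffice, and there the principal branches are explicit. P_{1,0} is cut between the weights -1/2
    and 1/2, where the ladder coefficients vanish, and its halves are treated as two more discrete
    summands. Ladder data show these halves to be invariant only to first order in r; this is why
    different summands are required to stay orthogonal under the boosts only up to O(r^2). *)

Section Inner.
Context {R : realType} {H : hilbertType R}.
Local Notation C := (R[i]).
Implicit Types (x y z v : H) (a : C).

Lemma innerDl x y z : inner (x + y) z = inner x z + inner y z.
Proof. exact: linearDl. Qed.
Lemma innerZl a x z : inner (a *: x) z = a * inner x z.
Proof. exact: linearZl_LR. Qed.
Lemma innerDr x y z : inner z (x + y) = inner z x + inner z y.
Proof. exact: linearDr. Qed.
Lemma innerZr a x z : inner z (a *: x) = a^* * inner z x.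
Proof. exact: linearZr_LR. Qed.
Lemma innerC x y : inner x y = (inner y x)^*.
Proof. by rewrite (hermC inner) expr0 mul1r. Qed.
Lemma inner0l x : inner 0 x = 0. Proof. exact: linear0l. Qed.
Lemma inner0r x : inner x 0 = 0. Proof. exact: linear0r. Qed.
Lemma innerNl x y : inner (- x) y = - inner x y. Proof. exact: linearNl. Qed.
Lemma innerNr x y : inner x (- y) = - inner x y. Proof. exact: linearNr. Qed.
Lemma innerBl x y z : inner (x - y) z = inner x z - inner y z.
Proof. exact: linearBl. Qed.
Lemma innerBr x y z : inner z (x - y) = inner z x - inner z y.
Proof. exact: linearBr. Qed.
Lemma inner_suml (I : Type) (r : seq I) (P : pred I) (F : I -> H) y :
  inner (\sum_(i <- r | P i) F i) y = \sum_(i <- r | P i) inner (F i) y.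
Proof. exact: linear_sumlz. Qed.
Lemma inner_sumr (I : Type) (r : seq I) (P : pred I) (F : I -> H) y :
  inner y (\sum_(i <- r | P i) F i) = \sum_(i <- r | P i) inner y (F i).
Proof. exact: linear_sumr. Qed.

Lemma inner_ge0 x : 0 <= inner x x.
Proof. by rewrite inner_norm exprn_ge0. Qed.

Lemma inner_eq0 x : (inner x x == 0) = (x == 0).
Proof. by rewrite inner_norm expf_eq0 /= normr_eq0. Qed.

Lemma inner_eq0C x y : inner x y = 0 -> inner y x = 0.
Proof. by move=> h; rewrite innerC h conjC0. Qed.

Lemma cauchy_schwarz x y : `|inner x y| <= `|x| * `|y|.
Proof.
have [->|y0] := eqVneq y 0; first by rewrite inner0r !normr0 mulr0.
have yy : 0 < inner y y by rewrite lt_def inner_eq0 y0 inner_ge0.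
rewrite -(ler_pXn2r (n := 2)) ?nnegrE ?mulr_ge0// exprMn -!inner_norm normCK.
rewrite -innerC; set t := inner x y; have tE : inner y x = t^* by rewrite innerC.
have := inner_ge0 (x - (t / inner y y) *: y).
rewrite innerBl !innerBr innerZl !innerZr innerZl -/t tE.
have -> : (t / inner y y)^* = t^* / inner y y.
  by rewrite rmorphM fmorphV /= -innerC.
have -> : inner x x - t^* / inner y y * t -
   (t / inner y y * t^* - t^* / inner y y * (t / inner y y * inner y y)) =
   (inner x x * inner y y - t * t^*) / inner y y.
  by field; rewrite gt_eqF.
by rewrite pmulr_lge0 ?invr_gt0// subr_ge0.
Qed.

Lemma closed_subspace_kernel (f : H -> C) (M : C) : 0 <= M ->
  (forall a u v, f (a *: u + v) = a * f u + f v) ->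
  (forall v, `|f v| <= M * `|v|) -> closed_subspace [set v | f v = 0].
Proof.
move=> M0 flin fM; have f0 : f 0 = 0.
  by have := flin 1 0 0; rewrite scaler0 addr0 mul1r => /eqP;
     rewrite addrC -subr_eq subrr => /eqP <-.
split => //=; last by move=> a u v fu fv; rewrite flin fu fv mulr0 addr0.
move=> p clp /=; apply/eqP/negPn/negP => fp.
(* The denominator is [M + 1] so that [M = 0] is allowed; a zero [u] of [f] this close to [p] would
   give |f p| = |f (p - u)| < |f p|. *)
have e0 : 0 < `|f p| / (M + 1) by rewrite divr_gt0 ?normr_gt0 ?ltr_wpDl.
have [u [/= fu]] := clp _ (nbhsx_ballx p _ e0).
rewrite -ball_normE /= => pu.
have E : f p = f (p - u).
  by rewrite -[p - u]addrC -scaleN1r flin fu mulr0 add0r.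
move: pu; rewrite ltr_pdivlMr ?ltr_wpDl// => pu.
have fpu := fM (p - u); rewrite -E in fpu.
have : M * `|p - u| < `|f p|.
  by apply: le_lt_trans pu; rewrite mulrDr mulr1 mulrC lerDl.
by move=> /(le_lt_trans fpu); rewrite ltxx.
Qed.

Lemma closed_subspace_inner y : closed_subspace [set v | inner v y = 0].
Proof.
apply: (@closed_subspace_kernel (fun v => inner v y) `|y|) => //.
  by move=> a u v; rewrite innerDl innerZl.
by move=> v; rewrite mulrC cauchy_schwarz.
Qed.

Lemma closed_subspace_bigcap (I : Type) (P : I -> Prop) (F : I -> set H) :
  (forall i, P i -> closed_subspace (F i)) ->
  closed_subspace [set v | forall i, P i -> F i v].
Proof.
move=> FS; split => /=.
- have -> : [set v | forall i, P i -> F i v] = \bigcap_(i in P) F i by [].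
  by apply: closed_bigI => i /FS[].
- by move=> i /FS[].
- by move=> a x y hx hy i Pi; have [_ _] := FS i Pi; apply; [exact: hx|exact: hy].
Qed.

Lemma closed_subspaceI (F G : set H) : closed_subspace F -> closed_subspace G ->
  closed_subspace (F `&` G).
Proof.
move=> [F1 F2 F3] [G1 G2 G3]; split; first exact: closedI.
  by [].
by move=> a x y [? ?] [? ?]; split; [apply: F3|apply: G3].
Qed.

Lemma closed_subspaceZ (F : set H) a x : closed_subspace F -> F x -> F (a *: x).
Proof. by move=> [_ F0 FD] Fx; rewrite -[_ *: _]addr0; exact: FD. Qed.
Lemma closed_subspaceD (F : set H) x y : closed_subspace F -> F x -> F y -> F (x + y).
Proof. by move=> [_ F0 FD] Fx Fy; rewrite -[x]scale1r; exact: FD. Qed.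

End Inner.

(** * Orthogonal projection and a criterion for reducibility *)

Section Projection.
Context {R : realType} {H : hilbertType R}.
Local Notation C := (R[i]).
Implicit Types (x y z v : H) (a : C).

Lemma parallelogram x y :
  `|x + y| ^+ 2 + `|x - y| ^+ 2 = 2 * (`|x| ^+ 2 + `|y| ^+ 2).
Proof.
by rewrite -!inner_norm !(innerDl, innerDr, innerNl, innerNr); ring.
Qed.

Lemma real_complex_norm x : (complex.Re `|x|)%:C = `|x|.
Proof. by rewrite RRe_real// normr_real. Qed.

Lemma norm_sub_proj x y : y != 0 ->
  `|x - (inner x y / inner y y) *: y| ^+ 2 =
  `|x| ^+ 2 - `|inner x y| ^+ 2 / inner y y.
Proof.
move=> y0; set t := inner x y / inner y y.
have tE : t^* = (inner x y)^* / inner y y.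
  by rewrite rmorphM fmorphV /= -(innerC y y).
rewrite -!inner_norm innerBl !innerBr !innerZl !innerZr tE (innerC y x).
by rewrite normCK /t; field; rewrite inner_eq0.
Qed.

Lemma small_inv (e : C) : 0 < e -> exists n : nat, n.+1%:R^-1 < e.
Proof.
move=> e0; have eR : (complex.Re e)%:C = e by rewrite RRe_real// gtr0_real.
have e0' : 0 < complex.Re e by rewrite -ltcR eR.
have [n _ /(_ n (leqnn _)) /= h] := near_infty_natSinv_lt (PosNum e0').
exists n; rewrite -eR -ltcR in h *; rewrite (le_lt_trans _ h)//.
by rewrite fmorphV rmorph_nat.
Qed.

(* the nearest point of M: a minimising sequence is Cauchy by the
   parallelogram law *)
Lemma projection (M : set H) v : closed_subspace M ->
  exists2 p, M p & orthocomp M (v - p).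
Proof.
move=> MS; have [Mcl M0 ML] := MS.
pose q m : R := complex.Re (`|v - m| ^+ 2).
have qE m : (q m)%:C = `|v - m| ^+ 2.
  by rewrite RRe_real// rpredX// normr_real.
pose E := [set q m | m in M].
have Einf : has_inf E.
  split; first by exists (q 0), 0.
  by exists 0 => _ [m _ <-]; rewrite -ler0c qE exprn_ge0.
pose d := inf E.
have dq m : M m -> d%:C <= `|v - m| ^+ 2.
  by move=> Mm; rewrite -qE lecR; apply: ge_inf; [case: Einf|exists m].
have /choice[m mP] : forall n : nat, exists m, M m /\
    `|v - m| ^+ 2 < d%:C + n.+1%:R^-1.
  move=> n; have n0 : (0 : R) < n.+1%:R^-1 by rewrite invr_gt0.
  have [_ [m Mm <-]] := inf_adherent n0 Einf.
  rewrite -ltcR qE rmorphD /= fmorphV rmorph_nat => h; by exists m.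
have mM n : M (m n) by case: (mP n).
have mlt n : `|v - m n| ^+ 2 < d%:C + n.+1%:R^-1 by case: (mP n).
have mm i j : `|m i - m j| ^+ 2 <= 2 * (i.+1%:R^-1 + j.+1%:R^-1).
  have Mh : M (2^-1 *: (m i + m j)).
    by apply: closed_subspaceZ => //; apply: closed_subspaceD.
  have h1 := dq _ Mh.
  have h2 := parallelogram (v - m i) (v - m j).
  have E1 : v - m i + (v - m j) = 2 *: (v - 2^-1 *: (m i + m j)).
    rewrite scalerBr scalerA divff ?scale1r ?pnatr_eq0//.
    by rewrite scaler_nat mulr2n opprD addrACA.
  have E2 : v - m i - (v - m j) = - (m i - m j).
    by rewrite !opprB addrC addrA subrK.
  rewrite E1 E2 normrN normrZ exprMn [`|2|]ger0_norm ?ler0n// in h2.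
  have -> : `|m i - m j| ^+ 2 = 2 * (`|v - m i| ^+ 2 + `|v - m j| ^+ 2)
    - 2 ^+ 2 * `|v - 2^-1 *: (m i + m j)| ^+ 2.
    by rewrite -h2 [_ + `|_ - _| ^+ 2]addrC addrK.
  have h3 : 2 * (`|v - m i| ^+ 2 + `|v - m j| ^+ 2) <=
    2 * ((d%:C + i.+1%:R^-1) + (d%:C + j.+1%:R^-1)).
    by rewrite ler_wpM2l ?ler0n// lerD// ltW.
  apply: le_trans (lerB h3 (ler_wpM2l _ h1)) _; first by rewrite exprn_ge0.
  by rewrite le_eqVlt; apply/orP; left; apply/eqP; ring.
have mc : cauchy (m @ \oo).
  apply: cauchy_exP => e e0.
  have e20 : 0 < e ^+ 2 / 4 by rewrite divr_gt0// exprn_gt0.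
  have [N hN] := small_inv e20.
  exists (m N); exists N => // j /= Nj; rewrite -ball_normE /=.
  rewrite -(ltr_pXn2r (n := 2)) ?nnegrE// ?ltW//.
  apply: le_lt_trans (mm N j) _.
  have jN : (j.+1%:R^-1 : C) <= N.+1%:R^-1.
    by rewrite lef_pV2 ?posrE ?ltr0n// ler_nat.
  apply: (@le_lt_trans _ _ (4 * N.+1%:R^-1)).
    rewrite (_ : 4 = 2 * 2); last by rewrite -natrM.
    by rewrite -mulrA ler_wpM2l ?ler0n// mulr2n mulrDl !mul1r lerD2l.
  by rewrite mulrC -ltr_pdivlMr ?ltr0n.
have /cvg_ex[p mp] : cvg (m @ \oo) by exact: cauchy_cvg.
exists p.
  by apply: (closed_cvg M Mcl _ p mp); exists 0.
move=> y My; apply: inner_eq0C.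
have [->|y0] := eqVneq y 0; first by rewrite inner0r.
have yy : 0 < inner y y by rewrite lt_def inner_eq0 y0 inner_ge0.
(* Moving [m n] along [y] by the optimal [t] lowers the squared distance to [v] by |<w, y>|^2 / <y,
   y>. As the distance cannot drop below the infimum [d], the gain is at most 1/(n+1) by the choice
   of [m n]. *)
have bnd n : `|inner (v - m n) y| ^+ 2 <= inner y y * n.+1%:R^-1.
  set w := v - m n; set t := inner w y / inner y y.
  have := dq (m n + t *: y); rewrite opprD addrA -/w => h.
  have {}h : d%:C <= `|w - t *: y| ^+ 2.
    by apply: h; apply: closed_subspaceD => //; exact: closed_subspaceZ.
  have E1 : `|w - t *: y| ^+ 2 = `|w| ^+ 2 - `|inner w y| ^+ 2 / inner y y by exact: norm_sub_proj.
  rewrite E1 in h.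
  have := lt_le_trans (mlt n) (lerD h (lexx n.+1%:R^-1)); rewrite -/w.
  rewrite -addrA ltrDl addrC subr_gt0 ltr_pdivrMr// mulrC => /ltW //.
apply/eqP/negPn/negP => nz.
have e0 : 0 < `|inner (v - p) y| by rewrite normr_gt0.
have ny : 0 < `|y| by rewrite normr_gt0.
set e := `|inner _ _| in e0.
have e1 : 0 < e / 2 / `|y| by rewrite !divr_gt0.
have e2 : 0 < (e / 2) ^+ 2 / inner y y by rewrite divr_gt0// exprn_gt0// divr_gt0.
have [N1 hN1] := small_inv e2.
have /cvgrPdist_lt /(_ _ e1) [N2 _ hN2] := mp.
have := hN2 (maxn N1 N2) (leq_maxr _ _) => /= hp.
have h1 : `|inner (v - m (maxn N1 N2)) y| < e / 2.
  rewrite -(ltr_pXn2r (n := 2)) ?nnegrE ?divr_ge0// ?ltW//.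
  apply: le_lt_trans (bnd _) _; rewrite mulrC -ltr_pdivlMr//.
  apply: le_lt_trans hN1.
  by rewrite lef_pV2 ?posrE ?ltr0n// ler_nat ltnS leq_maxl.
have h2 : `|inner (m (maxn N1 N2) - p) y| < e / 2.
  apply: le_lt_trans (cauchy_schwarz _ _) _.
  by rewrite -ltr_pdivlMr// distrC.
have : e < e / 2 + e / 2.
  apply: le_lt_trans (ltrD h1 h2); apply: le_trans (ler_normD _ _).
  by rewrite -innerDl addrA subrK.
by rewrite -splitr ltxx.
Qed.

(** Projecting [v] on the part of [Y] orthogonal to all [b j] outside [P] leaves a remainder
    orthogonal to every [b j], hence zero. With [P] everywhere true this is a density principle: a
    closed linear condition that holds on all [b j] holds everywhere. *)
Lemma orthogonal_span (J : Type) (b : J -> H) (P : J -> Prop) (Y : set H) :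
  (forall i j, i <> j -> inner (b i) (b j) = 0) ->
  (forall v, (forall j, inner v (b j) = 0) -> v = 0) ->
  closed_subspace Y -> (forall j, P j -> Y (b j)) ->
  forall v, (forall j, ~ P j -> inner v (b j) = 0) -> Y v.
Proof.
move=> orth tot YS Yb v vb.
pose M := [set v : H | forall j, ~ P j -> inner v (b j) = 0].
have MS : closed_subspace M.
  by apply: (@closed_subspace_bigcap _ H _ (fun j => ~ P j)
    (fun j => [set v | inner v (b j) = 0])) => j _; exact: closed_subspace_inner.
have [p [Yp Mp] op] := projection v (closed_subspaceI YS MS).
suff : v - p = 0 by move=> /eqP; rewrite subr_eq0 => /eqP ->.
apply: tot => j; have [Pj|nPj] := pselect (P j).
  apply: inner_eq0C; apply: op; split; first exact: Yb.
  by move=> i nPi; apply: orth => ij; apply: nPi; rewrite -ij.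
by rewrite innerBl (vb j nPj) (Mp j nPj) subrr.
Qed.

(* The two halves of an orthogonal basis are each other's complements. *)
Lemma reducible_split (J : Type) (b : J -> H) (P : J -> Prop) (T : H -> H) :
  bounded_op T ->
  (forall i j, i <> j -> inner (b i) (b j) = 0) ->
  (forall v, (forall j, inner v (b j) = 0) -> v = 0) ->
  (forall i j, P j -> ~ P i -> inner (T (b j)) (b i) = 0) ->
  (forall i j, ~ P j -> P i -> inner (T (b j)) (b i) = 0) ->
  (exists2 j, P j & b j != 0) -> (exists2 j, ~ P j & b j != 0) ->
  reducible T.
Proof.
move=> [Tlin [B TB]] orth tot T1 T2 [j Pj bj] [i Pi bi].
have TD a u v : T (a *: u + v) = a *: T u + T v by exact: Tlin.
have TB' v : `|T v| <= `|B| * `|v|.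
  have h := TB v; have [->|v0] := eqVneq v 0.
    have := TB 0; rewrite normr0 !mulr0 => /le_trans; apply.
    by [].
  rewrite (le_trans h)// ler_wpM2r// real_ler_norm//.
  have : 0 <= B * `|v| by rewrite (le_trans _ h).
  by rewrite pmulr_lge0 ?normr_gt0// => /ger0_real.
(* The half [Q] is arbitrary here because the statement is used for [P], giving the subspace, and
   for the complement of [P], giving its orthogonal complement. *)
have stab (Q : J -> Prop) :
   (forall i j, Q j -> ~ Q i -> inner (T (b j)) (b i) = 0) ->
   forall v, (forall j, ~ Q j -> inner v (b j) = 0) ->
   forall j, ~ Q j -> inner (T v) (b j) = 0.
  move=> TQ v vQ k Qk.
  apply: (@orthogonal_span J b Q [set v | inner (T v) (b k) = 0]) => //.
  - apply: (@closed_subspace_kernel _ _ (fun v => inner (T v) (b k))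
       (`|B| * `|b k|)).
    + by rewrite mulr_ge0.
    + by move=> a u w; rewrite TD innerDl innerZl.
    + move=> w; apply: le_trans (cauchy_schwarz _ _) _.
      by rewrite mulrAC ler_wpM2r.
  - by move=> l Ql /=; exact: TQ.
pose M := [set v | forall j, ~ P j -> inner v (b j) = 0].
have oM : orthocomp M = [set v | forall j, P j -> inner v (b j) = 0].
  apply/seteqP; split=> v /= hv.
    move=> k Pk; apply: inner_eq0C; apply: hv => l Pl; apply: orth => kl.
    by apply: Pl; rewrite -kl.
  move=> u Mu.
  apply: (@orthogonal_span J b P [set w | inner w v = 0]) => //.
    exact: closed_subspace_inner.
  by move=> k /hv /inner_eq0C.
exists M; split.
- by apply: (@closed_subspace_bigcap _ H _ (fun j => ~ P j)
    (fun j => [set v | inner v (b j) = 0])) => k _; exact: closed_subspace_inner.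
- have Mbj : M (b j) by move=> k Pk; apply: orth => jk; apply: Pk; rewrite -jk.
  have nMbi : ~ M (b i).
    by move=> /(_ i Pi) /eqP; rewrite inner_eq0 (negPf bi).
  split; apply/eqP => E; first by move: Mbj; rewrite E /= => /eqP; apply/negP.
  by apply: nMbi; rewrite E.
- by move=> v Mv; apply: stab.
- rewrite oM => v /= hv k Pk; apply: (stab (fun j => ~ P j)).
  + by move=> l m Pm /contrapT; exact: T2.
  + by move=> l /contrapT; exact: hv.
  + by move=> /(_ Pk).
Qed.

End Projection.

(** * The recurrences for the coefficients of T *)

Section Covariance.
Context {R : realType}.
Local Notation C := (R[i]).
Implicit Types H K : hilbertType R.

Lemma adjoint_unitaryE H K (U : H -> K) : unitary U ->
  forall x y, inner (U x) y = inner x (adjoint U y).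
Proof.
move=> [_ Ui /choice[S US]].
suff : [set S | forall x y, inner (U x) y = inner x (S y)] (adjoint U) by [].
by apply: (@xgetPex _ _ _ _); exists S => x y; rewrite -Ui US.
Qed.

Lemma adjoint_unitaryEr H K (U : H -> K) : unitary U ->
  forall x y, inner (adjoint U y) x = inner y (U x).
Proof. by move=> UU x y; rewrite innerC -adjoint_unitaryE// -innerC. Qed.

Lemma adjoint_unitaryK H K (U : H -> K) : unitary U -> cancel (adjoint U) U.
Proof.
move=> UU y; have [_ Ui /(_ y)[x <-]] := UU; congr (U _).
apply/eqP; rewrite -subr_eq0 -inner_eq0; set z := adjoint _ _ - _.
rewrite {1}/z innerBl innerC -(adjoint_unitaryE UU) Ui.
by rewrite -innerC subrr.
Qed.

Lemma unitaryK H K (U : H -> K) : unitary U -> cancel U (adjoint U).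
Proof.
move=> UU x; apply/eqP; rewrite -subr_eq0 -inner_eq0; set z := adjoint _ _ - _.
rewrite {1}/z innerBl innerC -(adjoint_unitaryE UU); have [_ -> _] := UU.
by rewrite -innerC subrr.
Qed.

Lemma adjoint_unitary H K (U : H -> K) : unitary U -> unitary (adjoint U).
Proof.
move=> UU; have [Ul Ui Us] := UU; split.
- move=> a x y; rewrite -[LHS](unitaryK UU) -[RHS](unitaryK UU).
  by rewrite Ul !adjoint_unitaryK.
- by move=> x y; rewrite -Ui !adjoint_unitaryK.
- by move=> y; exists (U y); rewrite unitaryK.
Qed.

Lemma unitary_norm H K (U : H -> K) x : unitary U -> `|U x| = `|x|.
Proof.
move=> [_ Ui _]; apply/eqP; rewrite -(eqrXn2 (n := 2))//.
by rewrite -!inner_norm Ui.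
Qed.

Lemma op_invP H (T : H -> H) : (exists S, inverse_op T S) ->
  inverse_op T (op_inv T).
Proof. exact: xgetPex. Qed.

(** The bound in the definition is a complex number, on the zero space an arbitrary one; its
    absolute value is a bound in every case. *)
Lemma bounded_opB H (T : H -> H) : bounded_op T ->
  exists2 B : C, 0 <= B & forall v, `|T v| <= B * `|v|.
Proof.
move=> [Tlin [B TB]]; exists `|B| => // v.
have h := TB v; have [->|v0] := eqVneq v 0.
  by have := TB 0; rewrite normr0 !mulr0.
rewrite (le_trans h)// ler_wpM2r// real_ler_norm//.
have : 0 <= B * `|v| by rewrite (le_trans _ h).
by rewrite pmulr_lge0 ?normr_gt0// => /ger0_real.
Qed.

Section Relations.
Context {H : hilbertType R} (T : H -> H) (rho : mob R -> H -> H).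
Hypotheses (boundedT : bounded_op T) (rhoU : forall g, unitary (rho g))
  (rhoT : associated rho T).

(** With centre 0 the denominator of the Möbius image is the identity, so that this image is the
    multiple [s^*] of [T]. *)
Lemma associated_rotation (g : mob R) (s : C) x y :
  mob_pair g = (s, 0) ->
  s^* * inner (T x) y = inner (T (rho (mob_inv g) x)) (rho (mob_inv g) y).
Proof.
move=> gE; have := congr1 (fun f => inner (f x) y) (rhoT (mob_inv g)) => /=.
rewrite (adjoint_unitaryEr (rhoU _)) => <-.
have iE : mob_pair (mob_inv g) = (s^*, - (s * 0)).
  by rewrite /= /mob_inv_pair /mob_rot /mob_pt gE.
rewrite /mob_op /mob_rot /mob_pt iE /= mulr0 oppr0 conjC0 scale0r subr0.
rewrite innerZl; congr (_ * inner (T _) _).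
set f := (fun x0 : H => _).
have [] : inverse_op f (op_inv f).
  apply: op_invP; exists id; split.
  - by split => //; exists 1 => v; rewrite mul1r.
  - by move=> v; rewrite /f scale0r subr0.
  - by move=> v; rewrite /f scale0r subr0.
by move=> _ _ /(_ x); rewrite /f scale0r subr0.
Qed.

Hypothesis (specT : spectrum T `<=` [set z | `|z| <= 1]).

(** The inverse of [g] sends T to (T + r)(1 + r T)^-1. Evaluating the covariance at [x + r T x], the
    image of [x] under the denominator, removes the inverse. The denominator is invertible because
    -1/r lies outside the closed disc and so outside the spectrum. *)
Lemma associated_boost (g : mob R) (r : R) x :
  0 < r < 1 -> mob_pair g = (1, r%:C) ->
  T (rho (mob_inv g) (x + r%:C *: T x)) =
  rho (mob_inv g) (T x + r%:C *: x).
Proof.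
move=> /andP[r0 r1] gE.
have rC : (0 : C) < r%:C by rewrite ltcR.
set z := x + _; have := congr1 (fun f => rho (mob_inv g) (f z)) (rhoT (mob_inv g)).
rewrite /= adjoint_unitaryK// => <-; congr (rho _ _).
have iE : mob_pair (mob_inv g) = (1, - r%:C).
  by rewrite /= /mob_inv_pair /mob_rot /mob_pt gE /= conjC1 mul1r.
rewrite /mob_op /mob_rot /mob_pt iE /= scale1r.
rewrite scaleNr opprK.
have -> : (- r%:C)^* = - r%:C.
  by apply: conj_Creal; rewrite realN; apply/complex_realP; exists r.
set f := (fun x0 : H => _).
have [] : inverse_op f (op_inv f).
  apply: op_invP.
  have : ~ spectrum T (- (r%:C)^-1).
    move=> /specT /=; rewrite normrN normfV gtr0_norm// invf_le1//.
    by rewrite -[1]/(1%:C) lecR leNgt r1.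
  rewrite /spectrum /= => /contrapT[S [[Slin [B SB]] TS ST]].
  exists (fun y => S ((r%:C)^-1 *: y)); split.
  - split; first by move=> a u v; rewrite scalerDr scalerA mulrC -scalerA Slin.
    exists (B * (r%:C)^-1) => v; rewrite (le_trans (SB _))// normrZ normfV.
    by rewrite gtr0_norm// mulrA.
  - move=> v; rewrite -[RHS]TS /f; congr (S _).
    by rewrite !scaleNr !opprK scalerDr scalerA mulVf ?gt_eqF// scale1r addrC.
  - move=> v; have := ST ((r%:C)^-1 *: v); rewrite /f; set w := S _ => h.
    have := congr1 (fun u => r%:C *: u) h.
    rewrite /= !scaleNr !opprK scalerDr !scalerA mulfV ?gt_eqF// !scale1r => <-.
    by rewrite addrC.
move=> _ fK _; have -> : op_inv f z = x.
  rewrite -[RHS]fK /f /z; congr (op_inv _ _).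
  by rewrite scaleNr opprK.
by [].
Qed.

End Relations.
End Covariance.

(** * Weight vectors, and weak first order expansions of the boosts *)

Section Ladders.
Context {R : realType}.
Local Notation C := (R[i]).
Implicit Types H K : hilbertType R.

(* The derivative at r = 0 of the action of the boosts (1, r)^-1 on a weight
   vector of weight x; k is half the parameter of the representation. *)
Definition ladder_deriv H (k : C) (b : R -> H) (x : R) : H :=
  (x%:C + k) *: b (x + 1) - (x%:C - k) *: b (x - 1).

(* b x is a weight vector of weight x, and 0 for x outside the support S. *)
Definition ladder H (rho : mob R -> H -> H) (k : C) (S : set R) (b : R -> H) :=
  [/\ forall x, S x <-> b x != 0,
      forall x y, x != y -> inner (b x) (b y) = 0,
      forall g th x, mob_pair g = (cis th, 0) -> 0 <= th <= 1 ->
        rho (mob_inv g) (b x) = cis (th * x) *: b x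
    & forall x y, S x -> exists M : R, forall g r,
        mob_pair g = (1, r%:C) -> 0 < r < 8^-1 ->
        `|inner (rho (mob_inv g) (b x) - b x - r%:C *: ladder_deriv k b x) (b y)|
          <= (M * r ^+ 2)%:C].

Lemma mob_exists (s a : C) : `|s| = 1 -> `|a| < 1 ->
  exists g : mob R, mob_pair g = (s, a).
Proof.
move=> s1 a1; have h : (`|((s, a) : C^o * C^o).1| == 1) && (`|(a : C^o)| < 1).
  by rewrite /= s1 eqxx a1.
by exists (Mob h).
Qed.

Lemma realCM (x y : R) : (x * y)%:C = x%:C * y%:C. Proof. exact: rmorphM. Qed.
Lemma realCD (x y : R) : (x + y)%:C = x%:C + y%:C. Proof. exact: rmorphD. Qed.
Lemma Re_norm (z : C) : (complex.Re `|z|)%:C = `|z|.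
Proof. by rewrite RRe_real// normr_real. Qed.

Lemma subrACA (V : zmodType) (x y z t : V) : x - y - (z - t) = x - z - (y - t).
Proof. by rewrite !opprB addrACA [RHS]addrACA [- y - z]addrC. Qed.

Lemma le_linear0 (x B : R) : (forall r, 0 < r < 8^-1 -> x <= B * r) -> x <= 0.
Proof.
move=> h; rewrite leNgt; apply/negP => x0.
have B0 : 0 < `|B| + 1 by rewrite ltr_wpDl.
pose r := Num.min (16^-1) (x / 2 / (`|B| + 1)).
have r0 : 0 < r by rewrite lt_min; apply/andP; split; rewrite ?invr_gt0 ?divr_gt0.
have r8 : r < 8^-1.
  by rewrite gt_min; apply/orP; left; lra.
have := h r; rewrite r0 r8 => /(_ isT).
apply/negP; rewrite -ltNge.
have rB : r <= x / 2 / (`|B| + 1) by rewrite ge_min lexx orbT.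
have : r * (`|B| + 1) <= x / 2 by rewrite -ler_pdivlMr.
have : B * r <= `|B| * r by rewrite ler_wpM2r ?ler_norm// ltW.
nra.
Qed.

Lemma cis_real_mul (x y : R) : cis (x + y) = cis x * cis y.
Proof.
by apply/eqP; rewrite eq_complex /= cosD sinD [_ + cos x * _]addrC !eqxx.
Qed.

Lemma norm_cis (x : R) : `|cis x| = 1.
Proof. by rewrite normc_def /= cos2Dsin2 sqrtr1. Qed.

Lemma conj_cis (x : R) : (cis x)^* = cis (- x).
Proof. by rewrite /cis cosN sinN. Qed.

Lemma cis0 : cis 0 = 1 :> C.
Proof. by rewrite /cis cos0 sin0. Qed.

Lemma cis_eq1 (d : R) : (forall th, 0 <= th <= 1 -> cis (th * d) = 1) -> d = 0.
Proof.
move=> h; have d1 : 0 < 1 + `|d| by rewrite ltr_pwDl.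
(* This angle keeps |th d| at most 1, hence inside [0, pi], where [acos] inverts [cos]. *)
pose th := (1 + `|d|)^-1.
have th0 : 0 < th by rewrite invr_gt0.
have thd : `|th * d| <= 1.
  rewrite normrM gtr0_norm// /th mulrC ler_pdivrMr// mul1r; lra.
have : cis (th * d) = 1.
  by apply: h; rewrite ltW//= /th invf_le1//; have := normr_ge0 d; lra.
move=> [] cE _; have : `|th * d| = 0.
  have : cos `|th * d| = 1 by rewrite -cE; case: (ler0P (th * d)); rewrite ?cosN.
  have dpi : `|th * d| \in `[0, pi].
    rewrite in_itv /= normr_ge0 /= (le_trans thd)//.
    by have := @pi_ge2 R; lra.
  by move=> /(congr1 acos); rewrite cosK// acos1.
by move=> /eqP; rewrite normr_eq0 mulf_eq0 gt_eqF//= => /eqP.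
Qed.

Section System.
Context {H : hilbertType R} (I : finType) (T : H -> H) (rho : mob R -> H -> H).
Context (k : I -> C) (S : I -> set R) (b : I -> R -> H).
Hypotheses (boundedT : bounded_op T) (rhoU : forall g, unitary (rho g))
  (rhoT : associated rho T) (specT : spectrum T `<=` [set z | `|z| <= 1])
  (lad : forall i, ladder rho (k i) (S i) (b i))
  (orth : forall i j x y, i != j -> inner (b i x) (b j y) = 0)
  (rho_orth : forall i j x y, i != j -> S i x -> exists M : R, forall g r,
     mob_pair g = (1, r%:C) -> 0 < r < 8^-1 ->
     `|inner (rho (mob_inv g) (b i x)) (b j y)| <= (M * r ^+ 2)%:C)
  (tot : forall v, (forall i x, inner v (b i x) = 0) -> v = 0).

(** The matrix entry t_ij(x). Where [b i (x + 1)] is zero, division by zero gives 0, so entries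
    vanish off the supports without a case distinction. *)
Definition coef (i j : I) (x : R) : C :=
  inner (T (b j x)) (b i (x + 1)) / inner (b i (x + 1)) (b i (x + 1)).

Let TD u v : T (u + v) = T u + T v.
Proof. by have [Tl _] := boundedT; have := Tl 1 u v; rewrite !scale1r. Qed.
Let T0 : T 0 = 0.
Proof. by apply: (addrI (T 0)); rewrite -TD !addr0. Qed.
Let TZ a u : T (a *: u) = a *: T u.
Proof. by have [Tl _] := boundedT; have := Tl a u 0; rewrite !addr0 T0 addr0. Qed.
Let TB u v : T (u - v) = T u - T v.
Proof. by rewrite TD -scaleN1r TZ scaleN1r. Qed.
Let Tsum (F : I -> H) : T (\sum_i F i) = \sum_i T (F i).
Proof. by apply: (big_morph T TD T0). Qed.

Lemma ladder_orth i j x y : (i, x) <> (j, y) -> inner (b i x) (b j y) = 0.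
Proof.
move=> ne; have [ij|ij] := eqVneq i j; last exact: orth.
subst j; have [_ h _ _] := lad i; apply: h; apply/eqP => xy.
by apply: ne; rewrite xy.
Qed.

(** Covariance under the rotation of angle th multiplies this entry by cis (th (x + 1 - y)); a
    nonzero entry makes the factor 1 for all th in [0, 1]. *)
Lemma weight_shift i j x y : y != x + 1 -> inner (T (b j x)) (b i y) = 0.
Proof.
move=> /eqP yx; apply/eqP/negPn/negP => nz; apply: yx.
suff : x + 1 - y = 0 by lra.
apply: cis_eq1 => th th1.
have [g gE] : exists g : mob R, mob_pair g = (cis th, 0).
  by apply: mob_exists; rewrite ?norm_cis ?normr0.
have := associated_rotation rhoU rhoT (b j x) (b i y) gE.
have [_ _ ri _] := lad i; have [_ _ rj _] := lad j.
rewrite (ri _ _ _ gE)// (rj _ _ _ gE)// TZ innerZl innerZr mulrA => /(mulIf nz).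
rewrite !conj_cis -cis_real_mul => e.
have -> : th * (x + 1 - y) = th + (th * x + - (th * y)) by ring.
by rewrite cis_real_mul -e -cis_real_mul subrr cis0.
Qed.

Lemma coef_support i j x : coef i j x != 0 -> S j x /\ S i (x + 1).
Proof.
rewrite /coef => c0; have [Si _ _ _] := lad i; have [Sj _ _ _] := lad j.
split; [apply/Sj|apply/Si]; apply: contraNneq c0 => ->.
  by rewrite T0 inner0l mul0r.
by rewrite !inner0r mul0r.
Qed.

Lemma coefM i j x :
  coef i j x * inner (b i (x + 1)) (b i (x + 1)) = inner (T (b j x)) (b i (x + 1)).
Proof.
rewrite /coef; have [->|b0] := eqVneq (b i (x + 1)) 0.
  by rewrite !inner0r mulr0.
by rewrite divfK// inner_eq0.
Qed.

Lemma op_expansion j x : T (b j x) = \sum_i coef i j x *: b i (x + 1).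
Proof.
apply/eqP; rewrite -subr_eq0; apply/eqP/tot => i y.
rewrite innerBl inner_suml; have [->|yx] := eqVneq y (x + 1).
  rewrite (bigD1 i)//= big1 ?addr0; last by move=> l li; rewrite innerZl orth ?mulr0.
  by rewrite innerZl coefM subrr.
rewrite weight_shift// big1 ?subrr// => l _; rewrite innerZl ladder_orth ?mulr0//.
by case=> _ /esym; apply/eqP.
Qed.

(** The constant may depend on the weight vector tested against: coefficient integrals bound one
    coordinate at a time. Totality of the weight vectors makes this enough to determine [v1]. *)
Definition weak_expansion (V : mob R -> H) (v0 v1 : H) : Prop :=
  forall i y, exists M : R, forall g r, mob_pair g = (1, r%:C) -> 0 < r < 8^-1 ->
    `|inner (V g - v0 - r%:C *: v1) (b i y)| <= (M * r ^+ 2)%:C.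

Lemma weak_expansionD V W v0 v1 w0 w1 : weak_expansion V v0 v1 ->
  weak_expansion W w0 w1 -> weak_expansion (fun g => V g + W g) (v0 + w0) (v1 + w1).
Proof.
move=> hV hW i y; have [M hM] := hV i y; have [N hN] := hW i y.
exists (M + N) => g r gE r8; rewrite mulrDl realCD.
apply: le_trans (lerD (hM g r gE r8) (hN g r gE r8)).
apply: le_trans (ler_normD _ _); rewrite -innerDl scalerDr !opprD.
by rewrite (addrACA _ (W g)) (addrACA (V g - v0)).
Qed.

Lemma weak_expansionZ (c : C) V v0 v1 : weak_expansion V v0 v1 ->
  weak_expansion (fun g => c *: V g) (c *: v0) (c *: v1).
Proof.
move=> hV i y; have [M hM] := hV i y.
exists (complex.Re `|c| * M) => g r gE r8.
rewrite scalerA mulrC -scalerA -!scalerBr innerZl normrM -mulrA realCM.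
by rewrite Re_norm ler_wpM2l// hM.
Qed.

Lemma weak_expansion0 : weak_expansion (fun=> 0) 0 0.
Proof.
move=> i y; exists 0 => g r _ _.
by rewrite scaler0 !subr0 inner0l normr0 mul0r.
Qed.

Lemma weak_expansion_sum (V : I -> mob R -> H) v0 v1 :
  (forall i, weak_expansion (V i) (v0 i) (v1 i)) ->
  weak_expansion (fun g => \sum_i V i g) (\sum_i v0 i) (\sum_i v1 i).
Proof.
move=> hV.
have : forall s : seq I, weak_expansion (fun g => \sum_(i <- s) V i g)
     (\sum_(i <- s) v0 i) (\sum_(i <- s) v1 i).
  elim=> [|i s IH].
    rewrite !big_nil (_ : (fun _ => _) = fun=> 0); first exact: weak_expansion0.
    by apply/funext => g; rewrite big_nil.
  rewrite !big_cons (_ : (fun _ => _) = fun g => V i g + \sum_(i <- s) V i g).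
    exact: weak_expansionD.
  by apply/funext => g; rewrite big_cons.
by move=> /(_ (index_enum I)).
Qed.

Lemma weak_expansion_shift V v0 v1 : weak_expansion V v0 v1 ->
  weak_expansion (fun g => mob_pt g *: V g) 0 v0.
Proof.
move=> hV i y; have [M hM] := hV i y.
exists (`|M| + complex.Re `|inner v1 (b i y)|) => g r gE r8.
have /andP[r0 r1] := r8.
have -> : mob_pt g = r%:C by rewrite /mob_pt gE.
have rC : 0 <= r%:C by rewrite ler0c ltW.
rewrite subr0 -scalerBr innerZl normrM ger0_norm//.
have -> : V g - v0 = (V g - v0 - r%:C *: v1) + r%:C *: v1 by rewrite subrK.
rewrite innerDl innerZl expr2 mulrCA realCM ler_wpM2l//.
apply: le_trans (ler_normD _ _) _; rewrite mulrDl realCD lerD//.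
  apply: le_trans (hM g r gE r8) _; rewrite lecR.
  apply: (@le_trans _ _ (`|M| * r ^+ 2)).
    by rewrite ler_wpM2r ?exprn_ge0 ?ler_norm// ltW.
  by rewrite ler_wpM2l// expr2 ler_piMr//; lra.
by rewrite normrM realCM Re_norm ger0_norm// mulrC.
Qed.

(** The adjoint of [T] sends a vector of weight [y] to a combination of the finitely many vectors of
    weight [y - 1]: both sides are bounded in [v] and agree on weight vectors. This finiteness lets
    [T] act on expansions that are controlled only coordinate by coordinate. *)
Lemma op_adjoint i y : exists w : I -> C, forall v,
  inner (T v) (b i y) = \sum_j w j * inner v (b j (y - 1)).
Proof.
pose w j := inner (T (b j (y - 1))) (b i y) / inner (b j (y - 1)) (b j (y - 1)).
exists w => v.
pose u := \sum_j (w j)^* *: b j (y - 1).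
have uE v' : inner v' u = \sum_j w j * inner v' (b j (y - 1)).
  by rewrite inner_sumr; apply: eq_bigr => j _; rewrite innerZr conjCK.
rewrite -uE; apply/eqP; rewrite -subr_eq0; apply/eqP.
have [B B0 TB'] := bounded_opB boundedT.
apply: (@orthogonal_span _ H (I * R) (fun p => b p.1 p.2) (fun=> True)
  [set v | inner (T v) (b i y) - inner v u = 0]) => //=.
- by move=> [j x] [l z] /=; exact: ladder_orth.
- by move=> v' hv; apply: tot => j x; exact: (hv (j, x)).
- apply: (@closed_subspace_kernel _ _ (fun v => inner (T v) (b i y) - inner v u)
    (B * `|b i y| + `|u|)).
  + by rewrite addr_ge0// mulr_ge0.
  + by move=> a v1 v2; rewrite TD TZ !innerDl !innerZl; ring.
  + move=> v'; apply: le_trans (ler_normB _ _) _; rewrite mulrDl lerD//.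
      apply: le_trans (cauchy_schwarz _ _) _.
      by rewrite mulrAC ler_wpM2r.
    by rewrite mulrC cauchy_schwarz.
- move=> [j x] _ /=; rewrite uE; have [->|xy] := eqVneq x (y - 1).
    rewrite (bigD1 j)//= big1 ?addr0; last first.
      by move=> l lj; rewrite orth ?mulr0// eq_sym.
    rewrite /w; have [->|b0] := eqVneq (b j (y - 1)) 0.
      by rewrite T0 !inner0l mulr0 subrr.
    by rewrite divfK ?subrr// inner_eq0.
  rewrite weight_shift; last by apply: contraNneq xy => ->; rewrite addrK.
  rewrite big1 ?subrr// => l _; rewrite ladder_orth ?mulr0//.
  by case=> _; apply/eqP.
Qed.

Lemma weak_expansion_op V v0 v1 : weak_expansion V v0 v1 ->
  weak_expansion (fun g => T (V g)) (T v0) (T v1).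
Proof.
move=> hV i y; have [w hw] := op_adjoint i y.
have /choice[M hM] := fun j => hV j (y - 1).
exists (\sum_j complex.Re `|w j| * M j) => g r gE r8.
have -> : ((\sum_j complex.Re `|w j| * M j) * r ^+ 2)%:C =
    \sum_j `|w j| * (M j * r ^+ 2)%:C.
  rewrite mulr_suml (raddf_sum (real_complex R)); apply: eq_bigr => j _.
  by rewrite -[in RHS]Re_norm -realCM mulrA.
rewrite -TZ -!TB hw.
apply: le_trans (ler_norm_sum _ _ _) _; apply: ler_sum => j _.
by rewrite normrM ler_wpM2l//; exact: hM.
Qed.

Lemma weak_expansion_uniq V v0 v1 w0 w1 : weak_expansion V v0 v1 ->
  weak_expansion V w0 w1 -> v1 = w1.
Proof.
move=> hV hW; apply/eqP; rewrite -subr_eq0; apply/eqP/tot => i y.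
have [M hM] := hV i y; have [N hN] := hW i y.
(* Subtracting the two expansions gives p - r q = O(r^2), which forces p = 0 and then q = 0. *)
set p := inner (w0 - v0) (b i y); set q := inner (v1 - w1) (b i y).
have h r : 0 < r < 8^-1 -> `|p - r%:C * q| <= ((M + N) * r ^+ 2)%:C.
  move=> r8; have /andP[r0 r1] := r8.
  have [g gE] : exists g : mob R, mob_pair g = (1, r%:C).
    by apply: mob_exists; rewrite ?normr1// ger0_norm ?ler0c ?ltW// -[1]/(1%:C) ltcR; lra.
  rewrite mulrDl realCD (le_trans _ (lerD (hM g r gE r8) (hN g r gE r8)))//.
  rewrite (le_trans _ (ler_normB _ _))// -innerBl /p /q -innerZl -innerBl.
  rewrite le_eqVlt; apply/orP; left; apply/eqP; congr (`|inner _ _|).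
  by rewrite scalerBr [RHS]subrACA; congr (_ - _); rewrite opprB [RHS]addrC addrA subrK.
have small (c : C) (B : R) :
    (forall r, 0 < r < 8^-1 -> `|c| <= (B * r)%:C) -> c = 0.
  move=> hc; apply/eqP; rewrite -normr_le0 -Re_norm -[0]/(0%:C) lecR.
  by apply: (@le_linear0 _ B) => r /hc; rewrite -{1}Re_norm lecR.
have p0 : p = 0.
  apply: (@small p (complex.Re `|q| + `|M + N|)) => r r8; have /andP[r0 r1] := r8.
  have rC : 0 <= r%:C by rewrite ler0c ltW.
  rewrite -[p](subrK (r%:C * q)) (le_trans (ler_normD _ _))// addrC.
  rewrite mulrDl realCD lerD//.
    by rewrite normrM realCM Re_norm ger0_norm// mulrC.
  rewrite (le_trans (h r r8))// lecR expr2 mulrA ler_wpM2r//; first exact: ltW.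
  apply: (@le_trans _ _ (`|M + N| * r)).
    by rewrite ler_wpM2r ?ler_norm// ltW.
  by rewrite ler_piMr//; lra.
apply: (@small q (M + N)) => r r8; have /andP[r0 r1] := r8.
have := h r r8; rewrite p0 sub0r normrN normrM ger0_norm ?ler0c ?(ltW r0)//.
by rewrite expr2 mulrCA (realCM r) ler_pM2l// ltcR.
Qed.

Let D i := ladder_deriv (k i) (b i).

Lemma ladder_expansion i x : S i x ->
  weak_expansion (fun g => rho (mob_inv g) (b i x)) (b i x) (D i x).
Proof.
move=> Six j y; have [ij|ij] := eqVneq i j.
  by rewrite -ij; have [_ _ _ ] := lad i; apply.
have [M hM] := rho_orth y ij Six; exists M => g r gE r8.
rewrite !innerBl innerZl /D /ladder_deriv innerBl !innerZl !orth//.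
by rewrite !mulr0 !subr0 mulr0 subr0; exact: hM.
Qed.

(* the commutator of T with the derivative of the boosts is 1 - T^2 *)
Lemma ladder_relation j x : S j x ->
  \sum_i coef i j x *: D i (x + 1) + b j x = T (D j x) + T (T (b j x)).
Proof.
(* [L] is expanded twice: with [T (b j x)] resolved into weight vectors, and after [T] has been
   moved to the front by the boost covariance. The relation equates the two first order terms. *)
move=> Sjx; pose L g := rho (mob_inv g) (T (b j x) + mob_pt g *: b j x).
have rhoD g u v : rho g (u + v) = rho g u + rho g v.
  by have [Ul _ _] := rhoU g; have := Ul 1 u v; rewrite !scale1r.
have rho0 g : rho g 0 = 0.
  by apply: (addrI (rho g 0)); rewrite -rhoD !addr0.
have rhoZ g a u : rho g (a *: u) = a *: rho g u.
  by have [Ul _ _] := rhoU g; have := Ul a u 0; rewrite !addr0 rho0 addr0.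
have hTb : weak_expansion (fun g => rho (mob_inv g) (T (b j x))) (T (b j x))
    (\sum_i coef i j x *: D i (x + 1)).
  have expn i : weak_expansion (fun g => coef i j x *: rho (mob_inv g) (b i (x + 1)))
      (coef i j x *: b i (x + 1)) (coef i j x *: D i (x + 1)).
    have [c0|/coef_support[_ Si]] := eqVneq (coef i j x) 0.
      rewrite c0 !scale0r (_ : (fun _ => _) = fun=> 0); first exact: weak_expansion0.
      by apply/funext => g; rewrite scale0r.
    exact/weak_expansionZ/ladder_expansion.
  have := weak_expansion_sum expn.
  rewrite -op_expansion; congr (weak_expansion _ _ _).
  apply/funext => g; rewrite op_expansion (big_morph _ (rhoD _) (rho0 _)).
  by apply: eq_bigr => i _; rewrite rhoZ.
have hb := ladder_expansion Sjx.
apply: (@weak_expansion_uniq L (T (b j x)) _ (T (b j x))).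
  rewrite -[in weak_expansion L (T _)](addr0 (T (b j x))).
  have := weak_expansionD hTb (weak_expansion_shift hb).
  congr (weak_expansion _ _ _).
  by apply/funext => g; rewrite /L rhoD rhoZ.
have := weak_expansion_op (weak_expansionD hb (weak_expansion_shift hTb)).
rewrite addr0 TD => h i y; have [M hM] := h i y.
exists M => g r gE r8; have /andP[r0 r1] := r8.
rewrite (le_trans _ (hM g r gE r8))//.
have ptE : mob_pt g = r%:C by rewrite /mob_pt gE.
have <- : T (rho (mob_inv g) (b j x) + mob_pt g *: rho (mob_inv g) (T (b j x))) = L g.
  rewrite -rhoZ -rhoD /L ptE; apply: (associated_boost rhoU rhoT specT _ _ gE).
  by rewrite r0; lra.
by [].
Qed.

Let N i x : C := inner (b i x) (b i x).

Lemma inner_sum_ladder (c : I -> C) i x y :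
  inner (\sum_l c l *: b l x) (b i y) = if x == y then c i * N i y else 0.
Proof.
rewrite inner_suml; case: eqVneq => [->|xy].
  rewrite (bigD1 i)//= big1 ?addr0 ?innerZl// => l li.
  by rewrite innerZl orth ?mulr0.
by rewrite big1// => l _; rewrite innerZl ladder_orth ?mulr0// => -[_]; apply/eqP.
Qed.

(** Only two weights occur in the operator relation: [x], reached by one raising and one lowering,
    and [x + 1 + 1], reached by two raisings. The conditionals keep both components in one
    equation. *)
Lemma ladder_relation_inner i j x y : S j x ->
  (if x + 1 + 1 == y then coef i j x * ((x + 1)%:C + k i) * N i y else 0) -
  (if x == y then coef i j x * ((x + 1)%:C - k i) * N i y else 0) +
  (if x == y then (i == j)%:R * N i y else 0) =
  (if x + 1 + 1 == y then coef i j (x + 1) * (x%:C + k j) * N i y else 0) -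
  (if x == y then coef i j (x - 1) * (x%:C - k j) * N i y else 0) +
  (if x + 1 + 1 == y then (\sum_l coef i l (x + 1) * coef l j x) * N i y else 0).
Proof.
move=> Sjx; have := congr1 (fun v => inner v (b i y)) (ladder_relation Sjx).
have -> : \sum_l coef l j x *: D l (x + 1) =
   \sum_l (coef l j x * ((x + 1)%:C + k l)) *: b l (x + 1 + 1) -
   \sum_l (coef l j x * ((x + 1)%:C - k l)) *: b l x.
  rewrite -sumrB; apply: eq_bigr => l _.
  by rewrite /D /ladder_deriv scalerBr !scalerA addrK.
have -> : T (T (b j x)) =
    \sum_l (\sum_m coef l m (x + 1) * coef m j x) *: b l (x + 1 + 1).
  rewrite op_expansion Tsum.
  under eq_bigr do rewrite TZ op_expansion scaler_sumr.
  rewrite exchange_big /=; apply: eq_bigr => l _; rewrite scaler_suml.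
  by apply: eq_bigr => m _; rewrite scalerA mulrC.
have -> : T (D j x) = \sum_l (coef l j (x + 1) * (x%:C + k j)) *: b l (x + 1 + 1) -
    \sum_l (coef l j (x - 1) * (x%:C - k j)) *: b l x.
  rewrite /D /ladder_deriv TB !TZ !op_expansion !scaler_sumr subrK.
  by congr (_ - _); apply: eq_bigr => l _; rewrite scalerA mulrC.
rewrite /= 2!innerDl 2!innerBl !inner_sum_ladder => <-; congr (_ + _).
case: (eqVneq x y) => [<-|xy].
  have [->|ij] := eqVneq i j; first by rewrite mul1r.
  by rewrite orth ?mul0r// eq_sym.
by rewrite ladder_orth// => -[_]; apply/eqP.
Qed.

(** The component of weight [x]: T^2 does not reach it, so the equation is linear, and the constant
    1 of the commutator is its inhomogeneous term. *)
Lemma lowering_relation i j x : S i x -> S j x ->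
  ((x + 1)%:C - k i) * coef i j x - coef i j (x - 1) * (x%:C - k j) = (i == j)%:R.
Proof.
move=> Six Sjx; have Nx : N i x != 0.
  by rewrite inner_eq0; have [Si _ _ _] := lad i; apply/Si.
have := ladder_relation_inner i x Sjx.
have -> : (x + 1 + 1 == x) = false by apply/eqP => h; lra.
rewrite eqxx !sub0r addr0.
move: (coef i j x) (coef i j (x - 1)) (_%:R) => p q d.
rewrite -!mulNr -mulrDl => /(mulIf Nx) e.
transitivity (- p * ((x + 1)%:C - k i) + d + p * ((x + 1)%:C - k i)).
  by rewrite e; ring.
by ring.
Qed.

(** The component two weights up, where T^2 enters and the constant 1 does not. *)
Lemma raising_relation i j x : S i (x + 1 + 1) -> S j x ->
  ((x + 1)%:C + k i) * coef i j x - coef i j (x + 1) * (x%:C + k j) =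
  \sum_l coef i l (x + 1) * coef l j x.
Proof.
move=> Six Sjx; have Nx : N i (x + 1 + 1) != 0.
  by rewrite inner_eq0; have [Si _ _ _] := lad i; apply/Si.
have := ladder_relation_inner i (x + 1 + 1) Sjx.
have -> : (x == x + 1 + 1) = false by apply/eqP => h; lra.
rewrite eqxx !subr0 addr0 -!mulrDl => /(mulIf Nx) e.
by rewrite [_ * coef i j x]mulrC e addrC addKr.
Qed.

End System.
End Ladders.

(** * Decoupling and reducibility *)

Section Coefficients.
Context {R : realType}.
Local Notation C := (R[i]).

Definition hol (k : R) : set R := [set x | exists n : nat, x = k + n%:R].
Definition anti (k : R) : set R := [set x | exists n : nat, x = - k - n%:R].

(** Zeros propagate upwards from the lowest weight, whose predecessor is outside the support. The
    step may assume [f x != 0], which for matrix entries puts both weights in their supports. *)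
Lemma hol_ind (f : R -> C) k : (forall x, f x != 0 -> hol k x) ->
  (forall x, hol k x -> f x != 0 -> f (x - 1) = 0 -> f x = 0) ->
  forall x, f x = 0.
Proof.
move=> fk step x; apply/eqP/negPn/negP => fx; have [n xE] := fk x fx.
elim: n x fx xE => [|n IH] x fx xE; move: (fx); rewrite step ?eqxx//.
- by exists 0%N.
- apply/eqP/negPn/negP => /fk[n]; rewrite xE => h.
  by have := ler0n R n; lra.
- by exists n.+1.
- apply/eqP/negPn/negP => f1; apply: (IH _ f1).
  by rewrite xE -natr1; lra.
Qed.

Lemma anti_ind (f : R -> C) k : (forall x, f x != 0 -> anti k x) ->
  (forall x, anti k x -> f x != 0 -> f (x + 1) = 0 -> f x = 0) ->
  forall x, f x = 0.
Proof.
move=> fk step x; apply/eqP/negPn/negP => fx.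
suff : f (- (- x)) = 0 by rewrite opprK; apply/eqP.
apply: (@hol_ind (fun y => f (- y)) k).
  by move=> y /fk[n yE]; exists n; lra.
move=> y [n yE] fy fy1; apply: step => //; first by exists n; lra.
by rewrite -[RHS]fy1; congr f; lra.
Qed.

Lemma hol_add1 k x : hol k x -> hol k (x + 1).
Proof. by case=> n ->; exists n.+1; rewrite -natr1; lra. Qed.
Lemma anti_sub1 k x : anti k x -> anti k (x - 1).
Proof. by case=> n ->; exists n.+1; rewrite -natr1; lra. Qed.
Lemma hol_ge (k x : R) : hol k x -> k <= x.
Proof. by case=> n ->; rewrite lerDl. Qed.
Lemma anti_le (k x : R) : anti k x -> x <= - k.
Proof. by case=> n ->; have := ler0n R n; lra. Qed.

Lemma hol_lt1 (k x : R) : 0 < k -> hol k x -> x < 1 -> k = x.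
Proof.
move=> k0 [[|n] ->]; first by rewrite addr0.
by rewrite -natr1 => h; have := ler0n R n; lra.
Qed.
Lemma anti_gtN1 (k x : R) : 0 < k -> anti k x -> -1 < x -> k = - x.
Proof.
move=> k0 [[|n] ->]; first by rewrite subr0 opprK.
by rewrite -natr1 => h; have := ler0n R n; lra.
Qed.

Lemma hol_sub1 (k k' x : R) : k' <= x -> k <= k' -> hol k (x + 1) -> hol k x.
Proof.
move=> k'x kk' [[|n] xE]; first by move: xE; rewrite addr0 => h; lra.
by exists n; move: xE; rewrite -natr1 => h; lra.
Qed.

Lemma realC1 : (1 : R)%:C = 1 :> C. Proof. by []. Qed.
Definition realCE := (@realCD R, realC1).
Lemma realC_neq0 (x : R) : x != 0 -> x%:C != 0.
Proof. by move=> x0; rewrite -[0]/(0%:C) (inj_eq (@complexI R)). Qed.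

(** * Arrays with the support condition and the two recurrences *)

Context (I : finType) (S : I -> set R) (k : I -> C) (c : I -> I -> R -> C).
Hypotheses
  (csupp : forall i j x, c i j x != 0 -> S j x /\ S i (x + 1))
  (clow : forall i j x, S i x -> S j x ->
    ((x + 1)%:C - k i) * c i j x - c i j (x - 1) * (x%:C - k j) = (i == j)%:R)
  (crai : forall i j x, S i (x + 1 + 1) -> S j x ->
    ((x + 1)%:C + k i) * c i j x - c i j (x + 1) * (x%:C + k j) =
    \sum_l c i l (x + 1) * c l j x).

Let c0l i j x : ~ S j x -> c i j x = 0.
Proof. by move=> nS; apply/eqP/negPn/negP => /csupp[]. Qed.
Let c0r i j x : ~ S i (x + 1) -> c i j x = 0.
Proof. by move=> nS; apply/eqP/negPn/negP => /csupp[]. Qed.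

(** For distinct summands the lowering relation is homogeneous, so a zero passes from x - 1 to x
    unless x + 1 = k_i. Read backwards, in [chigh0], it passes from x + 1 to x unless x + 1 =
    k_j. *)
Let clow0 i j x : i != j -> S i x -> S j x -> c i j (x - 1) = 0 ->
  (x + 1)%:C - k i != 0 -> c i j x = 0.
Proof.
move=> ij Si Sj h nz; have := clow Si Sj.
rewrite h mul0r subr0 (negPf ij) => /eqP; rewrite mulf_eq0 (negPf nz) /=.
by move=> /eqP.
Qed.

Let chigh0 i j x : i != j -> S i (x + 1) -> S j (x + 1) -> c i j (x + 1) = 0 ->
  (x + 1)%:C - k j != 0 -> c i j x = 0.
Proof.
move=> ij Si Sj h nz; have := clow Si Sj.
rewrite h mulr0 addrK sub0r (negPf ij) => /eqP; rewrite oppr_eq0 mulf_eq0 (negPf nz) orbF.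
by move=> /eqP.
Qed.

(** * One two-sided ladder beside a holomorphic and an anti-holomorphic one *)

Section ContinuousSummand.
Context (q p m : I) (kp km : R).
Hypotheses (qp : q != p) (qm : q != m) (pm : p != m)
  (all3 : forall l, [\/ l = q, l = p | l = m])
  (km0 : 0 < km)
  (kpE : k p = kp%:C) (kmE : k m = km%:C)
  (Sp : S p = hol kp) (Sm : S m = anti km)
  (Sq : forall x, S q x <-> S q (x + 1))
  (kq : forall x, S q x -> x%:C - k q != 0 /\ x%:C + k q != 0).

Let Sqs x : S q (x - 1) <-> S q x.
Proof. by have := Sq (x - 1); rewrite subrK. Qed.

(** The entries start at the lowest weight of [p], and y + 1 - k_q never vanishes on the two-sided
    ladder of [q], so the zero below the support propagates. [c_mq] is the same argument downwards,
    from the highest weight of [m]. *)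
Let c_qp x : c q p x = 0.
Proof.
apply: (@hol_ind (c q p) kp); first by move=> y /csupp; rewrite Sp => -[].
move=> y py ny h; have [_ qy1] := csupp ny; have qy := iffRL (Sq y) qy1.
by apply: clow0 => //; [rewrite Sp|have [] := kq qy1].
Qed.

Let c_mq x : c m q x = 0.
Proof.
apply: (@anti_ind (c m q) (km + 1)).
  by move=> y /csupp; rewrite Sm => -[_ [n yE]]; exists n; lra.
move=> y [n yE] ny h; have [qy my] := csupp ny.
have qy1 := iffLR (Sq y) qy.
by apply: chigh0 => //; [rewrite eq_sym|have [] := kq qy1].
Qed.

Let sum3 (f : I -> C) : \sum_l f l = f q + f p + f m.
Proof.
rewrite (bigD1 q)//= (bigD1 p)/= ?(eq_sym p)// (bigD1 m)/=; last first.
  by rewrite !(eq_sym m) qm.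
rewrite big1 ?addr0 ?addrA// => l /andP[/andP[lq lp] lm].
by have [] := all3 l => E; rewrite E eqxx in lq lp lm.
Qed.

(** Lowering at x + 1 expresses c_qq(x + 1) through u = c_qq(x). Inserted in raising at x, where
    only [q] itself survives in the sum, it gives a quadratic equation that factors as (u - 1) (u (x
    + 1 - k_q) - (x + k_q)) = 0. *)
Let c_qq x : S q x ->
  c q q x = 1 \/ c q q x * ((x + 1)%:C - k q) = x%:C + k q.
Proof.
move=> qx; have qx1 := iffLR (Sq x) qx; have qx2 := iffLR (Sq _) qx1.
have low := clow qx1 qx1; rewrite addrK eqxx mulr1n in low.
have rai := crai qx2 qx; rewrite sum3 c_qp c_mq mul0r mulr0 !addr0 in rai.
have [n1 n1'] := kq qx1; have [n2 _] := kq qx2.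
move: low rai; set u := c q q x; set v := c q q (x + 1) => low rai.
rewrite !realCE in low rai n1 n2 *.
have vE : v = (1 + u * (x%:C + 1 - k q)) / (x%:C + 1 + 1 - k q).
  by apply: (mulIf n2); rewrite divfK// mulrC; apply/eqP; rewrite -subr_eq low.
have : (u - 1) * (u * (x%:C + 1 - k q) - (x%:C + k q)) = 0.
  have h : (x%:C + 1 + k q) * u - v * (x%:C + k q) - v * u = 0.
    by rewrite rai subrr.
  have <- : - (((x%:C + 1 + k q) * u - v * (x%:C + k q) - v * u) *
      (x%:C + 1 + 1 - k q)) = (u - 1) * (u * (x%:C + 1 - k q) - (x%:C + k q)).
    by rewrite vE; field.
  by rewrite h mul0r oppr0.
by move=> /eqP; rewrite mulf_eq0 !subr_eq0 => /orP[] /eqP; [left|right].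
Qed.

(** Above the entry weight y = k_p - 1 the zero propagates. At y itself, raising at y - 1 turns a
    nonzero entry into c_qq(y - 1) = - (y - 1 + k_q); each of the two values allowed by [c_qq] then
    annihilates a factor x + k_q or x - k_q at some weight of [q]. *)
Let c_pq x : c p q x = 0.
Proof.
apply: (@hol_ind (c p q) (kp - 1)).
  by move=> y /csupp; rewrite Sp => -[_ [n yE]]; exists n; lra.
move=> y [n yE] ny h; have [qy py] := csupp ny.
case: n => [|n] in yE.
  have qy1 := iffRL (Sqs y) qy.
  have py1 : S p (y - 1 + 1 + 1) by rewrite subrK.
  have := crai py1 qy1; rewrite sum3 h c_mq subrK !mulr0 !addr0 sub0r => /eqP.
  rewrite eq_sym -subr_eq0 opprK -mulrDr mulf_eq0 (negPf ny) /= => /eqP e.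
  have [a1 a2] := kq qy1; have [a3 a4] := kq qy; have [a5 a6] := kq (iffLR (Sq y) qy).
  have [e1|] := c_qq qy1.
    move: e a4; rewrite e1 !realCE => e /eqP; case.
    by rewrite -[RHS]e rmorphN /=; ring.
  move: e => /eqP; rewrite addrC addr_eq0 => /eqP e.
  have -> : c q q (y - 1) = - ((y - 1)%:C + k q) by rewrite e opprK.
  rewrite subrK => /eqP; rewrite -subr_eq0.
  have -> : - ((y - 1)%:C + k q) * (y%:C - k q) - ((y - 1)%:C + k q) =
     - ((y - 1)%:C + k q) * ((y + 1)%:C - k q) by rewrite !realCE; ring.
  by rewrite mulf_eq0 oppr_eq0 (negPf a2) (negPf a5).
apply: clow0 => //; first by rewrite eq_sym.
  by rewrite Sp; exists n; move: yE; rewrite -natr1; lra.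
rewrite kpE -rmorphB realC_neq0//; apply/eqP => e.
by move: yE; rewrite -natr1; have := ler0n R n; lra.
Qed.

(** The mirror image: at the highest weight y = - k_m a nonzero entry forces c_qq(y + 1) = y + 1 +
    k_q, which both values of [c_qq] exclude. *)
Let c_qm x : c q m x = 0.
Proof.
apply: (@anti_ind (c q m) km); first by move=> y /csupp; rewrite Sm => -[].
move=> y [n yE] ny h; have [my qy] := csupp ny.
have qy' := iffRL (Sq y) qy.
have qy2 := iffLR (Sq _) qy.
case: n => [|n] in yE.
  have := crai qy2 my; rewrite sum3 h c_qp !mul0r !addr0 subr0 => /eqP.
  rewrite -subr_eq0 -mulrBl mulf_eq0 (negPf ny) orbF subr_eq0 => /eqP e.
  have [a1 a2] := kq qy'; have [a3 a4] := kq qy; have [a5 a6] := kq qy2.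
  have [e1|] := c_qq qy.
    move: e a2; rewrite e1 !realCE => e /eqP; case.
    by apply: (addIr 1); rewrite add0r -[RHS]e; ring.
  rewrite -e => /eqP; rewrite -subr_eq0.
  have -> : ((y + 1)%:C + k q) * ((y + 1 + 1)%:C - k q) - ((y + 1)%:C + k q) =
     ((y + 1)%:C + k q) * ((y + 1)%:C - k q) by rewrite !realCE; ring.
  by rewrite mulf_eq0 (negPf a4) (negPf a3).
apply: chigh0 => //.
  by rewrite Sm; exists n; move: yE; rewrite -natr1; lra.
rewrite kmE -rmorphB realC_neq0//; apply/eqP => e.
by move: yE km0; rewrite -natr1; have := ler0n R n; lra.
Qed.

Lemma continuous_decoupled l x : l != q -> c q l x = 0 /\ c l q x = 0.
Proof. by case: (all3 l) => -> //; rewrite eqxx. Qed.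

End ContinuousSummand.

(** * Couplings among discrete series *)

Section DiscreteSummands.
Context (sg : I -> bool) (kr : I -> R).
Hypotheses (kr0 : forall i, 0 < kr i) (kE : forall i, k i = (kr i)%:C)
  (Shol : forall i, sg i -> S i = hol (kr i))
  (Santi : forall i, ~~ sg i -> S i = anti (kr i)).

Let hol_pos i x : sg i -> S i x -> 0 < x.
Proof. by move=> hi; rewrite Shol// => /hol_ge; apply: lt_le_trans. Qed.
Let anti_neg i x : ~~ sg i -> S i x -> x < 0.
Proof.
by move=> hi; rewrite Santi// => /anti_le h; apply: le_lt_trans h _; rewrite oppr_lt0.
Qed.

Let csum i j x y (l0 : I) : (forall l, l != l0 -> c i l y * c l j x = 0) ->
  \sum_l c i l y * c l j x = c i l0 y * c l0 j x.
Proof. by move=> h; rewrite (bigD1 l0)//= big1 ?addr0. Qed.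

(** [T] raises weights, while holomorphic weights are positive and anti-holomorphic ones
    negative. *)
Lemma anti_hol0 i j x : ~~ sg i -> sg j -> c i j x = 0.
Proof.
move=> hi hj; apply/eqP/negPn/negP => /csupp[/(hol_pos hj) h1 /(anti_neg hi) h2].
by move: h1 h2; lra.
Qed.

(** At the lowest weight the coefficient x - k of the preceding entry is zero, so the recurrence
    starts by itself with the value 1. The diagonal block is multiplication by z in the basis of
    monomials. *)
Lemma hol_diag i x : sg i -> S i x -> c i i x = 1.
Proof.
move=> hi; rewrite Shol// => -[n ->].
elim: n => [|n IH].
  have Si : S i (kr i) by rewrite Shol//; exists 0%N; rewrite addr0.
  have := clow Si Si; rewrite kE subrr mulr0 subr0 eqxx realCE addrAC subrr add0r.
  by rewrite mul1r addr0.
have Si : S i (kr i + n.+1%:R) by rewrite Shol//; exists n.+1.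
have := clow Si Si; have -> : kr i + n.+1%:R - 1 = kr i + n%:R.
  by rewrite -natr1 addrA addrK.
rewrite IH mul1r eqxx kE => /eqP; rewrite subr_eq => /eqP h.
have nz : (kr i + n.+1%:R + 1)%:C - (kr i)%:C != 0.
  rewrite -rmorphB realC_neq0//; apply/eqP => e.
  by have := ler0n R n.+1; move: e; lra.
by apply: (mulfI nz); rewrite h !realCE mulr1n; ring.
Qed.

(** All weights of [j] are at least k_i, so the exceptional x = k_i - 1 is never met. In the
    opposite order the lowering relation alone does not force the entry at k_i - 1 to vanish. *)
Lemma hol_hol0 i j x : sg i -> sg j -> i != j -> kr i <= kr j -> c i j x = 0.
Proof.
move=> hi hj ij kij; apply: (@hol_ind (c i j) (kr j)).
  by move=> y /csupp[]; rewrite (Shol hj).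
move=> y jy ny h; have [Sj Si] := csupp ny.
have yk := hol_ge jy.
have Siy : S i y by move: Si; rewrite Shol//; apply: hol_sub1 kij.
apply: clow0 => //.
rewrite kE -rmorphB realC_neq0//; apply/eqP => e.
by move: e yk kij; lra.
Qed.

(** The recurrence starts at n = 0, where the target is outside the support, and is solved by n / (n
    - 1 + 2 k). It is multiplied out because this denominator vanishes for n = 0, k = 1/2. For k =
    1/2 all entries with n > 0 equal 1. *)
Lemma anti_diag i n : ~~ sg i ->
  c i i (- kr i - n%:R) * (n%:R - 1 + 2 * (kr i)%:C) = n%:R.
Proof.
move=> hi; have Sn m : S i (- kr i - m%:R) by rewrite Santi//; exists m.
elim: n => [|n IH].
  by rewrite c0r ?mul0r//; rewrite Santi// => /anti_le h; move: h; rewrite subr0; lra.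
have := clow (Sn n) (Sn n).
have -> : - kr i - n%:R - 1 = - kr i - n.+1%:R by rewrite -natr1 opprD addrA.
rewrite eqxx kE; set u := c i i _ in IH *; set v := c i i _.
rewrite !(realCE, rmorphB, rmorphN, rmorph_nat) /= => h; rewrite -natr1.
have -> : v * (n%:R + 1 - 1 + 2 * (kr i)%:C) =
  (- (kr i)%:C - n%:R + 1 - (kr i)%:C) * u - v * (- (kr i)%:C - n%:R - (kr i)%:C) +
  u * (n%:R - 1 + 2 * (kr i)%:C) by ring.
by rewrite h IH addrC.
Qed.

Lemma anti_anti0 i j x : ~~ sg i -> ~~ sg j -> i != j -> kr j <= kr i ->
  c i j x = 0.
Proof.
move=> hi hj ij kij; apply: (@anti_ind (c i j) (kr i + 1)).
  by move=> y /csupp[_]; rewrite (Santi hi) => -[n yE]; exists n; lra.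
move=> y [n yE] ny h; have [Sj Si] := csupp ny.
have Sj1 : S j (y + 1).
  move: Sj; rewrite Santi// => -[[|l] yE']; last first.
    by exists l; move: yE'; rewrite -natr1; lra.
  by move: yE'; rewrite subr0 => yE'; have := ler0n R n; move: yE yE' kij; lra.
apply: chigh0 => //.
rewrite kE -rmorphB realC_neq0//; apply/eqP => e.
by have := anti_neg hi Si; have := kr0 j; move: e; lra.
Qed.

(* The exceptional value 1/2 is that of D_1^+ and D_1^-, the two halves of P_{1,0}. *)
Lemma cross_half i j x : sg i -> ~~ sg j -> c i j x != 0 ->
  [/\ x = - 2^-1, kr i = 2^-1 & kr j = 2^-1].
Proof.
move=> hi hj nz; have [Sj Si] := csupp nz.
have x0 := anti_neg hj Sj; have x1 := hol_pos hi Si.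
(* Since x < 0 < x + 1, the target lies below 1 and x lies above -1; so they are the lowest weight
   of [i] and the highest weight of [j]. *)
have ki : kr i = x + 1.
  by move: Si; rewrite Shol// => /hol_lt1; apply => //; lra.
have kj : kr j = - x.
  by move: Sj; rewrite Santi// => /anti_gtN1; apply => //; lra.
(* Raising at x: the entry at x + 1 is zero because x + 1 > 0 is no weight of [j], and in the sum
   only l = i survives, with c_ii = 1. Hence 2 (x + 1) = 1. *)
have Si2 : S i (x + 1 + 1) by rewrite Shol//; apply: hol_add1; rewrite -Shol.
have := crai Si2 Sj; rewrite (@csum i j x (x + 1) i); last first.
  move=> l li; have [hl|hl] := boolP (sg l); last first.
    by rewrite c0l ?mul0r// => /(anti_neg hl) h; move: x1 h; lra.
  have [->|nl] := eqVneq (c l j x) 0; first by rewrite mulr0.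
  have [_ Sl] := csupp nl; rewrite hol_hol0 ?mul0r// 1?eq_sym//.
  have -> : kr l = x + 1 by move: Sl; rewrite Shol// => /hol_lt1; apply => //; lra.
  by rewrite ki.
rewrite (@c0l i j (x + 1)); last by move=> /(anti_neg hj) h; move: x1 h; lra.
rewrite mul0r subr0 hol_diag// => /(mulIf nz).
rewrite kE ki -rmorphD => h.
have {}h : x + 1 + (x + 1) = 1 by apply: (@complexI R); exact: h.
by split; lra.
Qed.

(** If k_i' < 1/2, the weights of [i] and [i'] never differ by an integer. Otherwise only the entry
    from [i] to [i'] is in question, at y = k_i' - 1. If y = 1/2, raising from [j] at -1/2 gives
    c_i'i(1/2) c_ij(-1/2) = 0; if y > 1/2, raising from [i] at y - 1 gives (y + k_i) c_i'i(y) = 0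
    with a positive factor. *)
Lemma cross_hol_decoupled i i' j : sg i -> sg i' -> ~~ sg j -> i != i' ->
  (forall l, sg l -> l = i \/ l = i') ->
  c i j (- 2^-1) != 0 -> kr i' != 2^-1 ->
  forall l x, l != i' -> c i' l x = 0 /\ c l i' x = 0.
Proof.
move=> hi hi' hj ii' hol2 nz ki' l x li'.
have [_ ki kj] := cross_half hi hj nz.
have cr j' y : ~~ sg j' -> c i' j' y = 0.
  move=> hj'; apply/eqP/negPn/negP => /(cross_half hi' hj')[_ e _].
  by rewrite e eqxx in ki'.
have [hl|hl] := boolP (sg l); last by split; [exact: cr|exact: anti_hol0].
have {hl li'}-> : l = i by case: (hol2 l hl) => // e; rewrite e eqxx in li'.
have lt1 y : S i y -> S i' (y + 1) -> kr i' < kr i -> False.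
  rewrite (Shol hi) (Shol hi') ki => -[n ->] [m e] lt; have := kr0 i'.
  have : (n%:R : R) + 2 > m%:R by move: e lt; have := kr0 i'; lra.
  rewrite -[2]/(2%:R) -natrD ltr_nat => l1 k0.
  have : (m%:R : R) > n%:R + 1 by move: e lt; lra.
  by rewrite natr1 ltr_nat => l2; move: l1; rewrite addn2 ltnS leqNgt l2.
have lt2 y : S i' y -> S i (y + 1) -> kr i' < kr i -> False.
  rewrite (Shol hi) (Shol hi') ki => -[n ->] [m e] lt.
  have : (n%:R : R) + 1 > m%:R by move: e lt; lra.
  rewrite natr1 ltr_nat => l1.
  have : (m%:R : R) > n%:R by have := kr0 i'; move: e lt; lra.
  by rewrite ltr_nat => l2; move: l1; rewrite ltnS leqNgt l2.
split; last first.
  have [lt|le] := ltP (kr i') (kr i); last exact: hol_hol0.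
  by apply/eqP/negPn/negP => /csupp[h1 h2]; exact: (lt2 x).
have [lt|le] := ltP (kr i') (kr i).
  by apply/eqP/negPn/negP => /csupp[h1 h2]; exact: (lt1 x).
apply: (@hol_ind (c i' i) (kr i' - 1)).
  by move=> y /csupp; rewrite (Shol hi') => -[_ [n yE]]; exists n; lra.
move=> y [n yE] ny h; have [Si Si'] := csupp ny.
case: n => [|n] in yE; last first.
  apply: clow0 => //; first by rewrite eq_sym.
    by rewrite Shol//; exists n; move: yE; rewrite -natr1; lra.
  rewrite kE -rmorphB realC_neq0//; apply/eqP => e.
  by move: yE; rewrite -natr1; have := ler0n R n; move: e; lra.
have hn l' : sg l' -> l' != i -> l' != i' -> False.
  by move=> /hol2[] ->; rewrite eqxx.
move: (Si); rewrite Shol// => -[[|m] yE'].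
  have Sj : S j (y - 1) by rewrite Santi//; exists 0%N; move: yE'; rewrite ki kj; lra.
  have := @crai i' j (y - 1); rewrite !subrK => /(_ Si' Sj).
  rewrite !(cr j)// mulr0 mul0r subr0 (@csum i' j (y - 1) y i); last first.
    move=> l' li; have [hl|hl] := boolP (sg l').
      have [->|li'] := eqVneq l' i'; first by rewrite (cr j) ?mulr0.
      by case: (hn l').
    by rewrite (cr l') ?mul0r.
  have -> : y - 1 = - 2^-1 by move: yE'; rewrite ki; lra.
  by move=> /esym/eqP; rewrite mulf_eq0 (negPf nz) orbF => /eqP.
have Si1 : S i (y - 1) by rewrite Shol//; exists m; move: yE'; rewrite -natr1; lra.
have := @crai i' i (y - 1); rewrite !subrK => /(_ Si' Si1).
rewrite h mulr0 sub0r (@csum i' i (y - 1) y i); last first.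
  move=> l' li; have [hl|hl] := boolP (sg l').
    have [->|li'] := eqVneq l' i'; first by rewrite h mulr0.
    by case: (hn l').
  by rewrite (cr l') ?mul0r.
rewrite hol_diag// mulr1 => /eqP; rewrite -subr_eq0 -opprD oppr_eq0.
rewrite -{2}[c i' i y]mulr1 -mulrDr mulf_eq0 (negPf ny) /= kE -rmorphD -rmorphD.
move=> /eqP e.
have {}e : y - 1 + kr i + 1 = 0 by apply: (@complexI R); exact: e.
by exfalso; have := hol_pos hi Si; have := kr0 i; move: yE' e; rewrite -natr1; have := ler0n R m; lra.
Qed.

(** The mirror image: at the highest weight y = - k_j' raising is taken into [i] when y + 1 = -1/2,
    and into [j] otherwise, where c_jj = 1 leaves the impossible equation y + 3/2 = 1. *)
Lemma cross_anti_decoupled i j j' : sg i -> ~~ sg j -> ~~ sg j' -> j != j' ->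
  (forall l, ~~ sg l -> l = j \/ l = j') ->
  c i j (- 2^-1) != 0 -> kr j' != 2^-1 ->
  forall l x, l != j' -> c j' l x = 0 /\ c l j' x = 0.
Proof.
move=> hi hj hj' jj' anti2 nz kj' l x lj'.
have [_ ki kj] := cross_half hi hj nz.
have cr i' y : sg i' -> c i' j' y = 0.
  move=> hi'; apply/eqP/negPn/negP => /(cross_half hi' hj')[_ _ e].
  by rewrite e eqxx in kj'.
have [hl|hl] := boolP (sg l); first by split; [exact: anti_hol0|exact: cr].
have {hl lj'}-> : l = j by case: (anti2 l hl) => // e; rewrite e eqxx in lj'.
have lt1 y : S j' y -> S j (y + 1) -> kr j' < kr j -> False.
  rewrite (Santi hj) (Santi hj') kj => -[n ->] [m e] lt; have := kr0 j'.
  have : (m%:R : R) + 2 > n%:R by move: e lt; have := kr0 j'; lra.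
  rewrite -[2]/(2%:R) -natrD ltr_nat => l1 k0.
  have : (n%:R : R) > m%:R + 1 by move: e lt; lra.
  by rewrite natr1 ltr_nat => l2; move: l1; rewrite addn2 ltnS leqNgt l2.
have lt2 y : S j y -> S j' (y + 1) -> kr j' < kr j -> False.
  rewrite (Santi hj) (Santi hj') kj => -[n ->] [m e] lt.
  have : (m%:R : R) + 1 > n%:R by move: e lt; lra.
  rewrite natr1 ltr_nat => l1.
  have : (n%:R : R) > m%:R by have := kr0 j'; move: e lt; lra.
  by rewrite ltr_nat => l2; move: l1; rewrite ltnS leqNgt l2.
split.
  have [lt|le] := ltP (kr j') (kr j); last by apply: anti_anti0 => //; rewrite eq_sym.
  by apply/eqP/negPn/negP => /csupp[h1 h2]; exact: (lt2 x).
have [lt|le] := ltP (kr j') (kr j).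
  by apply/eqP/negPn/negP => /csupp[h1 h2]; exact: (lt1 x).
apply: (@anti_ind (c j j') (kr j')); first by move=> y /csupp; rewrite (Santi hj') => -[].
move=> y [n yE] ny h; have [Sj' Sj] := csupp ny.
case: n => [|n] in yE; last first.
  apply: chigh0 => //.
    by rewrite Santi//; exists n; move: yE; rewrite -natr1; lra.
  rewrite kE -rmorphB realC_neq0//; apply/eqP => e.
  by have := anti_neg hj Sj; have := kr0 j'; move: e; lra.
have hn l' : ~~ sg l' -> l' != j -> l' != j' -> False.
  by move=> /anti2[] ->; rewrite eqxx.
move: (Sj); rewrite Santi// => -[[|m] yE'].
  have yv : y + 1 = - 2^-1 by move: yE'; rewrite kj; lra.
  have Si : S i (y + 1 + 1).
    by rewrite Shol//; exists 0%N; move: yv; rewrite ki; lra.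
  have := crai Si Sj'; rewrite !(cr i)// mulr0 mul0r subr0.
  rewrite (@csum i j' y (y + 1) j); last first.
    move=> l' lj; have [hl|hl] := boolP (sg l'); first by rewrite (cr l') ?mulr0.
    have [->|lj'] := eqVneq l' j'; first by rewrite (cr i) ?mul0r.
    by case: (hn l').
  by rewrite yv => /esym/eqP; rewrite mulf_eq0 (negPf nz) /= => /eqP.
have Sj2 : S j (y + 1 + 1) by rewrite Santi//; exists m; move: yE'; rewrite -natr1; lra.
have := crai Sj2 Sj'; rewrite h mul0r subr0 (@csum j j' y (y + 1) j); last first.
  move=> l' lj; have [hl|hl] := boolP (sg l').
    by rewrite anti_hol0 ?mul0r.
  have [->|lj'] := eqVneq l' j'; last by case: (hn l').
  rewrite (@c0r j' j' y) ?mulr0// Santi// => /anti_le h'.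
  by move: h' yE; rewrite subr0; lra.
have d1 : c j j (y + 1) = 1.
  have := @anti_diag j m.+1 hj; rewrite -yE' kj => h'.
  have m0 : (m.+1%:R : C) != 0 by rewrite pnatr_eq0.
  apply: (mulIf m0); rewrite mul1r -[RHS]h'; congr (_ * _).
  by rewrite fmorphV rmorph_nat divff ?pnatr_eq0// subrK.
rewrite d1 kE kj -rmorphD => /(mulIf ny) e.
have {}e : y + 1 + 2^-1 = 1 by apply: (@complexI R); exact: e.
by exfalso; move: e yE'; rewrite kj -natr1; have := ler0n R m; lra.
Qed.

Lemma anti_diag_half j x : ~~ sg j -> kr j = 2^-1 -> S j x -> S j (x + 1) ->
  c j j x = 1.
Proof.
move=> hj kj; rewrite Santi// kj => -[[|m] xE] /anti_le h.
  by exfalso; move: h xE; rewrite subr0; lra.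
have := @anti_diag j m.+1 hj; rewrite kj -xE => h'.
have m0 : (m.+1%:R : C) != 0 by rewrite pnatr_eq0.
apply: (mulIf m0); rewrite mul1r -[RHS]h'; congr (_ * _).
by rewrite fmorphV rmorph_nat divff ?pnatr_eq0// subrK.
Qed.

End DiscreteSummands.

End Coefficients.

(** * Singular vectors of a 2 x 2 matrix *)

Section SingularVectors.
Context {R : realType}.
Local Notation C := (R[i]).

Lemma quadratic_root (a b d : C) : a != 0 -> exists t, a * t ^+ 2 + b * t + d = 0.
Proof.
move=> a0; exists ((- b + sqrtC (b ^+ 2 - 4 * a * d)) / (2 * a)).
have := sqrtCK (b ^+ 2 - 4 * a * d); set r := sqrtC _ => rE.
have -> : a * ((- b + r) / (2 * a)) ^+ 2 + b * ((- b + r) / (2 * a)) + d =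
   (r ^+ 2 - (b ^+ 2 - 4 * a * d)) / (4 * a) by field.
by rewrite rE subrr mul0r.
Qed.

(* A singular value decomposition of a 2 x 2 matrix for weighted inner products:
   s and h span the matching lines, (- M2 s2^*, M1 s1^* ) and (- N2 h2^*, N1 h1^* )
   their orthogonal complements. *)
Lemma singular_vectors (a11 a12 a21 a22 N1 N2 M1 M2 : C) :
  0 < N1 -> 0 < N2 -> 0 < M1 -> 0 < M2 ->
  exists s1 s2 h1 h2 : C, [/\ (s1 != 0) || (s2 != 0), (h1 != 0) || (h2 != 0),
    (a21 * s1 + a22 * s2) * h1 = (a11 * s1 + a12 * s2) * h2 &
    N1 * (a11 * (- (M2 * s2^*)) + a12 * (M1 * s1^*)) * h1^* +
    N2 * (a21 * (- (M2 * s2^*)) + a22 * (M1 * s1^*)) * h2^* = 0].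
Proof.
move=> N10 N20 M10 M20.
have cj (x : C) : 0 < x -> x^* = x by move=> x0; rewrite conj_Creal// gtr0_real.
(* g is the Gram matrix of the columns of a for the weights N. Orthogonality of the images of s and
   of its complement is a quadratic equation in s2 / s1; when its leading coefficient vanishes, s =
   (1, 0) is a solution. *)
pose g11 := N1 * a11 * a11^* + N2 * a21 * a21^*.
pose g12 := N1 * a11 * a12^* + N2 * a21 * a22^*.
pose g21 := N1 * a12 * a11^* + N2 * a22 * a21^*.
pose g22 := N1 * a12 * a12^* + N2 * a22 * a22^*.
have [s1 [s2 [s0 sE]]] : exists s1 s2 : C, (s1 != 0) || (s2 != 0) /\
   - M2 * (s1 * s2 * g11 + s2 ^+ 2 * g21) + M1 * (s1 ^+ 2 * g12 + s1 * s2 * g22) = 0.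
  have [g0|g0] := eqVneq g21 0.
    exists 1, 0; rewrite oner_eq0; split=> //.
    have -> : g12 = 0.
      apply: (can_inj conjCK); rewrite conjC0 -g0 /g12 /g21 !rmorphD !rmorphM /=.
      by rewrite !conjCK !(cj N1, cj N2)//; ring.
    ring.
  have M2g : - M2 * g21 != 0 by rewrite mulf_neq0 ?oppr_eq0// gt_eqF.
  have [t tE] := quadratic_root (M1 * g22 - M2 * g11) (M1 * g12) M2g.
  by exists 1, t; rewrite oner_eq0; split=> //; rewrite -[RHS]tE; ring.
exists s1, s2.
pose v1 := a11 * s1 + a12 * s2; pose v2 := a21 * s1 + a22 * s2.
pose w1 := a11 * (- (M2 * s2^*)) + a12 * (M1 * s1^*).
pose w2 := a21 * (- (M2 * s2^*)) + a22 * (M1 * s1^*).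
have vw : N1 * w1 * v1^* + N2 * w2 * v2^* = 0.
  apply: (can_inj conjCK); rewrite conjC0 -[RHS]sE.
  rewrite /w1 /w2 /v1 /v2 !(rmorphD, rmorphM, rmorphN) /= !conjCK !(cj N1, cj N2, cj M1, cj M2)//.
  by rewrite /g11 /g12 /g21 /g22; ring.
have [vz|vz] := boolP ((v1 != 0) || (v2 != 0)).
  by exists v1, v2; split => //; rewrite -/v1 -/v2 mulrC.
move: vz; rewrite negb_or !negbK => /andP[/eqP v10 /eqP v20].
(* Here the image v of s is zero, so h only has to be orthogonal to w; if w is zero as well, any h
   works. *)
have [wz|wz] := boolP ((w1 != 0) || (w2 != 0)).
  exists (- (N2 * w2^*)), (N1 * w1^*); split => //.
  - move: wz; rewrite oppr_eq0 !mulf_eq0 !conjC_eq0 (gt_eqF N10) (gt_eqF N20) /=.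
    by rewrite orbC.
  - by rewrite -/v1 -/v2 v10 v20 !mul0r.
  - by rewrite -/w1 -/w2 rmorphN !rmorphM /= !conjCK !cj//; ring.
move: wz; rewrite negb_or !negbK => /andP[/eqP w10 /eqP w20].
exists 1, 0; split; rewrite ?oner_eq0//.
  by rewrite -/v1 -/v2 v10 v20 !mul0r.
by rewrite -/w1 -/w2 w10 w20 !mulr0 !mul0r addr0.
Qed.
End SingularVectors.

(** * Reducing subspaces from vanishing couplings *)

Section Reducibility.
Context {R : realType}.
Local Notation C := (R[i]).

Section Split.
Context {H : hilbertType R} (I : finType) (T : H -> H) (rho : mob R -> H -> H).
Context (k : I -> C) (S : I -> set R) (b : I -> R -> H).
Hypotheses (boundedT : bounded_op T) (rhoU : forall g, unitary (rho g))
  (rhoT : associated rho T) (specT : spectrum T `<=` [set z | `|z| <= 1])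
  (lad : forall i, ladder rho (k i) (S i) (b i))
  (orth : forall i j x y, i != j -> inner (b i x) (b j y) = 0)
  (rho_orth : forall i j x y, i != j -> S i x -> exists M : R, forall g r,
     mob_pair g = (1, r%:C) -> 0 < r < 8^-1 ->
     `|inner (rho (mob_inv g) (b i x)) (b j y)| <= (M * r ^+ 2)%:C)
  (tot : forall v, (forall i x, inner v (b i x) = 0) -> v = 0).

Let c i j x := coef T b i j x.
Let csupp i j x : c i j x != 0 -> S j x /\ S i (x + 1).
Proof. exact: (coef_support boundedT lad). Qed.
Let clow i j x : S i x -> S j x ->
  ((x + 1)%:C - k i) * c i j x - c i j (x - 1) * (x%:C - k j) = (i == j)%:R.
Proof. exact: (lowering_relation boundedT rhoU rhoT specT lad orth rho_orth tot). Qed.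
Let crai i j x : S i (x + 1 + 1) -> S j x ->
  ((x + 1)%:C + k i) * c i j x - c i j (x + 1) * (x%:C + k j) =
  \sum_l c i l (x + 1) * c l j x.
Proof. exact: (raising_relation boundedT rhoU rhoT specT lad orth rho_orth tot). Qed.

Let inner_op i j x y : inner (T (b j x)) (b i y) =
  if y == x + 1 then c i j x * inner (b i y) (b i y) else 0.
Proof.
case: eqVneq => [->|xy]; first by rewrite coefM.
exact: (weight_shift boundedT rhoU rhoT lad).
Qed.

Let b_neq0 i x : S i x -> b i x != 0.
Proof. by have [h _ _ _] := lad i; move=> /h. Qed.

Lemma reducible_subsystem (P : pred I) :
  (forall i j x, P i != P j -> c i j x = 0) ->
  (exists i x, P i /\ S i x) -> (exists i x, ~~ P i /\ S i x) -> reducible T.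
Proof.
move=> cP [i [x [Pi Six]]] [j [y [Pj Sjy]]].
apply: (@reducible_split _ _ (I * R)%type (fun p => b p.1 p.2)
  (fun p => P p.1)) => //=.
- by move=> [i1 x1] [i2 x2]; exact: (ladder_orth lad orth).
- by move=> v hv; apply: tot => i1 x1; exact: (hv (i1, x1)).
- move=> [i1 x1] [i2 x2] /= P2 /negP P1; rewrite inner_op cP ?mul0r ?if_same//.
  by rewrite P2 (negPf P1).
- move=> [i1 x1] [i2 x2] /= /negP P2 P1; rewrite inner_op cP ?mul0r ?if_same//.
  by rewrite P1 (negPf P2).
- by exists (i, x) => //=; exact: b_neq0.
- by exists (j, y) => /=; [exact/negP|exact: b_neq0].
Qed.

Lemma reducible_summand q : (forall l x, l != q -> c q l x = 0 /\ c l q x = 0) ->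
  (exists x, S q x) -> (exists l x, l != q /\ S l x) -> reducible T.
Proof.
move=> cq [x Sx] [l [y [lq Sy]]]; apply: (@reducible_subsystem (pred1 q)).
- move=> i j z /=; have [->|iq] := eqVneq i q.
    by have [->|jq] := eqVneq j q => // _; have [] := cq j z jq.
  by have [->|jq] := eqVneq j q => // _; have [] := cq i z iq.
- by exists q, x => /=.
- by exists l, y.
Qed.

Lemma reducible_continuous (q p m : I) (kp km : R) :
  q != p -> q != m -> p != m -> (forall l, [\/ l = q, l = p | l = m]) ->
  0 < km -> k p = kp%:C -> k m = km%:C ->
  S p = hol kp -> S m = anti km ->
  (exists x, S q x) -> (forall x, S q x <-> S q (x + 1)) ->
  (forall x, S q x -> x%:C - k q != 0 /\ x%:C + k q != 0) -> reducible T.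
Proof.
move=> qp qm pm all3 km0 kpE kmE Sp Sm Sq0 Sq kq.
apply: (@reducible_summand q) => //.
  exact: (continuous_decoupled csupp clow crai qp qm pm all3 km0 kpE kmE Sp Sm Sq kq).
by exists p, kp; rewrite eq_sym Sp; split => //; exists 0%N; rewrite addr0.
Qed.

Section Discrete.
Context (sg : I -> bool) (kr : I -> R) (p1 p2 m1 m2 : I).
Hypotheses (kr0 : forall i, 0 < kr i) (kE : forall i, k i = (kr i)%:C)
  (Shol : forall i, sg i -> S i = hol (kr i))
  (Santi : forall i, ~~ sg i -> S i = anti (kr i))
  (p12 : p1 != p2) (m12 : m1 != m2)
  (sp1 : sg p1) (sp2 : sg p2) (sm1 : ~~ sg m1) (sm2 : ~~ sg m2)
  (hol2 : forall l, sg l -> l = p1 \/ l = p2)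
  (anti2 : forall l, ~~ sg l -> l = m1 \/ l = m2)
  (nconst : forall i, kr i = 2^-1 -> forall x y, S i x -> S i y ->
     inner (b i x) (b i x) = inner (b i y) (b i y)).

Let Sne i : exists x, S i x.
Proof.
have [hi|hi] := boolP (sg i).
  by exists (kr i); rewrite Shol//; exists 0%N; rewrite addr0.
by exists (- kr i); rewrite Santi//; exists 0%N; rewrite subr0.
Qed.

Let pm l l' : sg l -> ~~ sg l' -> l != l'.
Proof. by move=> h h'; apply: contraNneq h' => <-. Qed.

Lemma reducible_no_cross : (forall i j x, sg i -> ~~ sg j -> c i j x = 0) ->
  reducible T.
Proof.
move=> cross; apply: (@reducible_subsystem sg).
- move=> i j x; have [hi|hi] := boolP (sg i); have [hj|hj] := boolP (sg j) => // _.
    exact: cross.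
  exact: (anti_hol0 csupp kr0 Shol Santi).
- by have [x] := Sne p1; exists p1, x.
- by have [x] := Sne m1; exists m1, x.
Qed.

Section Half.
Hypothesis (kr_half : forall i, kr i = 2^-1).

Let pr (s w : bool) := if s then (if w then p2 else p1) else (if w then m2 else m1).
Let x0 (s : bool) : R := if s then 2^-1 else - 2^-1.
Let Nn (s w : bool) : C := inner (b (pr s w) (x0 s)) (b (pr s w) (x0 s)).

Let sg_pr s w : sg (pr s w) = s.
Proof. by case: s w => -[] //=; apply/negbTE. Qed.

Let pr_inj s w s' w' : pr s w = pr s' w' -> s = s' /\ w = w'.
Proof.
move=> e; have ss : s = s' by rewrite -[LHS](sg_pr s w) e sg_pr.
split => //; move: e; rewrite -ss.
by case: s w w' {ss} => -[] [] //= e; exfalso; move: p12 m12; rewrite e eqxx.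
Qed.

Let S_x0 s w : S (pr s w) (x0 s).
Proof.
case: s => /=; [rewrite Shol|rewrite Santi]; rewrite ?(sg_pr true) ?(sg_pr false)//.
  by exists 0%N; rewrite kr_half addr0.
by exists 0%N; rewrite kr_half subr0.
Qed.

Let S_half s w x : S (pr s w) x -> S (pr s (~~ w)) x.
Proof.
case: s => /=; [rewrite !Shol|rewrite !Santi]; rewrite ?(sg_pr true) ?(sg_pr false) ?kr_half//;
  by case: w => //=; rewrite ?kr_half.
Qed.

Let N_pos s w : 0 < Nn s w.
Proof. by rewrite lt_def inner_ge0 inner_eq0 b_neq0//; exact: S_x0. Qed.

Let normE s w x : S (pr s w) x -> inner (b (pr s w) x) (b (pr s w) x) = Nn s w.
Proof. by move=> h; apply: nconst => //; exact: S_x0. Qed.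

Let prP i : exists s w, i = pr s w.
Proof.
have [/hol2[]->|/anti2[]->] := boolP (sg i).
- by exists true, false.
- by exists true, true.
- by exists false, false.
- by exists false, true.
Qed.

(** One pair of combinations of the two holomorphic vectors, and one of the two anti-holomorphic
    vectors, is used at all weights. It stays orthogonal because the norms do not depend on the
    weight, and within each kind [T] is the same shift on both vectors, so it respects any such
    pair. Only the crossing from -1/2 to 1/2 can mix, which the singular vectors prevent. *)
Lemma reducible_half : reducible T.
Proof.
pose a w' w := c (pr true w') (pr false w) (- 2^-1).
have [s1 [s2 [h1 [h2 [sn hn hs sh]]]]] := singular_vectors (a false false)
  (a false true) (a true false) (a true true) (N_pos true false) (N_pos true true)
  (N_pos false false) (N_pos false true).
(* [s] selects the kind, [f] the singular line or its complement for the weights [Nn], and [w] the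
   coordinate. *)
pose U (s f w : bool) : C :=
  let u1 := if s then h1 else s1 in let u2 := if s then h2 else s2 in
  if f then (if w then u2 else u1)
  else (if w then Nn s false * u1^* else - (Nn s true * u2^*)).
have U0 s : (U s true false != 0) || (U s true true != 0) by case: s.
have cj s w : (Nn s w)^* = Nn s w by rewrite conj_Creal// gtr0_real.
have Uorth s f : U s f false * (U s (~~ f) false)^* * Nn s false +
   U s f true * (U s (~~ f) true)^* * Nn s true = 0.
  by case: f; rewrite /U /= ?(rmorphN, rmorphM) /= ?cj ?conjCK; ring.
pose e (q : bool * bool * R) : H := let: (s, f, x) := q in
  U s f false *: b (pr s false) x + U s f true *: b (pr s true) x.
have tot_e v : (forall q, inner v (e q) = 0) -> v = 0.
  move=> hv; apply: tot => i x; have [s [w ->]] := prP i.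
  have := hv (s, true, x); have := hv (s, false, x).
  rewrite /e !innerDr !innerZr /U.
  set u1 := if s then h1 else s1; set u2 := if s then h2 else s2.
  set y1 := inner v (b (pr s false) x); set y2 := inner v (b (pr s true) x).
  rewrite !(rmorphN, rmorphM) /= !cj !conjCK => e1 e2.
  (* The determinant of the two coordinate equations; it is the weighted squared norm of (u1, u2),
     hence positive. *)
  pose det := Nn s false * (u1 * u1^*) + Nn s true * (u2 * u2^*).
  have det0 : det != 0.
    have := U0 s; rewrite /U -/u1 -/u2 => uz; apply: lt0r_neq0.
    have nn w' (z : C) : 0 <= Nn s w' * `|z| ^+ 2.
      by rewrite mulr_ge0 ?exprn_ge0// ltW.
    have np w' (z : C) : z != 0 -> 0 < Nn s w' * `|z| ^+ 2.
      by move=> z0; rewrite mulr_gt0// exprn_gt0// normr_gt0.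
    rewrite /det -!normCK.
    by case/orP: uz => z0; [rewrite ltr_pwDl// np|rewrite ltr_wpDl// np].
  case: w; rewrite -/y1 -/y2; apply: (mulfI det0); rewrite mulr0.
    have -> : det * y2 = Nn s true * u2 * (u1^* * y1 + u2^* * y2) +
       u1^* * (- (Nn s true * u2) * y1 + Nn s false * u1 * y2) by rewrite /det; ring.
    by rewrite e1 e2 !mulr0 addr0.
  have -> : det * y1 = Nn s false * u1 * (u1^* * y1 + u2^* * y2) -
     u2^* * (- (Nn s true * u2) * y1 + Nn s false * u1 * y2) by rewrite /det; ring.
  by rewrite e1 e2 !mulr0 subr0.
pose nn s w x := inner (b (pr s w) x) (b (pr s w) x).
have inner_pr s w s' w' x y : inner (b (pr s w) x) (b (pr s' w') y) =
    if [&& s == s', w == w' & x == y] then nn s w x else 0.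
  case: ifPn => [/and3P[/eqP <- /eqP <- /eqP <-]//|ne].
  apply: (ladder_orth lad orth) => -[/pr_inj[ss ww] xy].
  by rewrite ss ww xy !eqxx in ne.
have b_zero s w x : ~ S (pr s w) x -> b (pr s w) x = 0.
  move=> nS; apply/eqP/negPn/negP => bz; apply: nS.
  by have [h _ _ _] := lad (pr s w); apply/h.
have inner_e s f s' f' x y : (s, f, x) <> (s', f', y) ->
    inner (e (s, f, x)) (e (s', f', y)) = 0.
  move=> ne; rewrite /e !(innerDl, innerDr) !innerZl !innerZr !inner_pr /= !andbF.
  have [ss|ss] := eqVneq s s'; last by rewrite /= !mulr0 !addr0.
  have [xy|xy] := eqVneq x y; last by rewrite /= !mulr0 !addr0.
  subst s' y; rewrite !mulr0 /= add0r addr0.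
  have ff : f' = ~~ f.
    by case: f f' ne => -[] //= ne; case: ne.
  have [Sx|Sx] := pselect (S (pr s true) x).
    rewrite /nn !normE//; last exact: (@S_half s true).
    by rewrite ff !mulrA; exact: Uorth.
  rewrite /nn (b_zero s true x Sx) (b_zero s false x) ?inner0l ?mulr0 ?addr0//.
  by move=> h; apply: Sx; exact: (@S_half s false).
have inner_Te s f s' f' x y : f != f' ->
    inner (T (e (s, f, x))) (e (s', f', y)) = 0.
  move=> ff; have {ff} -> : f' = ~~ f by case: f f' ff => -[].
  have TD u v : T (u + v) = T u + T v.
    by have [Tl _] := boundedT; have := Tl 1 u v; rewrite !scale1r.
  have T0 : T 0 = 0 by apply: (addrI (T 0)); rewrite -TD !addr0.
  have TZ z u : T (z *: u) = z *: T u.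
    by have [Tl _] := boundedT; have := Tl z u 0; rewrite !addr0 T0 addr0.
  rewrite /e TD !TZ !(innerDl, innerDr) !innerZl !innerZr !inner_op.
  case: eqVneq => [->|_]; last by rewrite !mulr0 !addr0.
  have [Sy|Sy] := pselect (S (pr s' true) (x + 1)); last first.
    rewrite (b_zero s' true _ Sy) (b_zero s' false) ?inner0l ?mulr0 ?addr0//.
    by move=> h; apply: Sy; exact: (@S_half s' false).
  rewrite !normE//; last exact: (@S_half s' true).
  have [Sx|Sx] := pselect (S (pr s true) x); last first.
    have nS w : ~ S (pr s w) x.
      by case: w => // h; apply: Sx; exact: (@S_half s false).
    have cz i w : c i (pr s w) x = 0.
      by apply/eqP/negPn/negP => /csupp[/nS].
    by rewrite !cz !(mul0r, mulr0) !addr0.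
  have Sx' w : S (pr s w) x by case: w => //; exact: (@S_half s true).
  have Sy' w : S (pr s' w) (x + 1) by case: w => //; exact: (@S_half s' true).
  have [ss|ss] := eqVneq s s'.
    subst s'; have offd w : c (pr s w) (pr s (~~ w)) x = 0.
      have ne : pr s w != pr s (~~ w).
        by apply/eqP => /pr_inj[_]; case: w.
      case: (s) (sg_pr s) ne => sp ne.
        by apply: (hol_hol0 csupp clow kE Shol); rewrite ?sp// !kr_half.
      by apply: (anti_anti0 csupp clow kr0 kE Santi); rewrite ?sp// !kr_half.
    have diag w : c (pr s w) (pr s w) x = 1.
      case: (s) (sg_pr s) (Sx' w) (Sy' w) => sp Sxw Syw.
        by apply: (hol_diag clow kE Shol); rewrite ?sp.
      by apply: (anti_diag_half csupp clow kE Santi); rewrite ?sp.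
    have := offd true; have := offd false; rewrite /= => -> ->.
    rewrite !diag !mul0r !mulr0 !mul1r addr0 add0r.
    by rewrite !mulrA; exact: Uorth.
  case: s s' ss Sx Sx' Sy Sy' => -[] // _ Sx Sx' Sy Sy'.
    have cz w' w : c (pr false w') (pr true w) x = 0.
      by apply: (anti_hol0 csupp kr0 Shol Santi); rewrite sg_pr.
    by rewrite !cz !(mul0r, mulr0) !addr0.
  have [xE|xE] := eqVneq x (- 2^-1); last first.
    have cz w' w : c (pr true w') (pr false w) x = 0.
      apply/eqP/negPn/negP => /(cross_half csupp clow crai kr0 kE Shol Santi).
      by rewrite !sg_pr => /(_ isT isT)[h]; rewrite h eqxx in xE.
    by rewrite !cz !(mul0r, mulr0) !addr0.
  (* The crossing itself: for [f] true the image of the singular vector lies on the partner line,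
     for [f] false the image of the complement is orthogonal to that line. *)
  rewrite xE; case: (f); rewrite /U /= ?(rmorphN, rmorphM) /= ?cj ?conjCK.
    move: hs; rewrite /a => /eqP; rewrite -subr_eq0 => /eqP hs.
    rewrite -[RHS](mulr0 (Nn true false * Nn true true)) -hs; ring.
  by rewrite -[RHS]sh /a; ring.
apply: (@reducible_split _ _ (bool * bool * R)%type e (fun q => q.1.2)) => //.
- by move=> [[s f] x] [[s' f'] y]; exact: inner_e.
- by move=> [[s f] x] [[s' f'] y] /= hf hf'; apply: inner_Te; case: f' f hf hf' => -[].
- by move=> [[s f] x] [[s' f'] y] /= hf hf'; apply: inner_Te; case: f' f hf hf' => -[].
- exists (true, true, x0 true) => //; apply/eqP => ez.
  have : forall w, inner (e (true, true, x0 true)) (b (pr true w) (x0 true)) = 0.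
    by move=> w; rewrite ez inner0l.
  rewrite /e => hz; have := U0 true; apply/negP; rewrite negb_or !negbK.
  have := hz true; have := hz false; rewrite !innerDl !innerZl !inner_pr /= eqxx.
  rewrite !mulr0 addr0 add0r /nn !normE//.
  by move=> /eqP; rewrite mulf_eq0 (gt_eqF (N_pos _ _)) orbF => -> /eqP;
     rewrite mulf_eq0 (gt_eqF (N_pos _ _)) orbF => ->.
- exists (true, false, x0 true) => //; apply/eqP => ez.
  have : forall w, inner (e (true, false, x0 true)) (b (pr true w) (x0 true)) = 0.
    by move=> w; rewrite ez inner0l.
  rewrite /e => hz; have := U0 true; apply/negP; rewrite negb_or !negbK.
  have := hz true; have := hz false; rewrite !innerDl !innerZl !inner_pr /= eqxx.
  rewrite !mulr0 addr0 add0r /nn !normE//.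
  move=> /eqP; rewrite mulf_eq0 (gt_eqF (N_pos _ _)) orbF oppr_eq0 mulf_eq0
    (gt_eqF (N_pos _ _)) conjC_eq0 /= => -> /eqP.
  by rewrite mulf_eq0 (gt_eqF (N_pos _ _)) orbF mulf_eq0
    (gt_eqF (N_pos _ _)) conjC_eq0 /= => ->.
Qed.

End Half.

Lemma reducible_discrete : reducible T.
Proof.
have [[[i j] /= [hi hj] nz]|cross] := pselect (exists2 ij : I * I,
    sg ij.1 /\ ~~ sg ij.2 & c ij.1 ij.2 (- 2^-1) != 0); last first.
  apply: reducible_no_cross => i j x hi hj; apply/eqP/negPn/negP => nz.
  have [xE _ _] := cross_half csupp clow crai kr0 kE Shol Santi hi hj nz.
  by apply: cross; exists (i, j); rewrite //= -xE.
have [allh|] := pselect (forall l, kr l = 2^-1); first exact: reducible_half.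
move=> /existsNP[l /eqP kl].
have [_ ki kj] := cross_half csupp clow crai kr0 kE Shol Santi hi hj nz.
apply: (@reducible_summand l) => //; last first.
  have [x Sx] := Sne i; exists i, x; split => //.
  by apply: contraNneq kl => <-; rewrite ki.
have [hl|hl] := boolP (sg l).
  apply: (cross_hol_decoupled csupp clow crai kr0 kE Shol Santi hi hl hj _ _ nz kl).
    by apply: contraNneq kl => <-; rewrite ki.
  have il : i != l by apply: contraNneq kl => <-; rewrite ki.
  move=> l' hl'; have [-> //|l'i] := eqVneq l' i; [by left|right].
  case: (hol2 hi) (hol2 hl) (hol2 hl') il l'i => -> [->|->] [->|->] //;
    by rewrite eqxx.
apply: (cross_anti_decoupled csupp clow crai kr0 kE Shol Santi hi hj hl _ _ nz kl).
  by apply: contraNneq kl => <-; rewrite kj.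
have jl : j != l by apply: contraNneq kl => <-; rewrite kj.
move=> l' hl'; have [-> //|l'j] := eqVneq l' j; [by left|right].
case: (anti2 hj) (anti2 hl) (anti2 hl') jl l'j => -> [->|->] [->|->] //;
  by rewrite eqxx.
Qed.

End Discrete.
End Split.
End Reducibility.

(** * First order expansion of the multipliers *)

Section RealEstimates.
Context {R : realType}.
Implicit Types x y : R.

Lemma mvt_bound (f df : R -> R) x (B : R) :
  (forall c : R, `|c| <= `|x| -> is_derive c 1 f (df c)) ->
  (forall c : R, `|c| <= `|x| -> `|df c| <= B) -> `|f x - f 0| <= B * `|x|.
Proof.
move=> fd fB; have [->|x0] := eqVneq x 0.
  by rewrite subrr normr0 mulr0.
pose a := Num.min x 0; pose b := Num.max x 0.
have ab : a < b by rewrite /a /b; case: (ltgtP x 0) x0.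
have inab c : a <= c <= b -> `|c| <= `|x|.
  rewrite /a /b; case: (ltP x 0) => h /andP[h1 h2].
    by rewrite (ltr0_norm h) ler0_norm// lerN2.
  by rewrite (ger0_norm h) ger0_norm.
have [c cab fc] : exists2 c, c \in `]a, b[ & f b - f a = df c * (b - a).
  apply: MVT => //.
    by move=> c; rewrite in_itv /= => /andP[h1 h2]; apply/fd/inab; rewrite !ltW.
  apply: derivable_within_continuous => c; rewrite in_itv /= => h.
  by have [] := fd c (inab c h).
have -> : `|f x - f 0| = `|f b - f a|.
  by rewrite /a /b; case: (ltP x 0) => h //; rewrite distrC.
rewrite fc normrM; have -> : `|b - a| = `|x|.
  by rewrite /a /b; case: (ltP x 0) => h; rewrite ?sub0r ?normrN ?subr0.
rewrite ler_wpM2r// fB// inab//; move: cab; rewrite in_itv /= => /andP[? ?].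
by rewrite !ltW.
Qed.

Lemma sin_bound x : `|sin x| <= `|x|.
Proof.
have := @mvt_bound sin cos x 1; rewrite sin0 subr0 mul1r; apply => c _; exact: cos_max.
Qed.

Lemma cos_expansion x : `|cos x - 1| <= x ^+ 2.
Proof.
have := @mvt_bound cos (fun x => - sin x) x `|x|.
rewrite cos0 -normrM -expr2 ger0_norm ?sqr_ge0//; apply => c cx.
by rewrite normrN (le_trans (sin_bound c)).
Qed.

Lemma sqr_le x y : `|x| <= `|y| -> x ^+ 2 <= y ^+ 2.
Proof. by move=> h; rewrite -(real_normK (num_real x)) -(real_normK (num_real y)) ler_pXn2r ?nnegrE. Qed.

Lemma sin_expansion x : `|x| <= 1 -> `|sin x - x| <= x ^+ 2.
Proof.
move=> x1; have := @mvt_bound (fun x => sin x - x) (fun x => cos x - 1) x (x ^+ 2).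
rewrite sin0 !subr0 => h.
apply: le_trans (h _ _) _.
- by move=> c cx; rewrite (le_trans (cos_expansion c))// sqr_le.
- by rewrite ler_piMr// sqr_ge0.
Qed.

Lemma expR_expansion x : `|x| <= 2^-1 -> `|expR x - 1 - x| <= 2 * x ^+ 2.
Proof.
move=> x1; have h1 := expR_ge1Dx x; have h2 := expR_ge1Dx (- x).
have e0 := expR_gt0 x; have : expR x * expR (- x) = 1 by rewrite -expRD subrr expR0.
move: (expR x) (expR (- x)) h1 h2 e0 => u v h1 h2 e0 uv.
have /andP[xl xr] : - 2^-1 <= x <= 2^-1 by rewrite -ler_norml.
rewrite ger0_norm; last by lra.
have : u * (1 - x) <= u * v by rewrite ler_wpM2l// ltW.
rewrite uv => uv'.
nra.
Qed.

Lemma ln_expansion x : `|x| <= 2^-1 -> `|ln (1 + x) - x| <= 2 * x ^+ 2.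
Proof.
move=> x1; have /andP[xl xr] : - 2^-1 <= x <= 2^-1 by rewrite -ler_norml.
have h1 : ln (1 + x) <= x by apply: le_ln1Dx; lra.
have p : 0 < 1 + x by lra.
have h2 : - ln (1 + x) <= (1 + x)^-1 - 1.
  rewrite -lnV ?posrE// -[X in ln X](subrK 1) addrC; apply: le_ln1Dx.
  by rewrite ltrBrDl subrr invr_gt0.
rewrite ler0_norm; last by lra.
have h3 : (1 + x)^-1 * (1 + x) = 1 by rewrite mulVf// gt_eqF.
have : 0 < (1 + x)^-1 by rewrite invr_gt0.
move: ((1 + x)^-1) h2 h3 => w h2 h3 w0.
nra.
Qed.

Lemma asin0 : asin (0 : R) = 0.
Proof. by have := @sinK R 0; rewrite sin0; apply; rewrite in_itv /=; have := @pi_ge0 R; lra. Qed.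

Lemma asin_expansion x : `|x| <= 2^-1 -> `|asin x - x| <= x ^+ 2.
Proof.
move=> x1; have := @mvt_bound (fun x => asin x - x)
  (fun x => (Num.sqrt (1 - x ^+ 2))^-1 - 1) x (2 * x ^+ 2).
rewrite asin0 !subr0 => h; apply: le_trans (h _ _) _.
- move=> c cx; apply: is_deriveB; apply: is_derive1_asin.
  by have := le_trans cx x1; rewrite ler_norml => /andP[? ?]; lra.
- move=> c cx; have cx2 := sqr_le cx.
  have c4 : c ^+ 2 <= 4^-1.
    have : c ^+ 2 <= (2^-1) ^+ 2.
      by apply: sqr_le; rewrite (le_trans cx)// (le_trans x1)// ger0_norm.
    by rewrite exprVn -natrX.
  have c0 := sqr_ge0 c; set s := Num.sqrt _.
  have s2 : s ^+ 2 = 1 - c ^+ 2 by rewrite sqr_sqrtr//; lra.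
  have s0 : 0 < s by rewrite sqrtr_gt0; lra.
  have s1 : s <= 1 by nra.
  have si : 0 < s^-1 by rewrite invr_gt0.
  have ss : s * s^-1 = 1 by rewrite divff// gt_eqF.
  have si1 : 1 <= s^-1 by rewrite invf_ge1.
  rewrite ger0_norm; last by lra.
  move: (s^-1) si ss si1 => w; nra.
- by rewrite -mulrA; have := normr_ge0 x; have := sqr_ge0 x; nra.
Qed.

End RealEstimates.

(** * Second order estimates for the complex exponential and logarithm *)

Section ComplexEstimates.
Context {R : realType}.
Local Notation C := (R[i]).
Implicit Types (z w : C) (x y : R).

Lemma cnormE z : (cnorm z)%:C = `|z|. Proof. exact: Re_norm. Qed.
Lemma cnorm_ge0 z : 0 <= cnorm z.
Proof. by rewrite -ler0c cnormE. Qed.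
Lemma cnormD z w : cnorm (z + w) <= cnorm z + cnorm w.
Proof. by rewrite -lecR realCD !cnormE ler_normD. Qed.
Lemma cnormM z w : cnorm (z * w) = cnorm z * cnorm w.
Proof. by apply: (@complexI R); rewrite realCM !cnormE normrM. Qed.
Lemma cnormN z : cnorm (- z) = cnorm z. Proof. by rewrite /cnorm normrN. Qed.
Lemma cnormB z w : cnorm (z - w) <= cnorm z + cnorm w.
Proof. by rewrite (le_trans (cnormD _ _))// cnormN. Qed.
Lemma cnormX z n : cnorm (z ^+ n) = cnorm z ^+ n.
Proof. by apply: (@complexI R); rewrite rmorphXn/= !cnormE normrX. Qed.
Lemma cnorm_conj z : cnorm z^* = cnorm z. Proof. by rewrite /cnorm norm_conjC. Qed.
Lemma cnorm_real x : cnorm x%:C = `|x|.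
Proof. by rewrite /cnorm normc_def /= expr0n addr0 sqrtr_sqr. Qed.
Lemma cnorm1 : cnorm (1 : C) = 1. Proof. by rewrite /cnorm normr1. Qed.
Lemma cnorm0 : cnorm (0 : C) = 0. Proof. by rewrite /cnorm normr0. Qed.
Lemma cnormV z : cnorm z^-1 = (cnorm z)^-1.
Proof. by apply: (@complexI R); rewrite fmorphV/= !cnormE normfV. Qed.
Lemma cnorm_sqr z : cnorm z ^+ 2 = complex.Re z ^+ 2 + complex.Im z ^+ 2.
Proof. by rewrite /cnorm normc_def /= sqr_sqrtr// addr_ge0 ?sqr_ge0. Qed.
Lemma cnorm_eq0 z : (cnorm z == 0) = (z == 0).
Proof. by rewrite -(inj_eq (@complexI R)) cnormE normr_eq0. Qed.
Lemma cnorm_Re z : `|complex.Re z| <= cnorm z.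
Proof. by rewrite -lecR cnormE normc_ge_Re. Qed.
Lemma cnorm_Im z : `|complex.Im z| <= cnorm z.
Proof.
by rewrite -(ler_pXn2r (n := 2)) ?nnegrE ?cnorm_ge0// cnorm_sqr real_normK
  ?num_real// lerDr sqr_ge0.
Qed.
Lemma cnorm_le z : cnorm z <= `|complex.Re z| + `|complex.Im z|.
Proof.
rewrite -(ler_pXn2r (n := 2)) ?nnegrE ?cnorm_ge0 ?addr_ge0// cnorm_sqr sqrrD.
rewrite !real_normK ?num_real//.
have := mulr_ge0 (normr_ge0 (complex.Re z)) (normr_ge0 (complex.Im z)); lra.
Qed.

Lemma ReD z w : complex.Re (z + w) = complex.Re z + complex.Re w.
Proof. by case: z w => ? ? [? ?]. Qed.
Lemma ImD z w : complex.Im (z + w) = complex.Im z + complex.Im w.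
Proof. by case: z w => ? ? [? ?]. Qed.
Lemma ReN z : complex.Re (- z) = - complex.Re z. Proof. by case: z. Qed.
Lemma ImN z : complex.Im (- z) = - complex.Im z. Proof. by case: z. Qed.
Lemma ReM z w : complex.Re (z * w) =
  complex.Re z * complex.Re w - complex.Im z * complex.Im w.
Proof. by case: z w => ? ? [? ?]. Qed.
Lemma ImM z w : complex.Im (z * w) =
  complex.Re z * complex.Im w + complex.Im z * complex.Re w.
Proof. by case: z w => ? ? [? ?]. Qed.
Definition ReImE := (ReD, ImD, ReN, ImN, ReM, ImM).

Lemma cnorm_cexp z : cnorm (cexp z) = expR (complex.Re z).
Proof.
rewrite /cexp cnormM cnorm_real ger0_norm ?expR_ge0//.
by rewrite [cnorm (cis _)]/cnorm norm_cis mulr1.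
Qed.

Lemma cexp_expansion (M : R) : exists2 K : R, 0 <= K & forall w, cnorm w <= M ->
  cnorm (cexp w - 1 - w) <= K * cnorm w ^+ 2.
Proof.
have M0 := normr_ge0 M; have eM := expR_ge0 `|M|.
(* The 8 serves |w| <= 1/2, where the real expansions apply; for larger |w| the trivial bound is
   multiplied by 4 |w|^2 >= 1. *)
exists (8 + 4 * (expR `|M| + 1 + `|M|)); first by lra.
move=> w wM; have w0 := cnorm_ge0 w; have w20 := sqr_ge0 (cnorm w).
have [w1|w1] := leP (cnorm w) 2^-1; last first.
  have h1 : cnorm (cexp w) <= expR `|M|.
    rewrite cnorm_cexp ler_expR (le_trans (ler_norm _))//.
    by rewrite (le_trans (cnorm_Re _))// (le_trans wM)// ler_norm.
  have h2 := cnormB (cexp w - 1) w; have h3 := cnormB (cexp w) 1.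
  rewrite cnorm1 in h3.
  have h4 : cnorm w <= `|M| by rewrite (le_trans wM)// ler_norm.
  have h5 : 1 <= 4 * cnorm w ^+ 2 by nra.
  apply: (@le_trans _ _ (expR `|M| + 1 + `|M|)); first by lra.
  apply: (@le_trans _ _ ((expR `|M| + 1 + `|M|) * (4 * cnorm w ^+ 2))).
    by rewrite ler_peMr//; lra.
  nra.
have xn := cnorm_Re w; have yn := cnorm_Im w; have w2 := cnorm_sqr w.
set x := complex.Re w in xn w2 *; set y := complex.Im w in yn w2 *.
have := expR_expansion (le_trans xn w1).
have := cos_expansion y.
have : `|sin y - y| <= y ^+ 2 by apply: sin_expansion; lra.
have e0 := expR_gt0 x.
have := cnorm_le (cexp w - 1 - w).
have -> : complex.Re (cexp w - 1 - w) = (expR x - 1 - x) + expR x * (cos y - 1).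
  by rewrite !ReImE /= mul0r subr0 /x /y; ring.
have -> : complex.Im (cexp w - 1 - w) = expR x * (sin y - y) +
    (expR x - 1 - x) * y + x * y.
  by rewrite !ReImE /= mul0r subr0 /x /y; ring.
move: (expR x) e0 (cos y) (sin y) => e e0 c s n1 h1 h2 h3.
have e2 : e <= 2.
  move: h3 xn w1; rewrite !ler_norml => /andP[? ?] /andP[? ?] ?.
  have : x ^+ 2 <= 4^-1 by nra.
  lra.
have t1 := ler_normD (e - 1 - x) (e * (c - 1)).
have t2 := ler_normD (e * (s - y) + (e - 1 - x) * y) (x * y).
have t3 := ler_normD (e * (s - y)) ((e - 1 - x) * y).
rewrite !normrM (gtr0_norm e0) in t1 t2 t3.
have x0 := normr_ge0 x; have y0 := normr_ge0 y.
have x2 : `|x| ^+ 2 = x ^+ 2 by rewrite real_normK// num_real.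
have y2 : `|y| ^+ 2 = y ^+ 2 by rewrite real_normK// num_real.
have u1 : e * `|c - 1| <= 2 * y ^+ 2 by apply: ler_pM => //; exact: ltW.
have u2 : e * `|s - y| <= 2 * y ^+ 2 by apply: ler_pM => //; exact: ltW.
have u3 : `|e - 1 - x| * `|y| <= 2 * x ^+ 2 * 2^-1.
  by apply: ler_pM => //; lra.
have u4 : `|x| * `|y| <= x ^+ 2 + y ^+ 2 by rewrite -x2 -y2; nra.
have u5 : 0 <= (expR `|M| + 1 + `|M|) * cnorm w ^+ 2.
  by apply: mulr_ge0 => //; lra.
have x20 := sqr_ge0 x; have y20 := sqr_ge0 y.
have -> : (8 + 4 * (expR `|M| + 1 + `|M|)) * cnorm w ^+ 2 =
   8 * (x ^+ 2 + y ^+ 2) + 4 * ((expR `|M| + 1 + `|M|) * cnorm w ^+ 2).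
  by rewrite -w2; ring.
lra.
Qed.

(** Near the positive reals the defining formula uses [acos] at 1, where it is not differentiable;
    [asin] can be expanded at 0. *)
Lemma carg_asin z : 0 < complex.Re z -> carg z = asin (complex.Im z / cnorm z).
Proof.
move=> z0; have n0 : 0 < cnorm z.
  by rewrite (lt_le_trans _ (cnorm_Re z))// normr_gt0 gt_eqF.
have n2 := cnorm_sqr z.
set y := complex.Im z / cnorm z; set x := complex.Re z / cnorm z.
have x0 : 0 < x by rewrite divr_gt0.
have xy : x ^+ 2 + y ^+ 2 = 1.
  by rewrite !expr_div_n -mulrDl -n2 divff// expf_neq0// gt_eqF.
have y1 : -1 <= y <= 1 by nra.
have [ylo yhi] : - (pi / 2) <= asin y <= pi / 2 /\ sin (asin y) = y by exact: asin_def.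
have cx : cos (asin y) = x.
  rewrite cos_asin// -xy addrK sqrtr_sqr gtr0_norm//.
have p0 := @pi_gt0 R.
rewrite /carg -/x -cx; have [i0|i0] := leP 0 (complex.Im z).
  rewrite cosK// in_itv /=; apply/andP; split; last by lra.
  rewrite leNgt; apply/negP => h.
  have : 0 <= sin (- asin y) by apply: sin_ge0_pi; lra.
  rewrite sinN yhi oppr_ge0 => y0.
  have yz : y = 0 by apply/eqP; rewrite eq_le y0 divr_ge0// ltW.
  by move: h; rewrite yz asin0 ltxx.
have ylt0 : y < 0 by rewrite /y pmulr_llt0// invr_gt0.
rewrite cosKN ?opprK//; apply/andP; split; first by lra.
rewrite leNgt; apply/negP => h.
have : 0 <= sin (asin y) by apply: sin_ge0_pi; lra.
by rewrite yhi leNgt ylt0.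
Qed.

(** With r = |1 - w|, the real part is half the logarithm of r^2 = 1 - 2 Re w + |w|^2 and the
    imaginary part is asin (- Im w / r). The bound 1/8 keeps r at least 7/8 and |r^2 - 1| below 1/2,
    within reach of the real expansions. *)
Lemma clog_expansion w : cnorm w <= 8^-1 ->
  cnorm (clog (1 - w) + w) <= 20 * cnorm w ^+ 2.
Proof.
move=> w8; have n0 := cnorm_ge0 w.
have pn := cnorm_Re w; have qn := cnorm_Im w; have n2 := cnorm_sqr w.
have rr := cnorm_sqr (1 - w); rewrite !ReImE /= sub0r sqrrN in rr.
have r1 : cnorm (1 - w) <= 1 + cnorm w by rewrite (le_trans (cnormB _ _))// cnorm1.
have r2 : 1 <= cnorm (1 - w) + cnorm w.
  by rewrite -{1}cnorm1 -{1}(subrK w 1) cnormD.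
have re0 : 0 < complex.Re (1 - w).
  by rewrite !ReImE /=; move: pn; rewrite ler_norml; lra.
apply: le_trans (cnorm_le _) _; rewrite !ReImE /= carg_asin// !ReImE /= sub0r.
move: (cnorm (1 - w)) rr r1 r2 => r rr r1 r2.
set p := complex.Re w in pn n2 rr re0 *; set q := complex.Im w in qn n2 rr *.
set n := cnorm w in n0 w8 pn qn n2 r1 r2 *.
have rge : 7 / 8 <= r by lra.
have r0 : 0 < r by lra.
have h1 : `|ln r + p| <= 6 * n ^+ 2.
  have E : 1 + (r ^+ 2 - 1) = r ^+ 2 by rewrite addrC subrK.
  have xE : r ^+ 2 - 1 = - 2 * p + n ^+ 2 by rewrite rr n2; ring.
  have [pl pr] : - n <= p /\ p <= n by move: pn; rewrite ler_norml => /andP.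
  have xb : `|r ^+ 2 - 1| <= (17 / 8) * n by rewrite xE ler_norml; apply/andP; split; nra.
  have xh : `|r ^+ 2 - 1| <= 2^-1 by apply: le_trans xb _; lra.
  have h := ln_expansion xh; rewrite E lnXn// mulr2n in h.
  have x2 : (r ^+ 2 - 1) ^+ 2 <= 5 * n ^+ 2.
    have := @sqr_le R (r ^+ 2 - 1) ((17 / 8) * n).
    rewrite [`|17 / 8 * n|]ger0_norm; last by lra.
    by move=> /(_ xb); nra.
  move: h; rewrite !ler_norml => /andP[ha hb]; apply/andP; split; lra.
have h2 : `|asin (- q / r) + q| <= 4 * n ^+ 2.
  have ri : r^-1 <= 8 / 7 by rewrite -[8 / 7]invrK lef_pV2 ?posrE ?invr_gt0//; lra.
  have ri0 : 0 < r^-1 by rewrite invr_gt0.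
  have rri : r * r^-1 = 1 by rewrite divff// gt_eqF.
  have yb : `|- q / r| <= 8 / 7 * n.
    rewrite normrM normrN (gtr0_norm ri0) mulrC; apply: ler_pM => //; exact: ltW.
  have y2 : `|asin (- q / r) - (- q / r)| <= (- q / r) ^+ 2.
    by apply: asin_expansion; lra.
  have y3 : (- q / r) ^+ 2 <= 2 * n ^+ 2.
    have := @sqr_le R (- q / r) (8 / 7 * n).
    rewrite [`|8 / 7 * n|]ger0_norm; last by lra.
    by move=> /(_ yb); nra.
  have y4 : `|- q / r + q| <= 8 / 7 * n ^+ 2.
    have -> : - q / r + q = q * ((r - 1) * r^-1).
      by rewrite mulrBl rri; ring.
    rewrite !normrM (gtr0_norm ri0).
    have a1 : `|r - 1| <= n by rewrite ler_norml; lra.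
    have a2 : `|r - 1| * r^-1 <= n * (8 / 7) by apply: ler_pM => //; exact: ltW.
    have := ler_pM (normr_ge0 q) (mulr_ge0 (normr_ge0 (r - 1)) (ltW ri0)) qn a2.
    by rewrite expr2; lra.
  have := ler_normD (asin (- q / r) - (- q / r)) (- q / r + q).
  have -> : asin (- q / r) - - q / r + (- q / r + q) = asin (- q / r) + q by ring.
  have := sqr_ge0 n; lra.
have := sqr_ge0 n; lra.
Qed.

End ComplexEstimates.

(** * Expansions in the boost parameter, uniform on the disc *)

Section Expansions.
Context {R : realType}.
Local Notation C := (R[i]).
Implicit Types (W : mob R -> C -> C) (z : C).

(** Uniformity in [z] allows integration over circles. The same [K] also bounds both coefficients,
    which makes the notion stable under products. *)
Definition expands W (G0 G1 : C -> C) : Prop := exists2 K : R, 0 <= K &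
  forall g r z, mob_pair g = (1, r%:C) -> 0 < r < 8^-1 -> cnorm z <= 1 ->
    [/\ cnorm (G0 z) <= K, cnorm (G1 z) <= K
      & cnorm (W g z - G0 z - r%:C * G1 z) <= K * r ^+ 2].

Lemma expands_ext W W' G0 G1 H0 H1 : expands W G0 G1 ->
  (forall g r z, mob_pair g = (1, r%:C) -> 0 < r < 8^-1 -> cnorm z <= 1 ->
     W' g z = W g z) ->
  G0 =1 H0 -> G1 =1 H1 -> expands W' H0 H1.
Proof.
move=> [K K0 h] e e0 e1; exists K => // g r z gE r8 z1.
by rewrite (e _ r) // -e0 -e1; exact: h.
Qed.

Lemma expandsM W W' G0 G1 H0 H1 : expands W G0 G1 -> expands W' H0 H1 ->
  expands (fun g z => W g z * W' g z) (fun z => G0 z * H0 z)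
    (fun z => G0 z * H1 z + G1 z * H0 z).
Proof.
move=> [K K0 h] [L L0 h']; exists (8 * (K * L)) => [|g r z gE r8 z1].
  by rewrite mulr_ge0// mulr_ge0.
have [a1 a2 a3] := h g r z gE r8 z1; have [b1 b2 b3] := h' g r z gE r8 z1.
have KL := mulr_ge0 K0 L0.
have /andP[r0 r1] := r8.
have p (x y : C) (A B : R) : cnorm x <= A -> cnorm y <= B -> cnorm (x * y) <= A * B.
  by move=> xA yB; rewrite cnormM ler_pM ?cnorm_ge0.
have r2 : 0 <= r ^+ 2 by exact: sqr_ge0.
have rn : cnorm r%:C = r by rewrite cnorm_real gtr0_norm.
split.
- by rewrite (le_trans (p _ _ _ _ a1 b1))//; lra.
- rewrite (le_trans (cnormD _ _))// (le_trans (lerD (p _ _ _ _ a1 b2) (p _ _ _ _ a2 b1)))//; lra.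
set x := W g z; set y := W' g z.
set x0 := G0 z; set x1 := G1 z; set y0 := H0 z; set y1 := H1 z.
set dx := x - x0 - r%:C * x1; set dy := y - y0 - r%:C * y1.
have -> : x * y - x0 * y0 - r%:C * (x0 * y1 + x1 * y0) =
   dx * y + (x0 * dy + r%:C * (x1 * (dy + r%:C * y1))).
  by rewrite /dx /dy; ring.
have r12 : r ^+ 2 <= 1 by rewrite expr_le1//; lra.
have yb : cnorm y <= 3 * L.
  have -> : y = dy + (y0 + r%:C * y1) by rewrite /dy; ring.
  rewrite (le_trans (cnormD _ _))//.
  have := cnormD y0 (r%:C * y1); rewrite cnormM rn => h1.
  have : r * cnorm y1 <= 1 * L by apply: ler_pM => //; [exact: ltW|exact: cnorm_ge0|lra].
  have : L * r ^+ 2 <= L * 1 by rewrite ler_wpM2l.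
  by move: b1 b3 h1; rewrite -/y0 -/dy; lra.
have db : cnorm (dy + r%:C * y1) <= 2 * L * r.
  rewrite (le_trans (cnormD _ _))// cnormM rn.
  have : L * r ^+ 2 <= L * r by rewrite ler_wpM2l// expr2 ler_piMr//; lra.
  have : r * cnorm y1 <= r * L by rewrite ler_wpM2l// ltW.
  by move: b3; rewrite -/dy; lra.
rewrite (le_trans (cnormD _ _))//.
have t1 := p _ _ _ _ a3 yb; have t2 := p _ _ _ _ a1 b3; have t3 := p _ _ _ _ a2 db.
have t4 := cnormD (x0 * dy) (r%:C * (x1 * (dy + r%:C * y1))).
rewrite [cnorm (r%:C * _)]cnormM rn in t4.
have t5 : r * cnorm (x1 * (dy + r%:C * y1)) <= r * (K * (2 * L * r)).
  by rewrite ler_wpM2l// ltW.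
have -> : 8 * (K * L) * r ^+ 2 = K * r ^+ 2 * (3 * L) +
  (K * (L * r ^+ 2) + r * (K * (2 * L * r))) + 2 * (K * L * r ^+ 2) by ring.
have := mulr_ge0 KL r2; move: t1 t2; rewrite -/dx -/dy -/x0; lra.
Qed.

Lemma expands_cst (c : C) : expands (fun _ _ => c) (fun=> c) (fun=> 0).
Proof.
exists (cnorm c) => [|g r z _ _ _]; first exact: cnorm_ge0.
split=> //; first by rewrite cnorm0 cnorm_ge0.
by rewrite mulr0 subr0 subrr cnorm0 mulr_ge0 ?cnorm_ge0 ?sqr_ge0.
Qed.

Lemma expandsX W G0 G1 n : expands W G0 G1 ->
  expands (fun g z => W g z ^+ n) (fun z => G0 z ^+ n)
    (fun z => n%:R * G0 z ^+ n.-1 * G1 z).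
Proof.
move=> h; elim: n => [|n IH].
  by apply: (expands_ext (expands_cst 1)) => [g r z|z|z]; rewrite ?expr0// !mul0r.
apply: (expands_ext (expandsM h IH)) => [g r z _ _ _|z|z]; rewrite ?exprS//=.
by case: n {IH} => [|n] /=; rewrite -?natr1 ?exprS; ring.
Qed.

Lemma expands_conj W G0 G1 : expands W G0 G1 ->
  expands (fun g z => (W g z)^*) (fun z => (G0 z)^*) (fun z => (G1 z)^*).
Proof.
move=> [K K0 h]; exists K => // g r z gE r8 z1.
have [a1 a2 a3] := h g r z gE r8 z1; rewrite !cnorm_conj; split => //.
have -> : (W g z)^* - (G0 z)^* - r%:C * (G1 z)^* = (W g z - G0 z - r%:C * G1 z)^*.
  rewrite !rmorphB rmorphM; congr (_ - _ * _).
  by apply/esym/conj_Creal/complex_realP; exists r.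
by rewrite cnorm_conj.
Qed.

Lemma expands_flip W G0 G1 : expands W G0 G1 ->
  expands (fun g z => W g z^*) (fun z => G0 z^*) (fun z => G1 z^*).
Proof.
move=> [K K0 h]; exists K => // g r z gE r8 z1.
by apply: h => //; rewrite cnorm_conj.
Qed.

Lemma expands_Re W G0 G1 : expands W G0 G1 ->
  expands (fun g z => (complex.Re (W g z))%:C) (fun z => (complex.Re (G0 z))%:C)
    (fun z => (complex.Re (G1 z))%:C).
Proof.
move=> [K K0 h]; exists K => // g r z gE r8 z1.
have [a1 a2 a3] := h g r z gE r8 z1; rewrite !cnorm_real; split => //.
- exact: le_trans (cnorm_Re _) a1.
- exact: le_trans (cnorm_Re _) a2.
apply: le_trans a3; apply: le_trans (cnorm_Re _).
rewrite -realCM -!rmorphB/= cnorm_real !ReImE /= mul0r subr0 //.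
Qed.

Lemma expands_cexp W G1 : expands W (fun=> 0) G1 ->
  expands (fun g z => cexp (W g z)) (fun=> 1) G1.
Proof.
move=> [K K0 h]; have [L L0 hL] := cexp_expansion (2 * K).
have KK := mulr_ge0 K0 K0; have LKK := mulr_ge0 L0 KK.
exists (1 + K + L * (4 * (K * K))) => [|g r z gE r8 z1]; first by lra.
have [_ a2 a3] := h g r z gE r8 z1; have /andP[r0 r1] := r8.
rewrite subr0 in a3; have rn : cnorm r%:C = r by rewrite cnorm_real gtr0_norm.
have r2 := sqr_ge0 r.
split; [by rewrite cnorm1; lra|by lra|].
have gb : cnorm (W g z) <= 2 * K * r.
  rewrite -(subrK (r%:C * G1 z) (W g z)) (le_trans (cnormD _ _))// cnormM rn.
  have : K * r ^+ 2 <= K * r by rewrite ler_wpM2l// expr2 ler_piMr//; lra.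
  have : r * cnorm (G1 z) <= r * K by rewrite ler_wpM2l// ltW.
  lra.
have gb2 : cnorm (W g z) <= 2 * K.
  by rewrite (le_trans gb)// ler_piMr//; lra.
have h1 := hL _ gb2.
have -> : cexp (W g z) - 1 - r%:C * G1 z =
   (cexp (W g z) - 1 - W g z) + (W g z - r%:C * G1 z) by ring.
rewrite (le_trans (cnormD _ _))//.
have h2 : cnorm (W g z) ^+ 2 <= 4 * (K * K) * r ^+ 2.
  have -> : 4 * (K * K) * r ^+ 2 = (2 * K * r) ^+ 2 by ring.
  rewrite ler_pXn2r ?nnegrE ?cnorm_ge0//.
  by apply: mulr_ge0; [lra|exact: ltW].
have h3 : L * cnorm (W g z) ^+ 2 <= L * (4 * (K * K) * r ^+ 2) by rewrite ler_wpM2l.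
have -> : (1 + K + L * (4 * (K * K))) * r ^+ 2 =
   r ^+ 2 + K * r ^+ 2 + L * (4 * (K * K) * r ^+ 2) by ring.
lra.
Qed.

Lemma expandsZ (c : C) W G0 G1 : expands W G0 G1 ->
  expands (fun g z => c * W g z) (fun z => c * G0 z) (fun z => c * G1 z).
Proof.
move=> h; apply: (expands_ext (expandsM (expands_cst c) h)) => // z.
by rewrite mul0r addr0.
Qed.

(** The remainder is exactly r^2 z (z^2 - 1) / (1 - r z), and r < 1/8 keeps the denominator away
    from 0. *)
Lemma expands_mob_fun : expands (@mob_fun R) id (fun z => z ^+ 2 - 1).
Proof.
exists 4 => // g r z gE /andP[r0 r1] z1.
have rc : (mob_pt g)^* = r%:C.
  by rewrite /mob_pt gE /=; apply/conj_Creal/complex_realP; exists r.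
have rn : cnorm r%:C = r by rewrite cnorm_real gtr0_norm.
have z0 := cnorm_ge0 z.
have zz : cnorm (z ^+ 2 - 1) <= 2.
  rewrite (le_trans (cnormB _ _))// cnorm1 cnormX.
  have : cnorm z ^+ 2 <= 1 by rewrite expr_le1.
  lra.
split; [by rewrite (le_trans z1)//; lra|by rewrite (le_trans zz)//; lra|].
rewrite /mob_fun rc /mob_rot /mob_pt gE /= mul1r.
have rz : cnorm (r%:C * z) <= 8^-1.
  by rewrite cnormM rn; nra.
have d1 : 2^-1 <= cnorm (1 - r%:C * z).
  have := cnormD (1 - r%:C * z) (r%:C * z); rewrite subrK cnorm1; lra.
have dn : 1 - r%:C * z != 0 by rewrite -cnorm_eq0 gt_eqF// (lt_le_trans _ d1)// invr_gt0.
have -> : (z - r%:C) / (1 - r%:C * z) - z - r%:C * (z ^+ 2 - 1) =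
    r%:C ^+ 2 * (z * (z ^+ 2 - 1)) / (1 - r%:C * z) by field.
rewrite cnormM cnormV (cnormM (r%:C ^+ 2)) (cnormM z) cnormX rn.
have di : (cnorm (1 - r%:C * z))^-1 <= 2.
  by rewrite -[2]invrK lef_pV2 ?posrE ?invr_gt0//; lra.
have di0 : 0 <= (cnorm (1 - r%:C * z))^-1 by rewrite invr_ge0 cnorm_ge0.
have a1 : cnorm z * cnorm (z ^+ 2 - 1) <= 1 * 2 by apply: ler_pM; rewrite ?cnorm_ge0.
have a2 : r ^+ 2 * (cnorm z * cnorm (z ^+ 2 - 1)) <= r ^+ 2 * (1 * 2).
  by rewrite ler_wpM2l// sqr_ge0.
have a3 := ler_pM (mulr_ge0 (sqr_ge0 r) (mulr_ge0 z0 (cnorm_ge0 _))) di0 a2 di.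
by rewrite (le_trans a3)//; lra.
Qed.

Lemma carg1 : carg (1 : C) = 0.
Proof. by rewrite carg_asin /= ?ltr01// mul0r asin0. Qed.

Lemma log_mob_derivE (g : mob R) (r : R) z : mob_pair g = (1, r%:C) -> 0 < r ->
  log_mob_deriv g z = (ln (1 - r ^+ 2))%:C - 2 * clog (1 - r%:C * z).
Proof.
move=> gE r0; have rc : (mob_pt g)^* = r%:C.
  by rewrite /mob_pt gE /=; apply/conj_Creal/complex_realP; exists r.
rewrite /log_mob_deriv rc /mob_rot /mob_pt gE /= carg1.
by rewrite cnorm_real gtr0_norm.
Qed.

Lemma expands_log_mob_deriv : expands (@log_mob_deriv R) (fun=> 0) (fun z => 2 * z).
Proof.
exists 50 => // g r z gE /andP[r0 r1] z1.
have rc : (mob_pt g)^* = r%:C.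
  by rewrite /mob_pt gE /=; apply/conj_Creal/complex_realP; exists r.
have rn : cnorm r%:C = r by rewrite cnorm_real gtr0_norm.
have z0 := cnorm_ge0 z; have r2 := sqr_ge0 r.
have c2 : cnorm (2 : C) = 2 by rewrite /cnorm normr_nat -(rmorph_nat (real_complex R)).
split; [by rewrite cnorm0|by rewrite cnormM c2; lra|].
rewrite (log_mob_derivE _ gE r0).
have rz : cnorm (r%:C * z) <= r by rewrite cnormM rn; nra.
have L := @clog_expansion R (r%:C * z).
have {}L : cnorm (clog (1 - r%:C * z) + r%:C * z) <= 20 * r ^+ 2.
  apply: le_trans (L _) _; first by lra.
  rewrite ler_wpM2l// ler_pXn2r ?nnegrE ?cnorm_ge0//; exact: ltW.
have l2 : `|ln (1 - r ^+ 2)| <= 3 * r ^+ 2.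
  have r24 : r ^+ 2 <= 4^-1 by nra.
  have rh : `|- r ^+ 2| <= 2^-1 by rewrite normrN ger0_norm//; lra.
  have h := ln_expansion rh.
  have := ler_normD (ln (1 - r ^+ 2) - - r ^+ 2) (- r ^+ 2).
  rewrite subrK normrN (ger0_norm r2) sqrrN in h *.
  have : (r ^+ 2) ^+ 2 <= 4^-1 * r ^+ 2 by rewrite expr2 ler_wpM2r.
  lra.
have -> : (ln (1 - r ^+ 2))%:C - 2 * clog (1 - r%:C * z) - 0 - r%:C * (2 * z) =
   (ln (1 - r ^+ 2))%:C - 2 * (clog (1 - r%:C * z) + r%:C * z) by ring.
rewrite (le_trans (cnormB _ _))// cnorm_real cnormM c2; lra.
Qed.

Lemma expands_mob_deriv_pow (lam : R) :
  expands (fun g z => mob_deriv_pow g lam z) (fun=> 1) (fun z => lam%:C * z).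
Proof.
apply: expands_cexp.
apply: (expands_ext (expandsZ (lam / 2)%:C expands_log_mob_deriv)) => // z.
  by rewrite mulr0.
by rewrite realCM fmorphV rmorph_nat; field.
Qed.

(** Identifies |phi'|^mu with exp (mu Re log phi'), so that one expansion of log phi' serves both
    factors of the multiplier. *)
Lemma ln_cnorm_mob_deriv (g : mob R) (r : R) z : mob_pair g = (1, r%:C) ->
  0 < r < 8^-1 -> cnorm z <= 1 ->
  ln (cnorm (mob_deriv g z)) = complex.Re (log_mob_deriv g z).
Proof.
move=> gE /andP[r0 r1] z1.
have rc : (mob_pt g)^* = r%:C.
  by rewrite /mob_pt gE /=; apply/conj_Creal/complex_realP; exists r.
have rn : cnorm r%:C = r by rewrite cnorm_real gtr0_norm.
have z0 := cnorm_ge0 z.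
have rz : cnorm (r%:C * z) <= 8^-1.
  by rewrite cnormM rn; nra.
have d1 : 2^-1 <= cnorm (1 - r%:C * z).
  have := cnormD (1 - r%:C * z) (r%:C * z); rewrite subrK cnorm1; lra.
rewrite (log_mob_derivE _ gE r0) /mob_deriv rc /mob_rot /mob_pt gE /= mul1r.
have -> : 1 - `|r%:C| ^+ 2 = (1 - r ^+ 2)%:C by rewrite -cnormE rn rmorphB rmorphXn.
rewrite cnormM cnormV cnormX.
have r21 : 0 < 1 - r ^+ 2 by nra.
have dp : 0 < cnorm (1 - r%:C * z) by lra.
rewrite cnorm_real gtr0_norm// lnM ?posrE ?invr_gt0 ?exprn_gt0//.
rewrite lnV ?posrE ?exprn_gt0// lnXn//.
by rewrite [RHS]/= addr0 mul0r subr0 mulr2n mulrDl !mul1r.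
Qed.

Lemma expands_mob_deriv_norm_pow (mu : C) :
  expands (fun g z => mob_deriv_norm_pow g mu z) (fun=> 1) (fun z => mu * (z + z^*)).
Proof.
apply: expands_cexp.
apply: (expands_ext (expandsZ mu (expands_Re expands_log_mob_deriv))).
- by move=> g r z gE r8 z1; rewrite (ln_cnorm_mob_deriv gE r8 z1).
- by move=> z; rewrite mulr0.
move=> z; congr (_ * _); case: z => a b.
by apply/eqP; rewrite eq_complex !ReImE /=; apply/andP; split; apply/eqP; ring.
Qed.

End Expansions.

(** * Fourier coefficients *)

Section ComplexContinuity.
Context {R : realType}.
Local Notation C := (R[i]).
Implicit Types (u v : R -> C) (f g : R -> R).

(** Real and imaginary parts are kept apart because [cint] and the Fourier coefficients integrate
    them separately. *)
Definition ccont u : Prop :=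
  continuous (fun t => complex.Re (u t)) /\ continuous (fun t => complex.Im (u t)).

Lemma cfunD f g : continuous f -> continuous g -> continuous (fun t => f t + g t).
Proof. by move=> hf hg t; apply: continuousD; [exact: hf|exact: hg]. Qed.
Lemma cfunM f g : continuous f -> continuous g -> continuous (fun t => f t * g t).
Proof. by move=> hf hg t; apply: continuousM; [exact: hf|exact: hg]. Qed.
Lemma cfunN f : continuous f -> continuous (fun t => - f t).
Proof. by move=> hf t; apply: continuousN; exact: hf. Qed.
Lemma cfun_cst (a : R) : continuous (fun _ : R => a).
Proof. by move=> t; exact: cvg_cst. Qed.
Lemma cfun_comp (h : R -> R) f : (forall t, {for f t, continuous h}) ->
  continuous f -> continuous (fun t => h (f t)).
Proof. by move=> hh hf t; apply: continuous_comp; [exact: hf|exact: hh]. Qed.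
Lemma cfunV f : (forall t, f t != 0) -> continuous f -> continuous (fun t => (f t)^-1).
Proof. by move=> f0 hf t; apply: continuousV => //; exact: hf. Qed.

Lemma ccont_ext u v : u =1 v -> ccont u -> ccont v.
Proof. by move=> /funext ->. Qed.
Lemma ccont_cst (c : C) : ccont (fun=> c).
Proof. by split; exact: cfun_cst. Qed.
Lemma ccont_real f : continuous f -> ccont (fun t => (f t)%:C).
Proof. by split => //=; exact: cfun_cst. Qed.
Lemma ccontD u v : ccont u -> ccont v -> ccont (fun t => u t + v t).
Proof.
move=> [u1 u2] [v1 v2]; split.
  by under eq_fun do rewrite ReD; exact: cfunD.
by under eq_fun do rewrite ImD; exact: cfunD.
Qed.
Lemma ccontM u v : ccont u -> ccont v -> ccont (fun t => u t * v t).
Proof.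
move=> [u1 u2] [v1 v2]; split.
  by under eq_fun do rewrite ReM; apply: cfunD; [|apply: cfunN]; exact: cfunM.
by under eq_fun do rewrite ImM; apply: cfunD; exact: cfunM.
Qed.
Lemma ccontN u : ccont u -> ccont (fun t => - u t).
Proof.
move=> [u1 u2]; split.
  by under eq_fun do rewrite ReN; exact: cfunN.
by under eq_fun do rewrite ImN; exact: cfunN.
Qed.
Lemma ccontB u v : ccont u -> ccont v -> ccont (fun t => u t - v t).
Proof. by move=> hu hv; apply: ccontD => //; exact: ccontN. Qed.
Lemma ccontX u n : ccont u -> ccont (fun t => u t ^+ n).
Proof.
move=> hu; elim: n => [|n IH].
  by apply: (ccont_ext _ (ccont_cst 1)) => t; rewrite expr0.
by apply: (ccont_ext _ (ccontM hu IH)) => t; rewrite exprS.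
Qed.
Lemma ReC z : complex.Re (z^* : C) = complex.Re z. Proof. by case: z. Qed.
Lemma ImC z : complex.Im (z^* : C) = - complex.Im z. Proof. by case: z. Qed.
Lemma ccont_conj u : ccont u -> ccont (fun t => (u t)^*).
Proof.
move=> [u1 u2]; split; first by under eq_fun do rewrite ReC.
by under eq_fun do rewrite ImC; exact: cfunN.
Qed.

Lemma ccont_cnorm u : ccont u -> continuous (fun t => cnorm (u t)).
Proof.
move=> [u1 u2].
have -> : (fun t => cnorm (u t)) =
    (fun t => Num.sqrt (complex.Re (u t) ^+ 2 + complex.Im (u t) ^+ 2)).
  by apply/funext => t; rewrite /cnorm normc_def.
apply: cfun_comp; first by move=> t; exact: sqrt_continuous.
by under eq_fun do rewrite !expr2; apply: cfunD; exact: cfunM.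
Qed.

Lemma ccontV u : (forall t, u t != 0) -> ccont u -> ccont (fun t => (u t)^-1).
Proof.
move=> u0 hu; apply: (@ccont_ext (fun t => (u t)^* * ((cnorm (u t)) ^- 2)%:C)).
  move=> t; rewrite invc_norm mulrC -cnormE fmorphV/= rmorphXn/=.
  by [].
apply: ccontM; first exact: ccont_conj.
apply: ccont_real; apply: cfunV.
  by move=> t; rewrite expf_neq0// cnorm_eq0.
by under eq_fun do rewrite expr2; apply: cfunM; exact: ccont_cnorm.
Qed.

Lemma ccont_cis f : continuous f -> ccont (fun t => cis (f t)).
Proof.
by move=> hf; split => /=; apply: cfun_comp => // t;
  [exact: continuous_cos|exact: continuous_sin].
Qed.

Lemma ccont_cexp u : ccont u -> ccont (fun t => cexp (u t)).
Proof.
move=> [u1 u2]; apply: ccontM; last exact: ccont_cis.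
by apply: ccont_real; apply: cfun_comp => // t; exact: continuous_expR.
Qed.

Lemma ccont_clog u : (forall t, 0 < complex.Re (u t)) -> ccont u ->
  ccont (fun t => clog (u t)).
Proof.
move=> u0 hu; have [u1 u2] := hu.
have n0 t : 0 < cnorm (u t).
  by rewrite (lt_le_trans _ (cnorm_Re _))// normr_gt0 gt_eqF.
split => /=.
  by apply: cfun_comp; [move=> t; exact: continuous_ln|exact: ccont_cnorm].
under eq_fun do rewrite carg_asin//.
apply: cfun_comp; last first.
  by apply: cfunM => //; apply: cfunV; [move=> t; rewrite gt_eqF|exact: ccont_cnorm].
move=> t; apply: continuous_asin.
rewrite -ltr_norml normrM normfV (gtr0_norm (n0 t)) ltr_pdivrMr// mul1r.
rewrite -(ltr_pXn2r (n := 2)) ?nnegrE ?cnorm_ge0// cnorm_sqr real_normK ?num_real//.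
by rewrite ltrDr exprn_gt0.
Qed.

Section Integral.
Let D : set R := `[- pi, pi].
Local Notation mu := (@lebesgue_measure R).

Definition cint u : C :=
  Complex (\int[mu]_(t in D) complex.Re (u t)) (\int[mu]_(t in D) complex.Im (u t)).

Let cint_able f : continuous f -> mu.-integrable D (EFin \o f).
Proof.
move=> hf; apply: continuous_compact_integrable; first exact: segment_compact.
exact: continuous_subspaceT.
Qed.
Let mD : measurable D. Proof. exact: measurable_itv. Qed.

Let RintE : fine (mu D) = 2 * pi :> R.
Proof.
rewrite /D lebesgue_measure_itv /= lte_fin ifT /=; first by ring.
by have := @pi_gt0 R; lra.
Qed.

Lemma cintD u v : ccont u -> ccont v -> cint (fun t => u t + v t) = cint u + cint v.
Proof.
move=> [u1 u2] [v1 v2]; apply/eqP; rewrite eq_complex /=.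
apply/andP; split; apply/eqP.
  by under eq_Rintegral do rewrite ReD; rewrite RintegralD//; exact: cint_able.
by under eq_Rintegral do rewrite ImD; rewrite RintegralD//; exact: cint_able.
Qed.

Lemma cintZ (c : C) u : ccont u -> cint (fun t => c * u t) = c * cint u.
Proof.
move=> [u1 u2]; apply/eqP; rewrite eq_complex /= ReM ImM /=.
have i1 := cint_able u1; have i2 := cint_able u2.
have z1 (a : R) := cint_able (cfunM (@cfun_cst a) u1).
have z2 (a : R) := cint_able (cfunM (@cfun_cst a) u2).
apply/andP; split; apply/eqP.
  under eq_Rintegral do rewrite ReM.
  by rewrite RintegralB// ?RintegralZl.
under eq_Rintegral do rewrite ImM.
by rewrite RintegralD// ?RintegralZl.
Qed.

Lemma cint_bound u (B : R) : ccont u -> (forall t, cnorm (u t) <= B) ->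
  cnorm (cint u) <= 4 * pi * B.
Proof.
move=> [u1 u2] uB; apply: le_trans (cnorm_le _) _ => /=.
have bnd f : continuous f -> (forall t, `|f t| <= B) ->
    `|\int[mu]_(t in D) f t| <= 2 * pi * B.
  move=> hf fB; apply: le_trans; first by apply: le_normr_Rintegral => //; exact: cint_able.
  rewrite [2 * pi * B]mulrC -RintE -Rintegral_cst//; apply: le_Rintegral => //.
  - by apply: cint_able; apply: cfun_comp => // t; exact: norm_continuous.
  - by apply: cint_able; exact: cfun_cst.
have b1 := bnd _ u1 (fun t => le_trans (cnorm_Re _) (uB t)).
have b2 := bnd _ u2 (fun t => le_trans (cnorm_Im _) (uB t)).
have -> : 4 * pi * B = 2 * pi * B + 2 * pi * B by ring.
exact: lerD.
Qed.

Lemma sin_int_pi (k : int) : sin (k%:~R * pi) = 0 :> R.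
Proof.
have h (n : nat) : sin (n%:R * pi) = 0 :> R.
  elim: n => [|n IH]; first by rewrite mul0r sin0.
  by rewrite -natr1 mulrDl mul1r sinDpi IH oppr0.
case: k => n; first exact: h.
by rewrite NegzE rmorphN mulNr sinN h oppr0.
Qed.

Lemma cint_cis (k : int) : cint (fun t => cis (k%:~R * t)) =
  if k == 0 then (2 * pi)%:C else 0.
Proof.
case: eqVneq => [->|k0].
  have -> : (fun t : R => cis (0%:~R * t)) = fun=> 1 :> C.
    by apply/funext => t; rewrite mul0r cis0.
  apply/eqP; rewrite eq_complex /= !Rintegral_cst// RintE mul1r mul0r !eqxx //.
have p0 := @pi_gt0 R; have pp : - pi < pi :> R by lra.
have kr : (k%:~R : R) != 0 by rewrite intr_eq0.
have cd (t : R) : is_derive t 1 (fun t : R => k%:~R * t) k%:~R.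
  by apply: is_derive_eq; rewrite scaler1 // /GRing.scale /= mulr1.
have ftc (F f : R -> R) : continuous f -> (forall t : R, is_derive t 1 F (f t)) ->
    \int[mu]_(t in D) f t = F pi - F (- pi).
  move=> hf hF; rewrite /Rintegral (@continuous_FTC2 R f F (- pi) pi)//.
  - exact: continuous_subspaceT.
  - have cF : continuous F.
      move=> t; apply: differentiable_continuous; apply/derivable1_diffP.
      by have [] := hF t.
    split; first by move=> t _; have [] := hF t.
    + by apply: cvg_at_right_filter; exact: cF.
    + by apply: cvg_at_left_filter; exact: cF.
  - by move=> t _; rewrite derive1E; apply: derive_val.
have cl : continuous (fun t : R => k%:~R * t).
  by apply: cfunM; [exact: cfun_cst|move=> t; exact: cvg_id].
have dcos (t : R) : is_derive t 1 (fun t => (k%:~R)^-1 * sin (k%:~R * t)) (cos (k%:~R * t)).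
  by apply: is_derive_eq; rewrite /GRing.scale /= mulrCA mulVf ?mulr1.
have dsin (t : R) : is_derive t 1 (fun t => - (k%:~R)^-1 * cos (k%:~R * t)) (sin (k%:~R * t)).
  by apply: is_derive_eq; rewrite /GRing.scale /= mulrCA [X in _ * X]mulNr mulVf// mulrN1 opprK.
apply/eqP; rewrite eq_complex /=; apply/andP; split; apply/eqP.
  rewrite (ftc _ _ _ dcos); last by apply: cfun_comp => // t; exact: continuous_cos.
  by rewrite mulrN sinN sin_int_pi oppr0 subrr.
rewrite (ftc _ _ _ dsin); last by apply: cfun_comp => // t; exact: continuous_sin.
by rewrite mulrN cosN subrr.
Qed.

Lemma fourierE (F : C -> C) n : fourier F n =
  ((2 * pi)^-1)%:C * cint (fun t => F (cis t) * cis (- (n%:~R * t))).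
Proof. by []. Qed.

End Integral.
End ComplexContinuity.

(** * Weight vectors of the continuous and discrete series *)

Section LadderBuild.
Context {R : realType} {K : hilbertType R}.
Local Notation C := (R[i]).

(** Turns a basis indexed by naturals or integers into a family indexed by all real weights, zero
    off the values of [w], so that summands with weights in different classes modulo 1 can be
    treated together. [D j] is the boost derivative found in the concrete model; the last hypothesis
    puts it in ladder form. *)
Lemma ladder_build (J : Type) (e D : J -> K) (w : J -> R) (k : C)
    (rho : mob R -> K -> K) :
  injective w -> orthogonal_basis e -> (forall g, rho g 0 = 0) ->
  (forall g th j, mob_pair g = (cis th, 0) -> 0 <= th <= 1 ->
     rho (mob_inv g) (e j) = cis (th * w j) *: e j) ->
  (forall i j, exists M : R, forall g r, mob_pair g = (1, r%:C) -> 0 < r < 8^-1 ->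
     `|inner (rho (mob_inv g) (e j) - e j - r%:C *: D j) (e i)| <= (M * r ^+ 2)%:C) ->
  (forall b : R -> K, (forall j, b (w j) = e j) ->
     (forall x, (forall j, w j <> x) -> b x = 0) ->
     forall j, ladder_deriv k b (w j) = D j) ->
  exists b : R -> K, [/\ ladder rho k [set x | exists j, x = w j] b,
     (forall j, b (w j) = e j) & forall v, (forall x, inner v (b x) = 0) -> v = 0].
Proof.
move=> winj [e0 eorth etot] rho0 rot expn bD.
pose b x := if pselect (exists j, w j = x) is left h then e (sval (cid h)) else 0.
have bw j : b (w j) = e j.
  rewrite /b; case: pselect => [h|[]]; last by exists j.
  by case: (cid h) => i wi /=; rewrite (winj _ _ wi).
have b0 x : (forall j, w j <> x) -> b x = 0.
  by move=> h; rewrite /b; case: pselect => // p; have [j /h] := p.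
have bcase x : (exists2 j, x = w j & b x = e j) \/ b x = 0.
  have [[j wj]|h] := pselect (exists j, w j = x); first by left; exists j; rewrite // -wj.
  by right; apply: b0 => j wj; apply: h; exists j.
exists b; split => //; last first.
  by move=> v hv; apply: etot => j; rewrite -bw.
split.
- move=> x; split=> [[j ->]|bx]; first by rewrite bw.
  by case: (bcase x) => [[j xj _]|h]; [exists j|rewrite h eqxx in bx].
- move=> x y xy; have [[i xi ->]|->] := bcase x; last by rewrite inner0l.
  have [[j yj ->]|->] := bcase y; last by rewrite inner0r.
  by apply: eorth => ij; rewrite xi yj ij eqxx in xy.
- move=> g th x gE th1; have [[j -> ->]|->] := bcase x; first exact: rot.
  by rewrite rho0 scaler0.
- move=> x y [j ->]; rewrite (bD b bw b0) bw.
  have [[i -> ->]|->] := bcase y; first exact: expn.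
  by exists 0 => g r _ _; rewrite inner0r normr0 mul0r.
Qed.

Lemma unitary0 (U : K -> K) : unitary U -> U 0 = 0.
Proof.
move=> [Ul _ _]; have := Ul 1 0 0; rewrite !scale1r !addr0 => e.
by apply: (addrI (U 0)); rewrite -e addr0.
Qed.

End LadderBuild.

(** * The action on trigonometric monomials *)

Section CircleModel.
Context {R : realType}.
Local Notation C := (R[i]).

(* On the unit circle this is z^n. *)
Definition zpow (n : int) (z : C) : C :=
  match n with Posz m => z ^+ m | Negz m => (z^*) ^+ m.+1 end.

Lemma cis_natM (n : nat) (t : R) : cis (n%:R * t) = cis t ^+ n.
Proof.
elim: n => [|n IH]; first by rewrite mul0r cis0 expr0.
by rewrite -natr1 mulrDl mul1r cis_real_mul IH exprSr.
Qed.

Lemma zpow_cis n (t : R) : zpow n (cis t) = cis (n%:~R * t).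
Proof.
case: n => n /=; first by rewrite -cis_natM.
by rewrite conj_cis -cis_natM NegzE rmorphN mulNr mulrN.
Qed.

Lemma cnorm_cis (t : R) : cnorm (cis t) = 1.
Proof. by rewrite /cnorm norm_cis. Qed.

Lemma ccont_shift (a : R) : ccont (fun t => cis (a * t)).
Proof. by apply: ccont_cis; apply: cfunM; [exact: cfun_cst|move=> t; exact: cvg_id]. Qed.

Lemma ccont_id : ccont (fun t : R => cis t).
Proof. by apply: ccont_cis => t; exact: cvg_id. Qed.

Lemma expands_zpow (n : int) : exists2 M : R, 0 <= M & forall g r t,
  mob_pair g = (1, r%:C) -> 0 < r < 8^-1 ->
  cnorm (zpow n (mob_fun g (cis t)) - cis (n%:~R * t) -
    r%:C * (n%:~R * (cis ((n%:~R + 1) * t) - cis ((n%:~R - 1) * t)))) <= M * r ^+ 2.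
Proof.
have cs (t : R) : cis t * cis (- t) = 1 :> C by rewrite -cis_real_mul subrr cis0.
case: n => n.
  have [M M0 h] := expandsX n (expands_mob_fun (R := R)).
  exists M => // g r t gE r8; have [|_ _] := h g r (cis t) gE r8; first by rewrite cnorm_cis.
  congr (cnorm (_ - _ - _ * _) <= _); first by rewrite -pmulrn cis_natM.
  rewrite -!pmulrn !mulrDl mulNr mul1r !cis_real_mul cis_natM; case: n {h} => [|n]; first by rewrite !mul0r.
  rewrite /= -mulrA; congr (_ * _).
  rewrite [cis t ^+ n.+1]exprSr.
  transitivity (cis t ^+ n * (cis t * cis t - cis t * cis (- t))); first by rewrite cs expr2.
  by ring.
have [M M0 h] := expandsX n.+1 (expands_conj (expands_mob_fun (R := R))).
exists M => // g r t gE r8; have [|_ _] := h g r (cis t) gE r8; first by rewrite cnorm_cis.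
have E : (Negz n)%:~R * t = n.+1%:R * (- t) by rewrite NegzE rmorphN mulNr mulrN.
congr (cnorm (_ - _ - _ * _) <= _); first by rewrite E cis_natM conj_cis.
rewrite !mulrDl mulNr mul1r !cis_real_mul E cis_natM /= rmorphB rmorphXn rmorph1 /= conj_cis.
rewrite mulN1r -mulrN opprB -mulrA; congr (_ * _).
rewrite [cis (- t) ^+ n.+1]exprSr.
transitivity (cis (- t) ^+ n * (cis (- t) * cis (- t) - cis t * cis (- t))).
  by rewrite cs expr2.
by ring.
Qed.

(** The multiplier contributes lam z + mu (z + 1/z) and the substitution n (z - 1/z), each times
    z^n. The coefficients n + lam + mu and n - mu are x + kappa and x - kappa for x = lam/2 + n,
    kappa = lam/2 + mu. *)
Lemma circle_expansion (lam : R) (mu : C) (n : int) : exists2 M : R, 0 <= M &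
  forall g r t, mob_pair g = (1, r%:C) -> 0 < r < 8^-1 ->
  cnorm (Rlm lam mu g (zpow n) (cis t) - cis (n%:~R * t) -
    r%:C * ((n%:~R + lam%:C + mu) * cis ((n%:~R + 1) * t) -
            (n%:~R - mu) * cis ((n%:~R - 1) * t))) <= M * r ^+ 2.
Proof.
have [L L0 hL] := expandsM (expands_mob_deriv_pow lam) (expands_mob_deriv_norm_pow mu).
have [M M0 hM] := expands_zpow n.
have cn := cnorm_cis; have nn := cnorm_ge0 (n%:~R : C).
set N := cnorm (n%:~R : C) in nn.
exists (L + (1 + 2 * L) * M + 4 * (L * N)) => [|g r t gE r8].
  by rewrite !addr_ge0 ?mulr_ge0// ?addr_ge0 ?mulr_ge0.
have /andP[r0 r1] := r8; have r2 := sqr_ge0 r.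
have [|_ l2 l3] := hL g r (cis t) gE r8; first by rewrite cn.
have m3 := hM g r t gE r8.
rewrite /= !mul1r !mulr1 in l2 l3.
have rn : cnorm r%:C = r by rewrite cnorm_real gtr0_norm.
rewrite /Rlm; set A := mob_deriv_pow _ _ _ * _ in l3 *; set B := zpow _ _ in m3 *.
set a1 := mu * _ + _ in l2 l3; set z0 := cis (n%:~R * t) in m3 *.
set zp := cis ((n%:~R + 1) * t) in m3 *; set zm := cis ((n%:~R - 1) * t) in m3 *.
set b1 := n%:~R * _ in m3.
have E : (n%:~R + lam%:C + mu) * zp - (n%:~R - mu) * zm = a1 * z0 + b1.
  rewrite /a1 /b1 /zp /zm /z0 conj_cis !mulrDl mulNr !mul1r !cis_real_mul; ring.
have b1n : cnorm b1 <= 2 * N.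
  rewrite cnormM mulrC ler_wpM2r// (le_trans (cnormB _ _))// !cn; lra.
rewrite E; have -> : A * B - z0 - r%:C * (a1 * z0 + b1) =
   (A - 1 - r%:C * a1) * z0 + (A * (B - z0 - r%:C * b1) + (A - 1) * (r%:C * b1)) by ring.
have An : cnorm (A - 1) <= 2 * L * r.
  have -> : A - 1 = (A - 1 - r%:C * a1) + r%:C * a1 by ring.
  rewrite (le_trans (cnormD _ _))// cnormM rn.
  have : L * r ^+ 2 <= L * r by rewrite ler_wpM2l// expr2 ler_piMr//; lra.
  have : r * cnorm a1 <= r * L by rewrite ler_wpM2l// ltW.
  by move: l3; lra.
have An1 : cnorm A <= 1 + 2 * L.
  have -> : A = 1 + (A - 1) by ring.
  rewrite (le_trans (cnormD _ _))// cnorm1 lerD2l (le_trans An)// ler_piMr ?mulr_ge0//; lra.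
rewrite (le_trans (cnormD _ _))//.
have t1 : cnorm ((A - 1 - r%:C * a1) * z0) <= L * r ^+ 2 by rewrite cnormM cn mulr1.
have t2 : cnorm (A * (B - z0 - r%:C * b1)) <= (1 + 2 * L) * (M * r ^+ 2).
  by rewrite cnormM ler_pM ?cnorm_ge0.
have t3 : cnorm ((A - 1) * (r%:C * b1)) <= 2 * L * r * (r * (2 * N)).
  by rewrite cnormM ler_pM ?cnorm_ge0// cnormM rn ler_wpM2l// ltW.
have t4 := cnormD (A * (B - z0 - r%:C * b1)) ((A - 1) * (r%:C * b1)).
have -> : (L + (1 + 2 * L) * M + 4 * (L * N)) * r ^+ 2 =
  L * r ^+ 2 + ((1 + 2 * L) * (M * r ^+ 2) + 2 * L * r * (r * (2 * N))) by ring.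
by rewrite lerD// (le_trans t4)// lerD.
Qed.

Lemma ccont_mob_fun (g : mob R) (r : R) : mob_pair g = (1, r%:C) -> 0 < r < 8^-1 ->
  ccont (fun t => mob_fun g (cis t)).
Proof.
move=> gE r8; apply: ccontM.
  apply: ccontM; first exact: ccont_cst.
  by apply: ccontB; [exact: ccont_id|exact: ccont_cst].
apply: ccontV; first by move=> t; apply: mob_den_neq0; rewrite norm_cis.
apply: ccontB; first exact: ccont_cst.
by apply: ccontM; [exact: ccont_cst|exact: ccont_id].
Qed.

Lemma ccont_zpow n u : ccont u -> ccont (fun t => zpow n (u t)).
Proof.
case: n => n hu /=; first exact: ccontX.
by apply: ccontX; exact: ccont_conj.
Qed.

Lemma ccont_log_mob_deriv (g : mob R) (r : R) : mob_pair g = (1, r%:C) ->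
  0 < r < 8^-1 -> ccont (fun t => log_mob_deriv g (cis t)).
Proof.
move=> gE /andP[r0 r1].
apply: (ccont_ext (u := fun t => (ln (1 - r ^+ 2))%:C - 2 * clog (1 - r%:C * cis t))).
  by move=> t; rewrite (log_mob_derivE _ gE r0).
apply: ccontB; first exact: ccont_cst.
apply: ccontM; first exact: ccont_cst.
apply: ccont_clog.
  move=> t; rewrite !ReImE /= mul0r subr0.
  by have := cos_max t; rewrite ler_norml => /andP[_ h]; nra.
apply: ccontB; first exact: ccont_cst.
by apply: ccontM; [exact: ccont_cst|exact: ccont_id].
Qed.

Lemma ccont_Rlm (lam : R) (mu : C) (n : int) (g : mob R) (r : R) :
  mob_pair g = (1, r%:C) -> 0 < r < 8^-1 ->
  ccont (fun t => Rlm lam mu g (zpow n) (cis t)).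
Proof.
move=> gE r8; have [h1 h2] := ccont_log_mob_deriv gE r8.
apply: ccontM; last exact: ccont_zpow (ccont_mob_fun gE r8).
apply: ccontM.
  by apply: ccont_cexp; apply: ccontM; [exact: ccont_cst|].
apply: (ccont_ext (u := fun t =>
    cexp (mu * (complex.Re (log_mob_deriv g (cis t)))%:C))).
  move=> t; rewrite /mob_deriv_norm_pow (ln_cnorm_mob_deriv gE r8)//.
  by rewrite cnorm_cis.
apply: ccont_cexp; apply: ccontM; first exact: ccont_cst.
exact: ccont_real.
Qed.

End CircleModel.

Section CircleLadder.
Context {R : realType} {K : hilbertType R}.
Local Notation C := (R[i]).

Lemma cintB (u v : R -> C) : ccont u -> ccont v ->
  cint (fun t => u t - v t) = cint u - cint v.
Proof.
move=> hu hv; have h := cintZ (-1) hv.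
have := cintD hu (ccontM (ccont_cst (-1)) hv); rewrite h mulN1r => <-.
by congr cint; apply/funext => t; rewrite mulN1r.
Qed.

Lemma ccont_char (m : int) : ccont (fun t : R => cis (- (m%:~R * t))).
Proof.
apply: (ccont_ext _ (ccont_shift (- m%:~R))) => t.
by rewrite mulNr.
Qed.

Lemma fourier_zpow (n m : int) : fourier (@zpow R n) m = (n == m)%:R.
Proof.
rewrite fourierE.
have -> : (fun t : R => zpow n (cis t) * cis (- (m%:~R * t))) =
    fun t => cis ((n - m)%:~R * t).
  by apply/funext => t; rewrite zpow_cis -cis_real_mul rmorphB mulrBl.
rewrite cint_cis subr_eq0; case: eqP => _; last by rewrite mulr0.
by rewrite -realCM mulVf// mulf_neq0 ?pnatr_eq0// gt_eqF// pi_gt0.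
Qed.

Lemma square_integrable_zpow (n : int) : square_integrable (@zpow R n).
Proof.
have h := ccont_zpow n (ccont_id (R := R)); have [h1 h2] := h.
split.
- by apply: measurable_funTS; exact: measurable_realfun.continuous_measurable_fun.
- by apply: measurable_funTS; exact: measurable_realfun.continuous_measurable_fun.
- apply: (@continuous_compact_integrable R (fun t => cnorm (zpow n (cis t)) ^+ 2)).
    exact: segment_compact.
  apply: continuous_subspaceT; under eq_fun do rewrite expr2.
  by apply: cfunM; exact: ccont_cnorm.
Qed.

(** Angles in [0, 1] lie in the range of the principal argument, so the weights of the rotations
    appear without a branch correction. *)
Lemma carg_cis (th : R) : 0 <= th <= 1 -> carg (cis th) = th.
Proof.
move=> /andP[t0 t1]; have p2 := @pi_ge2 R.
have -> : carg (cis th) = acos (cos th).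
  by rewrite /carg cnorm_cis divr1 /= sin_ge0_pi//; lra.
by rewrite cosK// in_itv /=; lra.
Qed.

Lemma clog1 : clog (1 : C) = 0.
Proof. by rewrite /clog carg1 cnorm1 ln1. Qed.

Lemma log_mob_deriv_rotation (g : mob R) (s z : C) : mob_pair g = (s, 0) ->
  log_mob_deriv g z = Complex 0 (carg s).
Proof.
move=> gE; rewrite /log_mob_deriv /mob_rot /mob_pt gE /= conjC0 mul0r subr0 clog1.
by rewrite cnorm0 expr0n subr0 ln1 mulr0 subr0.
Qed.

Lemma mob_fun_rotation (g : mob R) (s z : C) : mob_pair g = (s, 0) ->
  mob_fun g z = s * z.
Proof.
by move=> gE; rewrite /mob_fun /mob_rot /mob_pt gE /= conjC0 mul0r !subr0 divr1.
Qed.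

Lemma cexp_imag (y : R) : cexp (Complex 0 y) = cis y.
Proof. by rewrite /cexp /= expR0 mul1r. Qed.

Lemma mob_deriv_pow_rotation (g : mob R) (s z : C) (lam : R) :
  mob_pair g = (s, 0) -> mob_deriv_pow g lam z = cis (lam / 2 * carg s).
Proof.
move=> gE; rewrite /mob_deriv_pow (log_mob_deriv_rotation _ gE) -cexp_imag.
congr cexp; apply/eqP; rewrite eq_complex /=; apply/andP; split; apply/eqP; ring.
Qed.

Lemma mob_deriv_norm_pow_rotation (g : mob R) (s z mu : C) :
  mob_pair g = (s, 0) -> `|s| = 1 -> mob_deriv_norm_pow g mu z = 1.
Proof.
move=> gE s1; rewrite /mob_deriv_norm_pow /mob_deriv /mob_rot /mob_pt gE /=.
rewrite normr0 expr0n /= subr0 mulr1 conjC0 mul0r subr0 expr1n divr1.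
by rewrite /cnorm s1 ln1 mulr0 -[0]/(Complex 0 0) cexp_imag cis0.
Qed.

Lemma Rlm_rotation (lam : R) (mu : C) (n : int) (g : mob R) (th t : R) :
  mob_pair g = (cis th, 0) -> 0 <= th <= 1 ->
  Rlm lam mu g (zpow n) (cis t) = cis (th * (lam / 2 + n%:~R)) * zpow n (cis t).
Proof.
move=> gE th1; rewrite /Rlm (mob_deriv_pow_rotation _ _ gE).
rewrite (mob_deriv_norm_pow_rotation _ _ gE) ?norm_cis// mulr1 carg_cis//.
rewrite (mob_fun_rotation _ gE) -cis_real_mul !zpow_cis -!cis_real_mul.
by congr cis; ring.
Qed.

(** The representation is evaluated only on the monomials z^n, which are genuine functions even in
    the Complementary series. Coordinates are Fourier coefficients, so a uniform error of the
    transformed function bounds each of them. *)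
Lemma circle_ladder (lam : R) (mu : C) (w : int -> R) (rho : mob R -> K -> K) :
  (forall g, unitary (rho g)) -> circle_rep lam mu w rho ->
  exists b : R -> K, [/\
    ladder rho ((lam / 2)%:C + mu) [set x | exists n : int, x = lam / 2 + n%:~R] b,
    forall n : int, `|b (lam / 2 + n%:~R)| ^+ 2 = (w n)%:C
    & forall v, (forall x, inner v (b x) = 0) -> v = 0].
Proof.
move=> rhoU [e [eb ew erep]]; have [e0 eorth etot] := eb.
have innerE n m : inner (e n) (e m) = fourier (@zpow R n) m * `|e m| ^+ 2.
  rewrite fourier_zpow; have [->|nm] := eqVneq n m; first by rewrite mul1r inner_norm.
  by rewrite eorth ?mul0r//; exact/eqP.
have repn n : represents e (zpow n) (e n) by move=> m; exact: innerE.
have repg g n := erep g _ _ (square_integrable_zpow n) (repn n).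
pose wt (n : int) : R := lam / 2 + n%:~R.
pose D (n : int) := (n%:~R + lam%:C + mu) *: e (n + 1) - (n%:~R - mu) *: e (n - 1).
have [||||||b [hb bw tb]] := @ladder_build R K int e D wt ((lam / 2)%:C + mu) rho.
- by move=> n m; rewrite /wt => /addrI /intr_inj.
- exact: eb.
- by move=> g; exact: unitary0.
- move=> g th n gE th1; apply/eqP; rewrite -subr_eq0; apply/eqP/etot => m.
  rewrite innerBl innerZl repg innerE mulrA -mulrBl.
  suff -> : fourier (Rlm lam mu g (zpow n)) m = cis (th * wt n) * fourier (zpow n) m.
    by rewrite subrr mul0r.
  rewrite !fourierE mulrCA; congr (_ * _); rewrite -cintZ; last first.
    by apply: ccontM; [exact: ccont_zpow (ccont_id (R := R))|exact: ccont_char].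
  by congr cint; apply/funext => t; rewrite (Rlm_rotation _ _ _ _ gE th1) mulrA.
- move=> m n; have [M M0 hM] := circle_expansion lam mu n.
  (* The factor 2 is the 4 pi of [cint_bound] divided by the 2 pi of the Fourier coefficient. *)
  exists (2 * M * cnorm (`|e m| ^+ 2)) => g r gE r8.
  have cz k := ccont_zpow k (ccont_id (R := R)).
  set A := n%:~R + lam%:C + mu; set B := n%:~R - mu.
  have -> : inner (rho (mob_inv g) (e n) - e n - r%:C *: D n) (e m) =
    (fourier (Rlm lam mu g (zpow n)) m - fourier (zpow n) m -
     r%:C * (A * fourier (zpow (n + 1)) m - B * fourier (zpow (n - 1)) m)) * `|e m| ^+ 2.
    by rewrite /D -/A -/B !innerBl innerZl innerBl !innerZl repg !innerE; ring.
  rewrite -cnormE cnormM lecR.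
  rewrite [X in _ <= X](_ : _ = 2 * (M * r ^+ 2) * cnorm (`|e m| ^+ 2)); last by ring.
  rewrite ler_wpM2r ?cnorm_ge0//.
  pose u (v : R -> C) t := v t * cis (- (m%:~R * t)).
  have cu v : ccont v -> ccont (u v) by move=> hv; apply: ccontM => //; exact: ccont_char.
  have fE F : fourier F m = ((2 * pi)^-1)%:C * cint (u (fun t => F (cis t))).
    by rewrite fourierE.
  pose E t := Rlm lam mu g (zpow n) (cis t) - cis (n%:~R * t) -
    r%:C * (A * cis ((n%:~R + 1) * t) - B * cis ((n%:~R - 1) * t)).
  have cW := ccont_Rlm lam mu n gE r8.
  have cE : ccont E.
    apply: ccontB; first by apply: ccontB => //; exact: ccont_shift.
    apply: ccontM; first exact: ccont_cst.
    by apply: ccontB; apply: ccontM; (try exact: ccont_cst); exact: ccont_shift.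
  have -> : fourier (Rlm lam mu g (zpow n)) m - fourier (zpow n) m -
     r%:C * (A * fourier (zpow (n + 1)) m - B * fourier (zpow (n - 1)) m) =
     ((2 * pi)^-1)%:C * cint (u E).
    rewrite !fE.
    have -> : u E = fun t => u (fun t => Rlm lam mu g (zpow n) (cis t)) t -
        u (fun t => zpow n (cis t)) t -
        r%:C * (A * u (fun t => zpow (n + 1) (cis t)) t -
                B * u (fun t => zpow (n - 1) (cis t)) t).
      apply/funext => t; rewrite /u /E !zpow_cis rmorphD rmorphB rmorph1.
      by ring.
    rewrite cintB; last 2 first.
    + by apply: ccontB; exact: cu.
    + apply: ccontM; first exact: ccont_cst.
      by apply: ccontB; apply: ccontM; (try exact: ccont_cst); exact: cu.
    rewrite cintB; [|exact: cu|exact: cu].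
    rewrite cintZ; last by apply: ccontB; apply: ccontM; (try exact: ccont_cst); exact: cu.
    rewrite cintB; try by apply: ccontM; [exact: ccont_cst|exact: cu].
    rewrite !cintZ; try exact: cu.
    by ring.
  rewrite cnormM cnorm_real ger0_norm; last first.
    by rewrite invr_ge0 mulr_ge0// pi_ge0.
  have hE : cnorm (cint (u E)) <= 4 * pi * (M * r ^+ 2).
    apply: cint_bound; first exact: cu.
    by move=> t; rewrite cnormM cnorm_cis mulr1; exact: hM.
  have p0 := @pi_gt0 R.
  rewrite mulrC ler_pdivrMr ?mulr_gt0// (le_trans hE)// le_eqVlt.
  by apply/orP; left; apply/eqP; ring.
- move=> b bw _ n; rewrite /ladder_deriv /D.
  have -> : wt n + 1 = wt (n + 1) by rewrite /wt rmorphD rmorph1 addrA.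
  have -> : wt n - 1 = wt (n - 1) by rewrite /wt rmorphB rmorph1 addrA.
  rewrite !bw; congr (_ *: _ - _ *: _); rewrite /wt realCD rmorph_int.
    have -> : lam%:C = (lam / 2)%:C + (lam / 2)%:C by rewrite -realCD -splitr.
    by ring.
  by ring.
exists b; split => //; first by move=> n; rewrite bw ew.
Qed.

End CircleLadder.

(** * Coefficients of holomorphic functions on the disc *)

Section DiscModel.
Context {R : realType} {K : hilbertType R}.
Local Notation C := (R[i]).

Lemma ccont_continuous (u : R -> C) : ccont u -> continuous (u : R -> C^o).
Proof.
move=> [u1 u2] t; apply/cvgrPdist_lt => e e0.
have eR : (complex.Re e)%:C = e by rewrite RRe_real// gtr0_real.
have e2 : 0 < complex.Re e / 2 by rewrite divr_gt0// -ltcR eR.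
have /cvgrPdist_lt /(_ _ e2) h1 := u1 t; have /cvgrPdist_lt /(_ _ e2) h2 := u2 t.
near=> s; rewrite -eR -cnormE ltcR (le_lt_trans (cnorm_le _))//.
rewrite !ReImE [ltRHS]splitr ltrD//; first by near: s.
by near: s.
Unshelve. all: by end_near. Qed.

Lemma continuous_ccont (u : R -> C) : continuous (u : R -> C^o) -> ccont u.
Proof.
move=> hu; split=> t; apply/cvgrPdist_lt => e e0.
  have e0C : 0 < e%:C by rewrite ltcR.
  have /cvgrPdist_lt /(_ _ e0C) h := hu t.
  near=> s; rewrite -ReN -ReD (le_lt_trans (cnorm_Re _))// -ltcR cnormE.
  by near: s.
have e0C : 0 < e%:C by rewrite ltcR.
have /cvgrPdist_lt /(_ _ e0C) h := hu t.
near=> s; rewrite -ImN -ImD (le_lt_trans (cnorm_Im _))// -ltcR cnormE.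
by near: s.
Unshelve. all: by end_near. Qed.

Lemma ccont_derivable (f : C -> C) (u : R -> C) : ccont u ->
  (forall t, derivable (f : C^o -> C^o) (u t) 1) -> ccont (fun t => f (u t)).
Proof.
move=> hu hf; apply: continuous_ccont => t.
apply: (@continuous_comp _ _ _ (u : R -> C^o) (f : C^o -> C^o)).
  exact: ccont_continuous.
by apply: differentiable_continuous; apply/derivable1_diffP.
Qed.

Section Coefficients.
Context (ev : K -> C -> C) (e : nat -> K).
Hypotheses (ev_lin : forall z, disc z ->
    scalar (ev^~ z) /\ continuous (ev^~ z : K -> C^o))
  (ev_der : forall f z, disc z -> derivable (ev f : C^o -> C^o) z 1)
  (eb : orthogonal_basis e) (evE : forall n z, disc z -> ev (e n) z = z ^+ n).

Lemma evP a u v z : disc z -> ev (a *: u + v) z = a * ev u z + ev v z.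
Proof. by move=> /ev_lin[h _]; exact: h. Qed.
Lemma ev0 z : disc z -> ev 0 z = 0.
Proof.
move=> dz; have := evP 1 0 0 dz; rewrite scale1r addr0 mul1r => /eqP.
by rewrite -subr_eq0 opprD addrA subrr sub0r oppr_eq0 => /eqP.
Qed.
Lemma evD u v z : disc z -> ev (u + v) z = ev u z + ev v z.
Proof. by move=> dz; have := evP 1 u v dz; rewrite scale1r mul1r. Qed.
Lemma evZ a u z : disc z -> ev (a *: u) z = a * ev u z.
Proof. by move=> dz; have := evP a u 0 dz; rewrite !addr0 ev0// addr0. Qed.
Lemma evB u v z : disc z -> ev (u - v) z = ev u z - ev v z.
Proof. by move=> dz; rewrite evD// -scaleN1r evZ// mulN1r. Qed.

Lemma ev_bounded z : disc z -> exists2 A : R, 0 <= A &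
  forall v, cnorm (ev v z) <= A * complex.Re `|v|.
Proof.
move=> dz; have [_ /(_ 0)] := ev_lin dz.
move=> /cvgrPdist_lt /(_ 1 ltr01) /nbhs_ballP[d /= d0 hd].
have dR : (complex.Re d)%:C = d by rewrite RRe_real// gtr0_real.
have d0R : 0 < complex.Re d by rewrite -ltcR dR.
exists (2 / complex.Re d) => [|v]; first by rewrite divr_ge0// ltW.
have [->|v0] := eqVneq v 0; first by rewrite ev0// cnorm0 normr0 mulr0.
have nv : 0 < `|v| by rewrite normr_gt0.
pose a := d / 2 / `|v|.
have a0 : 0 < a by rewrite !divr_gt0.
have := hd (a *: v); rewrite -ball_normE /= sub0r normrN normrZ gtr0_norm//.
rewrite divfK ?gt_eqF// ltr_pdivrMr// ltr_pMr// ltr1n => /(_ isT).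
rewrite ev0// sub0r normrN evZ// normrM gtr0_norm// => h.
rewrite -lecR cnormE realCM real_complex_norm.
rewrite -(ler_pM2l a0) (le_trans (ltW h))//.
have -> : (2 / complex.Re d)%:C = 2 / d by rewrite realCM fmorphV/= dR rmorph_nat.
rewrite le_eqVlt; apply/orP; left; apply/eqP; rewrite /a; field.
by rewrite gt_eqF// gt_eqF.
Qed.

Lemma disc_half (t : R) : disc (cis t / 2 : C).
Proof.
rewrite /disc /= normrM norm_cis mul1r normfV normr_nat invf_lt1 ?ltr0n//.
by rewrite ltr1n.
Qed.

Hypothesis rotU : forall s : C, `|s| = 1 -> exists U : K -> K,
  (forall v, `|U v| = `|v|) /\
  forall v z, disc z -> cnorm (ev (U v) z) = cnorm (ev v (s * z)).

Let ccont_ev v : ccont (fun t : R => ev v (cis t / 2)).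
Proof.
apply: (@ccont_derivable (ev v) (fun t => cis t / 2)).
  by apply: ccontM; [exact: ccont_id|exact: ccont_cst].
by move=> t; apply: ev_der; exact: disc_half.
Qed.

(** Cauchy's formula on the circle of radius 1/2: both sides are bounded functionals of [v] that
    agree on the monomials. Evaluation is bounded at the point 1/2, and the rotations [rotU] carry
    this bound along the circle. *)
Lemma disc_coefficient v m :
  cint (fun t => ev v (cis t / 2) * cis (- (m%:R * t))) * `|e m| ^+ 2 =
  (2 * pi)%:C / 2 ^+ m * inner v (e m).
Proof.
have [e0 eorth etot] := eb.
have cc u : ccont (fun t => ev u (cis t / 2) * cis (- (m%:R * t))).
  by apply: ccontM => //; exact: (ccont_char (Posz m)).
have [A A0 hA] : exists2 A : R, 0 <= A &
    forall v t, cnorm (ev v (cis t / 2)) <= A * complex.Re `|v|.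
  have d2 : disc (2^-1 : C) by have := disc_half 0; rewrite cis0 mul1r.
  have [A A0 hA] := ev_bounded d2; exists A => // u t.
  have [U [Un Uev]] := rotU (norm_cis t).
  by rewrite -Uev// -(Un u).
apply/eqP; rewrite -subr_eq0; apply/eqP.
pose F u := cint (fun t => ev u (cis t / 2) * cis (- (m%:R * t))) * `|e m| ^+ 2 -
  (2 * pi)%:C / 2 ^+ m * inner u (e m).
apply: (@orthogonal_span _ K nat e (fun=> True) [set u | F u = 0]) => //.
- apply: (@closed_subspace_kernel _ _ F
    ((4 * pi * A)%:C * `|e m| ^+ 2 + `|(2 * pi)%:C / 2 ^+ m| * `|e m|)).
  + by rewrite addr_ge0 ?mulr_ge0 ?exprn_ge0// ler0c !mulr_ge0// pi_ge0.
  + move=> a u w; rewrite /F.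
    have -> : (fun t => ev (a *: u + w) (cis t / 2) * cis (- (m%:R * t))) =
       (fun t => a * (ev u (cis t / 2) * cis (- (m%:R * t))) +
                 ev w (cis t / 2) * cis (- (m%:R * t))).
      by apply/funext => t; rewrite evP ?mulrDl ?mulrA//; exact: disc_half.
    rewrite cintD//; last by apply: ccontM => //; exact: ccont_cst.
    by rewrite cintZ// innerDl innerZl; ring.
  + move=> u; rewrite /F (le_trans (ler_normB _ _))// [leRHS]mulrDl lerD//.
      rewrite normrM [`|_ ^+ 2|]ger0_norm ?exprn_ge0// mulrAC ler_wpM2r ?exprn_ge0//.
      rewrite -cnormE -real_complex_norm -realCM lecR -mulrA.
      apply: cint_bound => // t; rewrite cnormM cnorm_cis mulr1; exact: hA.
    by rewrite normrM -mulrA ler_wpM2l// mulrC cauchy_schwarz.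
- move=> k _; rewrite /= /F.
  have -> : (fun t => ev (e k) (cis t / 2) * cis (- (m%:R * t))) =
      fun t => (2^-1) ^+ k * cis ((Posz k - Posz m)%:~R * t).
    apply/funext => t; rewrite evE; last exact: disc_half.
    rewrite exprMn -cis_natM rmorphB mulrBl cis_real_mul. ring.
  rewrite cintZ; last exact: ccont_shift.
  rewrite cint_cis subr_eq0 eqz_nat.
  have [->|km] := eqVneq k m; first by rewrite inner_norm exprVn; ring.
  by rewrite eorth ?mulr0 ?mul0r ?subr0//; exact/eqP.
Qed.

(** The constant is 2^m from the radius 1/2, times 4 pi / (2 pi). *)
Lemma disc_coefficient_bound v m (B : R) : (forall t, cnorm (ev v (cis t / 2)) <= B) ->
  cnorm (inner v (e m)) <= 2 ^+ m.+1 * cnorm (`|e m| ^+ 2) * B.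
Proof.
move=> hB; have := disc_coefficient v m; move: (`|e m| ^+ 2) => Em.
move=> /(congr1 (@cnorm R)).
rewrite !cnormM cnorm_real cnormV cnormX.
have p0 := @pi_gt0 R.
have -> : cnorm (2 : C) = 2.
  by rewrite -(rmorph_nat (real_complex R)) cnorm_real ger0_norm.
rewrite ger0_norm; last by lra.
set c := cint _; set E := cnorm Em; set x := cnorm (inner _ _) => h.
have hc : cnorm c <= 4 * pi * B.
  apply: cint_bound.
    by apply: ccontM => //; exact: (ccont_char (Posz m)).
  by move=> t; rewrite cnormM cnorm_cis mulr1.
have E0 : 0 <= E := cnorm_ge0 _.
have p2 : 0 < (2 : R) ^+ m by rewrite exprn_gt0.
have xE : x = cnorm c * E * 2 ^+ m / (2 * pi).
  have q0 : 2 * pi != 0 :> R by rewrite gt_eqF// mulr_gt0.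
  rewrite h; move: (2 * pi) q0 (2 ^+ m) (gt_eqF p2) => q q0 p p1.
  by field; rewrite q0 p1.
rewrite xE ler_pdivrMr ?mulr_gt0//.
rewrite [leRHS](_ : _ = (4 * pi * B) * E * 2 ^+ m); last by rewrite exprS; ring.
by rewrite ler_wpM2r ?(ltW p2)// ler_wpM2r.
Qed.

(* the derivative at r = 0 of (1 - r^2)^(lam/2) (1 - r z)^(-lam-n) (z - r)^n *)
Definition disc_deriv (lam : R) (n : nat) : K :=
  (n%:R + lam%:C) *: e n.+1 - n%:R *: e n.-1.

Lemma disc_expansion (lam : R) (V : mob R -> K) (W : mob R -> C -> C) n m :
  (forall g r z, mob_pair g = (1, r%:C) -> 0 < r < 8^-1 -> disc z ->
     ev (V g) z = W g z) ->
  expands W (fun z => z ^+ n)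
    (fun z => lam%:C * z * z ^+ n + n%:R * z ^+ n.-1 * (z ^+ 2 - 1)) ->
  exists M : R, forall g r, mob_pair g = (1, r%:C) -> 0 < r < 8^-1 ->
    `|inner (V g - e n - r%:C *: disc_deriv lam n) (e m)| <= (M * r ^+ 2)%:C.
Proof.
move=> VW [M M0 hM]; exists (2 ^+ m.+1 * cnorm (`|e m| ^+ 2) * M) => g r gE r8.
rewrite -cnormE lecR -mulrA; apply: disc_coefficient_bound => t.
have dz := disc_half t; set z := cis t / 2 in dz *.
have z1 : cnorm z <= 1 by rewrite -lecR cnormE ltW.
have [_ _ h] := hM g r z gE r8 z1.
rewrite !evB// evZ// evB// !evZ// !evE// (VW g r z gE r8 dz).
apply: le_trans h; rewrite le_eqVlt; apply/orP; left; apply/eqP; congr cnorm.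
congr (_ - _ * _); case: n {VW M M0 hM} => [|n] /=.
  by rewrite !mul0r expr0 expr1; ring.
by rewrite !exprS; ring.
Qed.

End Coefficients.
End DiscModel.

Section Models.
Context {R : realType} {K : hilbertType R}.
Local Notation C := (R[i]).
Implicit Types (rho : mob R -> K -> K) (b : R -> K).

(* kr = lambda / 2, and Gamma (n + 1) Gamma lambda / Gamma (n + lambda) = 1
   for lambda = 1. *)
Definition constant_norm_half (kr : R) (S : set R) b : Prop :=
  kr = 2^-1 -> forall x y, S x -> S y -> inner (b x) (b x) = inner (b y) (b y).

Definition total b : Prop := forall v, (forall x, inner v (b x) = 0) -> v = 0.

Lemma mob_fun_disc (g : mob R) (z : C) : disc z -> disc (mob_fun g z).
Proof.
move=> dz; rewrite /disc /= /mob_fun !normrM normfV norm_mob_rot mul1r.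
have d0 : 0 < `|1 - (mob_pt g)^* * z|.
  by rewrite normr_gt0; apply: mob_den_neq0; exact: ltW.
rewrite ltr_pdivrMr// mul1r; have := @norm_disc_add R z (- mob_pt g) dz.
rewrite normrN => /(_ (norm_mob_pt g)).
by rewrite rmorphN mulNr.
Qed.

Lemma Gamma_norm_half (lam : R) (e : nat -> K) : lam / 2 = 2^-1 ->
  orthogonal_basis e ->
  (forall n, `|e n| ^+ 2 =
     real_complex R (Gamma n.+1%:R * Gamma lam / Gamma (n%:R + lam))) ->
  forall n m, inner (e n) (e n) = inner (e m) (e m).
Proof.
move=> lamE [e0 _ _] ne; have l1 : lam = 1 by lra.
suff h n : inner (e n) (e n) = (Gamma (1 : R))%:C by move=> n m; rewrite !h.
rewrite inner_norm ne l1 natr1 mulrAC divff ?mul1r//.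
(* The Gamma factor is nonzero because otherwise the basis vector [e n] would be zero. *)
apply/eqP => G0; have := ne n; rewrite G0 !mul0r => /eqP.
by rewrite expf_eq0 /= normr_eq0 (negPf (e0 n)).
Qed.

Lemma hol_ladder rho : (forall g, unitary (rho g)) ->
  holomorphic_discrete_series rho ->
  exists (kr : R) b, [/\ 0 < kr, ladder rho kr%:C (hol kr) b,
    constant_norm_half kr (hol kr) b & total b].
Proof.
move=> rhoU [lam [ev [lam0 [ev1 ev2 ev3 [e [eb en ee]]] rep]]].
have evrot g (s : C) f z : `|s| = 1 -> mob_pair g = (s, 0) -> disc z ->
    ev (rho (mob_inv g) f) z = cis (lam / 2 * carg s) * ev f (s * z).
  move=> s1 gE dz; rewrite rep// /Rlm (mob_deriv_pow_rotation _ _ gE).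
  by rewrite (mob_deriv_norm_pow_rotation _ _ gE)// mulr1 (mob_fun_rotation _ gE).
have rotU (s : C) : `|s| = 1 -> exists U : K -> K, (forall v, `|U v| = `|v|) /\
    forall v z, disc z -> cnorm (ev (U v) z) = cnorm (ev v (s * z)).
  move=> s1; have [g gE] : exists g : mob R, mob_pair g = (s, 0).
    by apply: mob_exists; rewrite ?normr0.
  exists (rho (mob_inv g)); split; first by move=> v; exact: unitary_norm.
  by move=> v z dz; rewrite (evrot g s)// cnormM cnorm_cis mul1r.
have k0 : 0 < lam / 2 by rewrite divr_gt0.
have S1 n : n.+1%:R = n%:R + 1 :> R by rewrite natr1.
have [||||||b [hb bw tb]] := @ladder_build R K nat e (disc_deriv e lam)
  (fun n => lam / 2 + n%:R) (lam / 2)%:C rho.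
- by move=> n m /addrI /eqP; rewrite eqr_nat => /eqP.
- exact: eb.
- by move=> g; exact: unitary0.
- move=> g th n gE th1; apply: ev2 => z; rewrite inE => dz.
  rewrite (evrot g (cis th))// ?norm_cis// carg_cis// (evZ ev1)// !ee//; last first.
    by rewrite /disc /= normrM norm_cis mul1r.
  rewrite exprMn -cis_natM mulrA -cis_real_mul; congr (cis _ * _); ring.
- move=> m n; apply: (disc_expansion ev1 ev3 eb ee rotU
    (W := fun g z => mob_deriv_pow g lam z * mob_deriv_norm_pow g 0 z *
       mob_fun g z ^+ n)).
    move=> g r z gE r8 dz; rewrite rep// /Rlm ee//; exact: mob_fun_disc.
  apply: (expands_ext (expandsM (expandsM (expands_mob_deriv_pow lam)
    (expands_mob_deriv_norm_pow 0)) (expandsX n (expands_mob_fun (R := R))))) => // z.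
    by rewrite !mul1r.
  by rewrite !mul1r; ring.
- move=> b bw b0 n; rewrite /ladder_deriv /disc_deriv.
  have -> : lam / 2 + n%:R + 1 = lam / 2 + n.+1%:R by rewrite (S1 n) addrA.
  have -> : (lam / 2 + n%:R)%:C + (lam / 2)%:C = n%:R + lam%:C.
    by rewrite -realCD addrAC -splitr realCD rmorph_nat addrC.
  have -> : (lam / 2 + n%:R)%:C - (lam / 2)%:C = n%:R.
    by rewrite realCD rmorph_nat addrAC subrr add0r.
  rewrite bw; congr (_ - _); case: n => [|n]; first by rewrite !scale0r.
  by congr (_ *: _); rewrite -bw; congr b; rewrite (S1 n); ring.
exists (lam / 2), b; split => //.
move=> kh _ _ [n ->] [m ->]; rewrite !bw; exact: Gamma_norm_half eb en n m.
Qed.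

Lemma anti_ladder rho : (forall g, unitary (rho g)) ->
  antiholomorphic_discrete_series rho ->
  exists (kr : R) b, [/\ 0 < kr, ladder rho kr%:C (anti kr) b,
    constant_norm_half kr (anti kr) b & total b].
Proof.
move=> rhoU [lam [ev [lam0 [ev1 ev2 ev3 [e [eb en ee]]] rep]]].
have evrot g (s : C) f z : `|s| = 1 -> mob_pair g = (s, 0) -> disc z ->
    ev (rho (mob_inv g) f) z = cis (- (lam / 2 * carg s)) * ev f (s^* * z).
  move=> s1 gE dz; rewrite rep// (mob_deriv_pow_rotation _ _ gE) conj_cis.
  by rewrite mob_funC (mob_fun_rotation _ gE) rmorphM/= conjCK.
have rotU (s : C) : `|s| = 1 -> exists U : K -> K, (forall v, `|U v| = `|v|) /\
    forall v z, disc z -> cnorm (ev (U v) z) = cnorm (ev v (s * z)).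
  move=> s1; have [g gE] : exists g : mob R, mob_pair g = (s^*, 0).
    by apply: mob_exists; rewrite ?norm_conjC ?normr0.
  exists (rho (mob_inv g)); split; first by move=> v; exact: unitary_norm.
  by move=> v z dz; rewrite (evrot g s^*) ?norm_conjC// conjCK cnormM cnorm_cis mul1r.
have k0 : 0 < lam / 2 by rewrite divr_gt0.
have S1 n : n.+1%:R = n%:R + 1 :> R by rewrite natr1.
have [||||||b [hb bw tb]] := @ladder_build R K nat e (disc_deriv e lam)
  (fun n => - (lam / 2) - n%:R) (lam / 2)%:C rho.
- by move=> n m /addrI /oppr_inj /eqP; rewrite eqr_nat => /eqP.
- exact: eb.
- by move=> g; exact: unitary0.
- move=> g th n gE th1; apply: ev2 => z; rewrite inE => dz.
  rewrite (evrot g (cis th))// ?norm_cis// carg_cis// (evZ ev1)// !ee//; last first.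
    by rewrite /disc /= normrM norm_conjC norm_cis mul1r.
  rewrite exprMn conj_cis -cis_natM mulrA -cis_real_mul; congr (cis _ * _); ring.
- move=> m n; apply: (disc_expansion ev1 ev3 eb ee rotU
    (W := fun g z => (mob_deriv_pow g lam z^*)^* * mob_fun (mob_star g) z ^+ n)).
    move=> g r z gE r8 dz; rewrite rep// ee//; exact: mob_fun_disc.
  have X := expands_conj (expands_flip (expands_mob_fun (R := R))).
  apply: (expands_ext (expandsM (expands_conj (expands_flip (expands_mob_deriv_pow lam)))
    (expandsX n X))) => [g r z _ _ _|z|z].
  + by rewrite mob_funC.
  + by rewrite rmorph1 mul1r conjCK.
  + rewrite rmorph1 mul1r rmorphM rmorphB rmorphXn rmorph1 /= !conjCK.
    have -> : (lam%:C)^* = lam%:C by apply/conj_Creal/complex_realP; exists lam.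
    by ring.
(* With x = - kappa - n, raising the weight lowers n and the two ladder terms change roles: x +
   kappa = - n and x - kappa = - (n + lam). *)
- move=> b bw b0 n; rewrite /ladder_deriv /disc_deriv.
  have -> : - (lam / 2) - n%:R - 1 = - (lam / 2) - n.+1%:R.
    by rewrite (S1 n) opprD addrA.
  have -> : (- (lam / 2) - n%:R)%:C + (lam / 2)%:C = - n%:R.
    by rewrite -realCD addrAC addNr add0r rmorphN rmorph_nat.
  have -> : (- (lam / 2) - n%:R)%:C - (lam / 2)%:C = - (n%:R + lam%:C).
    transitivity ((- (n%:R + lam))%:C); last by rewrite rmorphN rmorphD rmorph_nat.
    by rewrite -rmorphB; congr (_%:C); lra.
  rewrite bw !scaleNr opprK addrC; congr (_ - _); case: n => [|n].
    by rewrite !scale0r.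
  by congr (_ *: _); rewrite -bw; congr b; rewrite (S1 n); ring.
exists (lam / 2), b; split => //.
move=> kh _ _ [n ->] [m ->]; rewrite !bw; exact: Gamma_norm_half eb en n m.
Qed.

End Models.

(** * Where the ladder coefficients of the continuous series vanish *)

Section ContinuousModel.
Context {R : realType} {K : hilbertType R}.
Local Notation C := (R[i]).

Lemma int_between (n : int) (a : R) : (n%:~R : R) = a -> 0 < a < 1 -> False.
Proof.
by move=> <-; rewrite ltr0z -[1]/(1%:~R) ltr_int => /andP[]; case: n => // -[].
Qed.

Definition coset (lam : R) : set R := [set x | exists n : int, x = lam / 2 + n%:~R].

(* The only reducible member of the continuous series is P_{1,0}. *)
Lemma continuous_ladder (rho : mob R -> K -> K) : (forall g, unitary (rho g)) ->
  continuous_series rho -> exists (lam : R) (k : C) (b : R -> K),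
  [/\ ladder rho k (coset lam) b, total b &
   (forall x, coset lam x -> x%:C - k != 0 /\ x%:C + k != 0) \/
   [/\ lam = 1, k = (2^-1)%:C & forall x y, coset lam x -> coset lam y ->
      inner (b x) (b x) = inner (b y) (b y)]].
Proof.
move=> rhoU [[lam [s [/andP[l1 l2] sRe rep]]]|[lam [sig [/andP[l1 l2] /andP[s1 s2] rep]]]].
  have [b [hb nb tb]] := circle_ladder rhoU rep.
  have kE : (lam / 2)%:C + (((1 - lam) / 2)%:C + s) = (2^-1)%:C + s.
    by rewrite addrA -realCD; congr (_%:C + _); lra.
  exists lam, ((2^-1)%:C + s), b; rewrite -kE; split => //; rewrite kE.
  have [[lamE s0]|ne] := pselect (lam = 1 /\ s = 0).
    right; split => //; first by rewrite s0 addr0.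
    by move=> _ _ [n ->] [m ->]; rewrite !inner_norm !nb.
  left=> x [n xE].
  have Is : complex.Im s = 0 -> s = 0.
    by case: (s) sRe => a c /= -> ->.
  (* A zero of x - kappa or x + kappa, with kappa = 1/2 + s, forces s = 0 and makes (1 - lam)/2 or
     (1 + lam)/2 an integer; for -1 < lam < 1 both lie strictly between 0 and 1. *)
  split; apply/eqP => e; apply: ne.
    have e1 := congr1 (@complex.Re R) e; have e2 := congr1 (@complex.Im R) e.
    rewrite !ReImE /= sRe in e1; rewrite !ReImE /= in e2.
    have s0 : s = 0 by apply: Is; lra.
    split => //; apply: contrapT => lne.
    have l3 : lam < 1 by rewrite lt_neqAle l2 andbT; apply/eqP.
    apply: (@int_between n (2^-1 - lam / 2)); first lra.
    lra.
  have e1 := congr1 (@complex.Re R) e; have e2 := congr1 (@complex.Im R) e.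
  rewrite !ReImE /= sRe in e1; rewrite !ReImE /= in e2.
  have s0 : s = 0 by apply: Is; lra.
  split => //; apply: contrapT => lne.
  have l3 : lam < 1 by rewrite lt_neqAle l2 andbT; apply/eqP.
  apply: (@int_between (- n) (2^-1 + lam / 2)); first by rewrite rmorphN; lra.
  lra.
have [b [hb nb tb]] := circle_ladder rhoU rep.
have kE : (lam / 2)%:C + ((1 - lam) / 2 + sig)%:C = (2^-1 + sig)%:C.
  by rewrite -realCD; congr (_%:C); lra.
exists lam, ((2^-1 + sig)%:C), b; rewrite -kE; split => //; rewrite kE.
(* Now kappa = 1/2 + sig, and sig < (1 - |lam|)/2 keeps kappa - lam/2 and kappa + lam/2 strictly
   between 0 and 1. *)
left=> x [n xE]; have := ler_norm lam; have := ler_norm (- lam); rewrite normrN.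
move=> n1 n2; split.
  rewrite -rmorphB realC_neq0//; apply/eqP => e.
  by apply: (@int_between n (2^-1 + sig - lam / 2)); lra.
rewrite -rmorphD realC_neq0//; apply/eqP => e.
by apply: (@int_between (- n) (2^-1 + sig + lam / 2)); rewrite ?rmorphN; lra.
Qed.

End ContinuousModel.

(** * Direct sums *)

Section Transport.
Context {R : realType}.
Local Notation C := (R[i]).
Implicit Types H K : hilbertType R.

Lemma ladder_transport K H (V : K -> H) (tau : mob R -> K -> K)
    (rho : mob R -> H -> H) k S b :
  linear V -> (forall x y, inner (V x) (V y) = inner x y) ->
  (forall g x, rho g (V x) = V (tau g x)) ->
  ladder tau k S b -> ladder rho k S (V \o b).
Proof.
move=> Vl Vi rV [b1 b2 b3 b4].
have VD u v : V (u + v) = V u + V v by have := Vl 1 u v; rewrite !scale1r.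
have V0 : V 0 = 0 by apply: (addrI (V 0)); rewrite -VD !addr0.
have VZ (a : C) u : V (a *: u) = a *: V u by have := Vl a u 0; rewrite !addr0 V0 addr0.
have VB u v : V (u - v) = V u - V v by rewrite VD -scaleN1r VZ scaleN1r.
split => /=.
- move=> x; rewrite b1 -(inner_eq0 (b x)) -(inner_eq0 (V (b x))) Vi //.
- by move=> x y xy; rewrite Vi b2.
- by move=> g th x gE th1; rewrite rV (b3 _ th)// VZ.
- move=> x y Sx; have [M hM] := b4 x y Sx; exists M => g r gE r8.
  have -> : rho (mob_inv g) (V (b x)) - V (b x) - r%:C *: ladder_deriv k (V \o b) x =
      V (tau (mob_inv g) (b x) - b x - r%:C *: ladder_deriv k b x).
    by rewrite !VB VZ /ladder_deriv VB !VZ rV.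
  by rewrite Vi; exact: hM.
Qed.

(** A ladder can be cut to a subset of its weights when no derivative coefficient leads out of the
    subset; this is what the equality of the two [ladder_deriv] expresses. *)
Lemma ladder_restrict H (rho : mob R -> H -> H) k (S S' : set R) b b' :
  (forall x, S' x -> S x) -> (forall g, rho g 0 = 0) ->
  (forall x, S' x -> b' x = b x) -> (forall x, ~ S' x -> b' x = 0) ->
  (forall x, S' x -> ladder_deriv k b' x = ladder_deriv k b x) ->
  ladder rho k S b -> ladder rho k S' b'.
Proof.
move=> S'S rho0 b'b b'0 dE [b1 b2 b3 b4]; split.
- move=> x; split => [S'x|]; first by rewrite b'b//; apply/b1/S'S.
  by apply: contraNP => /b'0 ->.
- move=> x y xy; have [Sx|/b'0->] := pselect (S' x); last by rewrite inner0l.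
  have [Sy|/b'0->] := pselect (S' y); last by rewrite inner0r.
  by rewrite !b'b// b2.
- move=> g th x gE th1; have [Sx|/b'0->] := pselect (S' x).
    by rewrite b'b// (b3 _ th).
  by rewrite rho0 scaler0.
- move=> x y Sx; have [Sy|/b'0->] := pselect (S' y); last first.
    by exists 0 => g r _ _; rewrite inner0r normr0 mul0r.
  have [M hM] := b4 x y (S'S _ Sx); exists M => g r gE r8.
  by rewrite dE// !b'b//; exact: hM.
Qed.

(* The ladder of P_{1,0} splits at weight 0, as D_1^+ + D_1^-. *)
Lemma ladder_split H (rho : mob R -> H -> H) b : (forall g, rho g 0 = 0) ->
  ladder rho (2^-1)%:C (coset 1) b ->
  exists bp bm : R -> H, [/\ ladder rho (2^-1)%:C (hol 2^-1) bp,
    ladder rho (2^-1)%:C (anti 2^-1) bm,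
    forall x, b x = bp x + bm x,
    forall x, hol 2^-1 x -> bp x = b x & forall x, anti 2^-1 x -> bm x = b x].
Proof.
move=> rho0 hb; have [b1 _ _ _] := hb.
have S1 n : n.+1%:R = n%:R + 1 :> R by rewrite natr1.
have hc (x : R) : hol 2^-1 x -> coset 1 x.
  by move=> [n ->]; exists n%:Z; rewrite mul1r.
have ac (x : R) : anti 2^-1 x -> coset 1 x.
  move=> [n ->]; exists (- n.+1%:Z); rewrite rmorphN/= -pmulrn (S1 n).
  by rewrite mul1r; lra.
have cha (x : R) : coset 1 x -> hol 2^-1 x \/ anti 2^-1 x.
  move=> [[n|n] ->]; first by left; exists n; rewrite mul1r.
  by right; exists n; rewrite NegzE rmorphN/= -pmulrn (S1 n) mul1r; lra.
have disj (x : R) : hol 2^-1 x -> anti 2^-1 x -> False.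
  move=> [n ->] [m e]; have := ler0n R n; have := ler0n R m; move: e; lra.
pose bp x := if pselect (hol 2^-1 x) then b x else 0.
pose bm x := if pselect (anti 2^-1 x) then b x else 0.
have bpE x : hol 2^-1 x -> bp x = b x by rewrite /bp; case: pselect.
have bmE x : anti 2^-1 x -> bm x = b x by rewrite /bm; case: pselect.
have bp0 x : ~ hol 2^-1 x -> bp x = 0 by rewrite /bp; case: pselect.
have bm0 x : ~ anti 2^-1 x -> bm x = 0 by rewrite /bm; case: pselect.
have b0 x : ~ coset 1 x -> b x = 0.
  by move=> nc; apply/eqP/negPn/negP => /b1.
exists bp, bm; split => //.
- apply: ladder_restrict hb => //.
  move=> x hx; rewrite /ladder_deriv bpE; last exact: hol_add1.
  (* At the end x = 1/2 the coefficient x - kappa of the removed neighbour is zero; for the other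
     half, x + kappa is zero at x = -1/2. *)
  congr (_ - _); case: (hx) => -[|n] xE.
    by rewrite xE addr0 subrr !scale0r.
  by rewrite bpE//; exists n; rewrite xE (S1 n); lra.
- apply: ladder_restrict hb => //.
  move=> x hx; rewrite /ladder_deriv [in X in _ - X = _]bmE; last exact: anti_sub1.
  congr (_ - _); case: (hx) => -[|n] xE.
    by rewrite xE subr0 -realCD addNr rmorph0 !scale0r.
  by rewrite bmE//; exists n; rewrite xE (S1 n); lra.
- move=> x; have [/[dup] hx /bpE ->|nh] := pselect (hol 2^-1 x).
    by rewrite bm0 ?addr0//; exact: disj.
  rewrite (bp0 x nh) add0r; have [/bmE ->//|na] := pselect (anti 2^-1 x).
  by rewrite (bm0 x na) b0// => /cha[].
Qed.

End Transport.

(** * Transport of the direct sum to the space of T *)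

Section Summands.
Context {R : realType}.
Local Notation C := (R[i]).

Lemma unitary_comp (H1 H2 H3 : hilbertType R) (U : H1 -> H2) (V : H2 -> H3) :
  unitary U -> unitary V -> unitary (V \o U).
Proof.
move=> [Ul Ui Us] [Vl Vi Vs]; split => /=.
- by move=> a x y /=; rewrite Ul Vl.
- by move=> x y; rewrite Vi Ui.
- by move=> y; have [x <-] := Vs y; have [z <-] := Us x; exists z.
Qed.

(** The embeddings [W] are named so that ladders in the summands can be moved into [H]. *)
Definition summands (I : finType) (E : I -> hilbertType R) (H : hilbertType R)
    (sigma : mob R -> H -> H) (tau : forall i, mob R -> E i -> E i)
    (W : forall i, E i -> H) : Prop :=
  [/\ forall i, linear (W i),
      forall i x y, inner (W i x) (W i y) = inner x y,
      forall i j x y, i != j -> inner (W i x) (W j y) = 0,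
      forall x, exists v : forall i, E i, x = \sum_i W i (v i)
    & forall i g x, sigma g (W i x) = W i (tau i g x)].

Section System.
Context (I : finType) (E : I -> hilbertType R) (H : hilbertType R)
  (sigma : mob R -> H -> H) (tau : forall i, mob R -> E i -> E i)
  (W : forall i, E i -> H) (b : I -> R -> H).
Arguments W : clear implicits.
Hypotheses (WS : summands sigma tau W) (bW : forall i x, exists u, b i x = W i u)
  (bsep : forall i u, (forall x, inner (W i u) (b i x) = 0) -> u = 0).

Lemma summands_orth i j x y : i != j -> inner (b i x) (b j y) = 0.
Proof.
move=> ij; have [u ->] := bW i x; have [v ->] := bW j y.
by have [_ _ h _ _] := WS; exact: h.
Qed.

Lemma summands_rep_orth i j x y g : i != j ->
  inner (sigma g (b i x)) (b j y) = 0.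
Proof.
move=> ij; have [u ->] := bW i x; have [v ->] := bW j y.
by have [_ _ h _ ->] := WS; exact: h.
Qed.

Lemma summands_total v : (forall i x, inner v (b i x) = 0) -> v = 0.
Proof.
move=> hv; have [Wl Wi Wo Ws _] := WS; have [u uE] := Ws v.
rewrite uE big1// => i _; have -> : u i = 0.
  apply: bsep => x; rewrite -(hv i x) uE inner_suml (bigD1 i)//= big1 ?addr0//.
  by move=> j ji; have [w ->] := bW i x; rewrite Wo.
by have := Wl i 1 0 0; rewrite !scale1r !addr0 => e; apply: (addrI (W i 0)); rewrite -e addr0.
Qed.

End System.
End Summands.

Section Main.
Context {R : realType}.
Local Notation C := (R[i]).

(** Pulling [rho] back by the unitary of the equivalence gives [sigma], which differs from [pi] by
    unimodular scalars; these cancel in the conjugation of [T]. *)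
Lemma summands_of_direct_sum (I : finType) (E : I -> hilbertType R)
    (H K : hilbertType R) (T : H -> H) (pi : mob R -> H -> H)
    (rho : mob R -> K -> K) (tau : forall i, mob R -> E i -> E i) :
  bounded_op T -> projective_rep pi -> associated pi T -> projective_rep rho ->
  direct_sum_rep tau rho -> equivalent_rep pi rho ->
  exists (sigma : mob R -> H -> H) (W : forall i, E i -> H),
    [/\ forall g, unitary (sigma g), associated sigma T & summands sigma tau W].
Proof.
move=> [Tl _] [piU _ _ _] piT [rhoU _ _ _] [V [Vl Vi Vo Vs Vr]] [f [U [_ f1 UU piE]]].
have UU' := adjoint_unitary UU.
have sU g : unitary (fun x => adjoint U (rho g (U x))).
  exact: unitary_comp (unitary_comp UU (rhoU g)) UU'.
exists (fun g x => adjoint U (rho g (U x))), (fun i x => adjoint U (V i x)).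
split => //.
  move=> g; apply/funext => x; rewrite piT /=; apply/eqP; rewrite -subr_eq0 -inner_eq0.
  set z := _ - _; rewrite {1}/z innerBl (adjoint_unitaryEr (piU g)).
  rewrite (adjoint_unitaryEr (sU g)) !piE.
  have T0 : T 0 = 0.
    by have := Tl 1 0 0; rewrite !scale1r !addr0 => e; apply: (addrI (T 0)); rewrite -e addr0.
  have TZ a u : T (a *: u) = a *: T u by have := Tl a u 0; rewrite !addr0 T0 addr0.
  by rewrite TZ innerZl innerZr mulrA -normCK f1 expr1n mul1r subrr.
have [Ul' Ui' _] := UU'; split.
- by move=> i a x y; rewrite Vl Ul'.
- by move=> i x y; rewrite Ui' Vi.
- by move=> i j x y ij; rewrite Ui' Vo.
- move=> x; have [v vE] := Vs (U x); exists v.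
  rewrite -[x](unitaryK UU) vE; apply: big_morph.
    by move=> u w; have := Ul' 1 u w; rewrite !scale1r.
  have := Ul' 1 0 0; rewrite !scale1r !addr0 => e.
  by apply: (addrI (adjoint U 0)); rewrite -e addr0.
- by move=> i g x; rewrite adjoint_unitaryK// Vr.
Qed.

End Main.

(** * Four discrete series summands *)

Section Cases.
Context {R : realType}.
Local Notation C := (R[i]).

Lemma uniq_full n (s : seq 'I_n) i : uniq s -> size s = n -> i \in s.
Proof.
move=> us ss; have e : #|s| = #|'I_n| by rewrite (card_uniqP us) ss card_ord.
by have /(_ (subset_predT _)) -> := subset_cardP e.
Qed.

Lemma discrete_case (I : finType) (E : I -> hilbertType R) (H : hilbertType R)
    (T : H -> H) (sigma : mob R -> H -> H) (tau : forall i, mob R -> E i -> E i)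
    (W : forall i, E i -> H) (i j k l : I) :
  bounded_op T -> spectrum T `<=` [set z | `|z| <= 1] ->
  (forall g, unitary (sigma g)) -> associated sigma T -> summands sigma tau W ->
  (forall m g, unitary (tau m g)) ->
  uniq [:: i; j; k; l] -> (forall m, m \in [:: i; j; k; l]) ->
  holomorphic_discrete_series (tau i) -> holomorphic_discrete_series (tau j) ->
  antiholomorphic_discrete_series (tau k) ->
  antiholomorphic_discrete_series (tau l) -> reducible T.
Proof.
move=> bT spT sU sT WS tU uI allI hi hj hk hl.
pose sg m := (m == i) || (m == j).
have [Wl Wi _ _ Wr] := WS.
have hsg m : sg m -> holomorphic_discrete_series (tau m).
  by case/orP => /eqP ->.
have asg m : ~~ sg m -> antiholomorphic_discrete_series (tau m).
  by rewrite /sg; have := allI m; rewrite !inE => /or4P[]/eqP-> //; rewrite eqxx ?orbT.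
pose S m (kr : R) := if sg m then hol kr else anti kr.
have /choice[d dP] : forall m, exists d : R * (R -> H),
  [/\ 0 < d.1, ladder sigma d.1%:C (S m d.1) d.2, constant_norm_half d.1 (S m d.1) d.2,
      forall x, exists u, d.2 x = W m u &
      forall u, (forall x, inner (W m u) (d.2 x) = 0) -> u = 0].
  move=> m; rewrite /S.
  have : exists kr (b : R -> E m), [/\ 0 < kr,
      ladder (tau m) kr%:C (if sg m then hol kr else anti kr) b,
      constant_norm_half kr (if sg m then hol kr else anti kr) b & total b].
    have [/hsg|/asg] := boolP (sg m); first exact: hol_ladder.
    exact: anti_ladder.
  move=> [kr [b [kr0 lb nb tb]]]; exists (kr, fun x => W m (b x)); split => //=.
  - exact: ladder_transport lb.
  - by move=> e x y Sx Sy; rewrite !Wi; exact: nb.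
  - by move=> x; exists (b x).
  - by move=> u hu; apply: tb => x; rewrite -(Wi m).
pose b m := (d m).2; pose kr m := (d m).1.
have bW m x : exists u, b m x = W m u.
  by have [_ _ _ h _] := dP m; exact: h.
have bsep m u : (forall x, inner (W m u) (b m x) = 0) -> u = 0.
  by have [_ _ _ _ h] := dP m; exact: h.
move: uI => /= /and4P[]; rewrite !inE !negb_or => /and3P[ij ik il] /andP[jk jl] kl _.
apply: (@reducible_discrete _ _ I T sigma (fun m => (kr m)%:C) (fun m => S m (kr m)) b
  bT sU sT spT _ _ _ _ sg kr i j k l) => //.
- by move=> m; have [] := dP m.
- exact: summands_orth WS bW.
- move=> m n x y mn _; exists 0 => g r _ _.
  by rewrite (summands_rep_orth WS bW)// normr0 mul0r.
- exact: summands_total WS bW bsep.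
- by move=> m; have [] := dP m.
- by move=> m; rewrite /S => ->.
- by move=> m; rewrite /S => /negbTE ->.
- by rewrite /sg eqxx.
- by rewrite /sg eqxx orbT.
- by rewrite /sg negb_or eq_sym ik eq_sym jk.
- by rewrite /sg negb_or eq_sym il eq_sym jl.
- by move=> m /orP[]/eqP; [left | right].
- move=> m; have := allI m; rewrite !inE /sg => /or4P[]/eqP->.
  + by rewrite eqxx.
  + by rewrite eqxx orbT.
  + by left.
  + by right.
- by move=> m; have [] := dP m.
Qed.

End Cases.

(** * One continuous series summand, P_{1,0} included *)

Section ContinuousCase.
Context {R : realType}.
Local Notation C := (R[i]).

(** If the zeroth and first order terms are orthogonal to [b y], only the error of the ladder
    remains. This gives the cross condition for the two halves of P_{1,0}. *)
Lemma ladder_orth_rep (H : hilbertType R) (rho : mob R -> H -> H) k S (b : R -> H)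
    (x y : R) :
  ladder rho k S b -> S x -> x != y -> inner (ladder_deriv k b x) (b y) = 0 ->
  exists M : R, forall g r, mob_pair g = (1, r%:C) -> 0 < r < 8^-1 ->
    `|inner (rho (mob_inv g) (b x)) (b y)| <= (M * r ^+ 2)%:C.
Proof.
move=> [_ ob _ eb] Sx xy h; have [M hM] := eb x y Sx; exists M => g r gr r0.
have := hM g r gr r0; rewrite !innerBl innerZl h ob// mulr0 !subr0; exact.
Qed.

Section Data.
Context (I : finType) (E : I -> hilbertType R) (H : hilbertType R)
  (T : H -> H) (sigma : mob R -> H -> H) (tau : forall i, mob R -> E i -> E i)
  (W : forall i, E i -> H) (q p m : I).
Arguments W : clear implicits.
Arguments tau : clear implicits.
Hypotheses (bT : bounded_op T) (spT : spectrum T `<=` [set z | `|z| <= 1])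
  (sU : forall g, unitary (sigma g)) (sT : associated sigma T)
  (WS : summands sigma tau W) (qp : q != p) (qm : q != m) (pm : p != m)
  (allI : forall l, [\/ l = q, l = p | l = m]).

(** The triple holds kappa, the set of weights and the weight vectors inside [H]; the last two
    conditions place these vectors in the image of the summand and make them total there. *)
Definition summand_ladder i (d : C * set R * (R -> H)) : Prop :=
  [/\ ladder sigma d.1.1 d.1.2 d.2, forall x, exists u, d.2 x = W i u &
      forall u, (forall x, inner (W i u) (d.2 x) = 0) -> u = 0].

Context (dq dp dm : C * set R * (R -> H)) (kp km : R).
Hypotheses (hq : summand_ladder q dq) (hp : summand_ladder p dp)
  (hm : summand_ladder m dm).

Definition pick_ladder i : C * set R * (R -> H) :=
  if i == q then dq else if i == p then dp else dm.

Let pq : pick_ladder q = dq. Proof. by rewrite /pick_ladder eqxx. Qed.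
Let pp : pick_ladder p = dp. Proof. by rewrite /pick_ladder eq_sym (negbTE qp) eqxx. Qed.
Let pm' : pick_ladder m = dm.
Proof. by rewrite /pick_ladder eq_sym (negbTE qm) eq_sym (negbTE pm). Qed.

Let pick_ladderP i : summand_ladder i (pick_ladder i).
Proof. by case: (allI i) => ->; rewrite ?pq ?pp ?pm'. Qed.

Let bW i x : exists u, (pick_ladder i).2 x = W i u.
Proof. by have [_ h _] := pick_ladderP i; exact: h. Qed.

Let bsep i u : (forall x, inner (W i u) ((pick_ladder i).2 x) = 0) -> u = 0.
Proof. by have [_ _ h] := pick_ladderP i; exact: h. Qed.

Hypotheses (kp0 : 0 < kp) (km0 : 0 < km) (dpk : dp.1 = (kp%:C, hol kp))
  (dmk : dm.1 = (km%:C, anti km)).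

Lemma generic_case lam : dq.1.2 = coset lam ->
  (forall x, coset lam x -> x%:C - dq.1.1 != 0 /\ x%:C + dq.1.1 != 0) ->
  reducible T.
Proof.
move=> dqS hk.
apply: (@reducible_continuous _ _ I T sigma (fun i => (pick_ladder i).1.1)
  (fun i => (pick_ladder i).1.2) (fun i => (pick_ladder i).2) bT sU sT spT _ _ _ _
  q p m kp km) => //.
- by move=> i; have [] := pick_ladderP i.
- exact: summands_orth WS bW.
- move=> i j x y ij _; exists 0 => g r _ _.
  by rewrite (summands_rep_orth WS bW)// normr0 mul0r.
- exact: summands_total WS bW bsep.
- by rewrite pp dpk.
- by rewrite pm' dmk.
- by rewrite pp dpk.
- by rewrite pm' dmk.
- by rewrite pq dqS; exists (lam / 2), 0; rewrite addr0.
- rewrite pq dqS => x; split => -[n e].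
    by exists (n + 1); rewrite e rmorphD/= addrA.
  by exists (n - 1); rewrite rmorphB/= addrA -e addrK.
- by rewrite pq dqS.
Qed.

Hypotheses (np : constant_norm_half kp (hol kp) dp.2)
  (nm : constant_norm_half km (anti km) dm.2).

(** P_{1,0} is cut in two and the system is read as four discrete summands indexed by [option I]:
    [Some q] is the holomorphic half, [None] the anti-holomorphic one. Both halves lie in the same
    summand [q], so their orthogonality under boosts, up to second order, comes from the ladder and
    not from the direct sum. *)
Lemma degenerate_case : dq.1 = ((2^-1)%:C, coset 1) ->
  (forall x y, coset 1 x -> coset 1 y -> inner (dq.2 x) (dq.2 x) = inner (dq.2 y) (dq.2 y)) ->
  reducible T.
Proof.
move=> dqE nq; have [lq _ _] := hq; rewrite dqE /= in lq.
have s0 g : sigma g 0 = 0 by exact: unitary0.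
have [bp [bm [lbp lbm bE bpE bmE]]] := ladder_split s0 lq.
have bp0 x : bp x != 0 -> hol 2^-1 x by have [h _ _ _] := lbp; move/h.
have bm0 x : bm x != 0 -> anti 2^-1 x by have [h _ _ _] := lbm; move/h.
have S1 n : n.+1%:R = n%:R + 1 :> R by rewrite natr1.
have hc (x : R) : hol 2^-1 x -> coset 1 x.
  by move=> [n ->]; exists n%:Z; rewrite mul1r.
have ac (x : R) : anti 2^-1 x -> coset 1 x.
  move=> [n ->]; exists (- n.+1%:Z); rewrite rmorphN/= -pmulrn (S1 n).
  by rewrite mul1r; lra.
have hx_ay (x y : R) : hol 2^-1 x -> anti 2^-1 y -> x != y.
  by move=> /hol_ge x0 /anti_le y0; apply/eqP => xy; move: x0 y0 xy; lra.
have [_ oq _ _] := lq.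
have obpm x y : inner (bp x) (bm y) = 0.
  have [->|/bp0 hx] := eqVneq (bp x) 0; first by rewrite inner0l.
  have [->|/bm0 hy] := eqVneq (bm y) 0; first by rewrite inner0r.
  by rewrite bpE// bmE// oq// hx_ay.
pose k (i : option I) : R := if i is Some l then (if l == q then 2^-1 else
  if l == p then kp else km) else 2^-1.
pose sg (i : option I) := if i is Some l then l != m else false.
pose S (i : option I) := if sg i then hol (k i) else anti (k i).
pose b (i : option I) : R -> H := if i is Some l then
  (if l == q then bp else (pick_ladder l).2) else bm.
pose o (i : option I) := odflt q i.
have SE i : S i = if sg i then hol (k i) else anti (k i) by [].
have lad i : ladder sigma (k i)%:C (S i) (b i).
  case: i => [l|] //; rewrite /S /b /k /=; have [->|nlq] := eqVneq l q; first by rewrite qm.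
  have [->|nlp] := eqVneq l p; first by rewrite pm pp; case: hp => h _ _; rewrite dpk in h.
  have -> : l = m by case: (allI l) => // e; move: nlq nlp; rewrite e eqxx.
  by rewrite eqxx pm'; case: hm => h _ _; rewrite dmk in h.
have [Wl _ Wo _ Wr] := WS; have [_ dqW _] := hq.
have W0 : W q 0 = 0.
  by have := Wl q 1 0 0; rewrite !scale1r !addr0 => e; apply: (addrI (W q 0)); rewrite -e addr0.
have bo i x : exists u, b i x = W (o i) u.
  case: i => [l|]; rewrite /b /=.
    have [->|nlq] := eqVneq l q; last exact: bW.
    have [->|/bp0 hx] := eqVneq (bp x) 0; first by exists 0.
    by rewrite bpE.
  have [->|/bm0 hx] := eqVneq (bm x) 0; first by exists 0.
  by rewrite bmE.
have same i j : i != j -> o i = o j -> (i = Some q /\ j = None) \/ (i = None /\ j = Some q).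
  case: i => [i|]; case: j => [j|] //=.
  - by move=> ij e; move: ij; rewrite e eqxx.
  - by move=> _ ->; left.
  - by move=> _ <-; right.
have bq : b (Some q) = bp by rewrite /b eqxx.
have bN : b None = bm by [].
have SN : S None = anti 2^-1 by [].

have Sq : S (Some q) = hol 2^-1 by rewrite /S /= qm /k eqxx.
apply: (@reducible_discrete _ _ (option I) T sigma (fun i => (k i)%:C) S b
  bT sU sT spT lad _ _ _ sg k (Some q) (Some p) None (Some m)) => //.
- move=> i j x y ij; have [/(same _ _ ij)[[-> ->]|[-> ->]]|oij] := eqVneq (o i) (o j).
  + by rewrite bq obpm.
  + by rewrite innerC bq obpm rmorph0.
  + by have [u ->] := bo i x; have [v ->] := bo j y; exact: Wo.
(* The halves could be linked only between the weights 1/2 and -1/2, where the coefficient x - 1/2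
   or x + 1/2 is zero. *)
- move=> i j x y ij Six; have [/(same _ _ ij)|oij] := eqVneq (o i) (o j); last first.
    exists 0 => g r _ _; have [u ->] := bo i x; have [v ->] := bo j y.
    by rewrite Wr Wo// normr0 mul0r.
  move=> [[iE jE]|[iE jE]]; move: Six; rewrite iE jE bq bN ?Sq ?SN => hx.
    have [->|/bm0 hy] := eqVneq (bm y) 0.
      by exists 0 => g r _ _; rewrite inner0r normr0 mul0r.
    rewrite bpE// bmE//; apply: ladder_orth_rep lq (hc _ hx) (hx_ay _ _ hx hy) _.
    rewrite /ladder_deriv innerBl !innerZl oq ?mulr0; last exact: hx_ay (hol_add1 hx) hy.
    have [e|ne] := eqVneq (x - 1) y; last by rewrite oq// mulr0 subr0.
    have -> : x = 2^-1 by move: (hol_ge hx) (anti_le hy) e; lra.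
    by rewrite subrr mul0r subr0.
  have [->|/bp0 hy] := eqVneq (bp y) 0.
    by exists 0 => g r _ _; rewrite inner0r normr0 mul0r.
  rewrite bpE// (bmE _ hx); apply: ladder_orth_rep lq (ac _ hx) _ _.
    by rewrite eq_sym; exact: hx_ay hy hx.
  rewrite /ladder_deriv innerBl !innerZl [in X in _ - X]oq ?mulr0 ?subr0; last first.
    by rewrite eq_sym; exact: hx_ay hy (anti_sub1 hx).
  have [e|ne] := eqVneq (x + 1) y; last by rewrite oq// mulr0.
  have -> : x = - 2^-1 by move: (hol_ge hy) (anti_le hx) e; lra.
  by rewrite -realCD addNr mul0r.
- move=> v hv; apply: (summands_total WS bW bsep) => i x.
  have [->|niq] := eqVneq i q.
    by rewrite pq bE innerDr -bq hv (hv None) addr0.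
  by have := hv (Some i) x; rewrite /b (negbTE niq).
- case=> [l|]; rewrite /k ?invr_gt0 ?ltr0n//.
  by case: ifP; rewrite ?invr_gt0 ?ltr0n//; case: ifP.
- by move=> i; rewrite /S => ->.
- by move=> i; rewrite /S => /negbTE ->.
- by rewrite /sg eqxx.
- case=> [l|]//= lm; case: (allI l) => e; rewrite e; [by left | by right |].
  by move: lm; rewrite e eqxx.
- by case=> [l|]/=; [rewrite negbK => /eqP->; right | left].
- case=> [l|] kl x y.
    rewrite /S /b /=; move: kl; rewrite /k; have [->|nlq] := eqVneq l q.
      by rewrite qm => _ hx hy; rewrite !bpE//; apply: nq; exact: hc.
    have [->|nlp] := eqVneq l p; first by rewrite pm pp => e; exact: np.
    have -> : l = m by case: (allI l) => // e; move: nlq nlp; rewrite e eqxx.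
    by rewrite eqxx pm' => e; exact: nm.
  by move=> hx hy; rewrite /b !bmE//; apply: nq; exact: ac.
Qed.

End Data.
End ContinuousCase.
Lemma continuous_case (R : realType) (I : finType) (E : I -> hilbertType R)
    (H : hilbertType R) (T : H -> H) (sigma : mob R -> H -> H)
    (tau : forall i, mob R -> E i -> E i) (W : forall i, E i -> H) (q p m : I) :
  bounded_op T -> spectrum T `<=` [set z | `|z| <= 1] ->
  (forall g, unitary (sigma g)) -> associated sigma T -> summands sigma tau W ->
  (forall i g, unitary (tau i g)) ->
  uniq [:: q; p; m] -> (forall i, i \in [:: q; p; m]) ->
  continuous_series (tau q) -> holomorphic_discrete_series (tau p) ->
  antiholomorphic_discrete_series (tau m) -> reducible T.
Proof.
move=> bT spT sU sT WS tU uI allI cq hp hm; have [Wl Wi _ _ Wr] := WS.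
move: uI => /= /and3P[]; rewrite !inE negb_or => /andP[qp qm] pm _.
have {}allI i : [\/ i = q, i = p | i = m].
  by have := allI i; rewrite !inE => /or3P[]/eqP->; [exact: Or31|exact: Or32|exact: Or33].
have sum i k S (b : R -> E i) : ladder (tau i) k S b -> total b ->
    summand_ladder sigma W i (k, S, fun x => W i (b x)).
  move=> lb tb; split=> /=.
  - exact: ladder_transport lb.
  - by move=> x; exists (b x).
  - by move=> u hu; apply: tb => x; rewrite -(Wi i).
have [lam [k [b [lb tb alt]]]] := continuous_ladder (tU q) cq.
have [kp [bp [kp0 lbp np tp]]] := hol_ladder (tU p) hp.
have [km [bm [km0 lbm nm tm]]] := anti_ladder (tU m) hm.
case: alt => [alt|[lam1 k1 nq]].
  exact: (generic_case bT spT sU sT WS qp qm pm allI (sum _ _ _ _ lb tb)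
    (sum _ _ _ _ lbp tp) (sum _ _ _ _ lbm tm) km0 erefl erefl erefl alt).
apply: (degenerate_case bT spT sU sT WS qp qm pm allI (sum _ _ _ _ lb tb)
    (sum _ _ _ _ lbp tp) (sum _ _ _ _ lbm tm) kp0 km0 erefl erefl) => /=.
- by move=> e x y hx hy; rewrite !Wi; exact: np.
- by move=> e x y hx hy; rewrite !Wi; exact: nm.
- by rewrite k1 lam1.
- by move=> x y hx hy; rewrite !Wi; apply: nq; rewrite lam1.
Qed.

Theorem mainTheorem2 (R : realType) (H : hilbertType R) (T : H -> H)
    (pi : mob R -> H -> H)
    (boundedT : bounded_op T) (homogeneousT : homogeneous T)
    (projective_pi : projective_rep pi) (associated_pi : associated pi T)
    (form_pi :
      (exists (E : 'I_3 -> hilbertType R) (tau : forall i, mob R -> E i -> E i)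
              (K : hilbertType R) (rho : mob R -> K -> K),
        [/\ forall i, projective_rep (tau i) /\ irreducible_rep (tau i),
            exists i j k : 'I_3,
              [/\ uniq [:: i; j; k], continuous_series (tau i),
                  holomorphic_discrete_series (tau j)
                & antiholomorphic_discrete_series (tau k)],
            projective_rep rho, direct_sum_rep tau rho
          & equivalent_rep pi rho])
      \/
      (exists (E : 'I_4 -> hilbertType R) (tau : forall i, mob R -> E i -> E i)
              (K : hilbertType R) (rho : mob R -> K -> K),
        [/\ forall i, projective_rep (tau i),
            exists i j k l : 'I_4,
              [/\ uniq [:: i; j; k; l],
                  holomorphic_discrete_series (tau i),
                  holomorphic_discrete_series (tau j),
                  antiholomorphic_discrete_series (tau k)
                & antiholomorphic_discrete_series (tau l)],
            projective_rep rho, direct_sum_rep tau rho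
          & equivalent_rep pi rho])) :
  reducible T.
Proof.
have [spT _] := homogeneousT.
case: form_pi => -[E [tau [K [rho [tauP]]]]].
  move=> [i [j [k [uI hi hj hk]]]] rhoP ds eq.
  have [sigma [W [sU sT WS]]] :=
    summands_of_direct_sum boundedT projective_pi associated_pi rhoP ds eq.
  apply: (continuous_case boundedT spT sU sT WS _ uI _ hi hj hk).
    by move=> l; have [[]] := tauP l.
  by move=> l; exact: uniq_full.
move=> [i [j [k [l [uI hi hj hk hl]]]]] rhoP ds eq.
have [sigma [W [sU sT WS]]] :=
  summands_of_direct_sum boundedT projective_pi associated_pi rhoP ds eq.
apply: (discrete_case boundedT spT sU sT WS _ uI _ hi hj hk hl).
  by move=> a; have [] := tauP a.
by move=> a; exact: uniq_full.
Qed.
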